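(* Let $N$ be a square-free positive integer, let $m$ be a positive integer, and let $\varphi_N(m,s)$ denote the $m$-th coefficient in the Fourier series expansion $$\mathcal{E}_\infty(z,s)=y^s+\varphi_N(s)y^{1-s}+\sum_{m\ne0}\varphi_N(m,s)W_s(mz),\qquad \mathrm{Re}(s)>1,$$ of the real analytic Eisenstein series of $\Gamma_0(N)^+$. Then $\varphi_N(m,s)$ can be meromorphically continued from the half plane $\mathrm{Re}(s)>1$ to the whole complex plane by the equation $$\varphi_N(m,s)=\pi^s\frac{m^{s-1}}{\Gamma(s)}\cdot\frac{\sigma_{1-2s}(m)}{\zeta(2s)}\cdot D_N(m,s).$$
   Context: $\mathbb{H}$ is the upper half plane, $z=x+iy$, $e(z)=e^{2\pi i z}$. For a square-free positive integer $N$, $$\Gamma_0(N)^+=\left\{ e^{-1/2}\begin{pmatrix} a & b\\ c& d\end{pmatrix}\in \mathrm{SL}(2,\mathbb{R}):\ ad-bc=e,\ a,b,c,d,e\in\mathbb{Z},\ e\mid N,\ e\mid a,\ e\mid d,\ N\mid c\right\}$$ (with $e>0$), and $\Gamma_\infty(N)$ is its parabolic subgroup, i.e. the stabilizer of $i\infty$ (equal to $\{\pm\begin{pmatrix}1&n\\0&1\end{pmatrix}:n\in\mathbb{Z}\}$). For $\mathrm{Re}(s)>1$, $$\mathcal{E}_\infty(z,s)=\sum_{\gamma\in\Gamma_\infty(N)\backslash\Gamma_0(N)^+}\mathrm{Im}(\gamma z)^s .$$ The Whittaker function is $W_s(mz)=2\sqrt{|m|y}\,K_{s-1/2}(2\pi|m|y)\,e(mx)$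 with $K$ the $K$-Bessel function. $\sigma_\alpha(m)=\sum_{\delta\mid m}\delta^\alpha$. For a prime $p$ let $\alpha_p\ge0$ be the integer with $p^{\alpha_p}\mid m$, $p^{\alpha_p+1}\nmid m$, and set $$F_p(m,s)=\left(1-\frac1{p^s}\right)\left(1+\frac1{p^{s-1}}+\dots+\frac1{p^{\alpha_p(s-1)}}\right),$$ $$D_N(m,s)=\sum_{v\mid N}v^{-s}\prod_{p\mid v}F_p(m,2s)^{-1}\prod_{p\mid (N/v)}\left(1-F_p(m,2s)^{-1}\right),$$ where $v$ runs over positive divisors of $N$ and $p$ over primes. *)

(* Defs.v *)
From HB Require Import structures.
From mathcomp Require Import all_boot all_order all_algebra.
From mathcomp Require Import all_classical all_reals all_analysis.
From mathcomp.analysis.showcase Require Import summability.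

Set Implicit Arguments.
Unset Strict Implicit.
Unset Printing Implicit Defensive.

Import Order.TTheory GRing.Theory Num.Theory.
Import numFieldNormedType.Exports.
(* after Num.Theory, so that Re and Im are the projections R[i] -> R *)
From mathcomp Require Import complex.

Local Open Scope classical_set_scope.
Local Open Scope ring_scope.
Local Open Scope complex_scope.

Section ComplexAnalysis.
Context {R : realType}.
Implicit Types (s z nu : R[i]) (t y : R).

Definition cexp z : R[i] :=
  (expR (Re z) * cos (Im z)) +i* (expR (Re z) * sin (Im z)).

(* t ^ s for t > 0 *)
Definition cpow t s : R[i] := cexp (s * (ln t)%:C).

Definition e z : R[i] := cexp ((0 +i* (2 * pi)) * z).

Definition cintegral (D : set R) (f : R -> R[i]) : R[i] :=
  (\int[@lebesgue_measure R]_(t in D) Re (f t)) +i*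
  (\int[@lebesgue_measure R]_(t in D) Im (f t)).

(* The topology of R[i] is carried by its copy R[i]^o as a normed module over
   itself, so that derivable f z 1 is complex differentiability at z *)
Definition holomorphic_at (f : R[i] -> R[i]) z :=
  \forall w \near (z : R[i]^o), derivable (f : R[i]^o -> R[i]^o) w 1.

(* The condition is on punctured neighbourhoods: the values of f at its poles
   and at removable singularities (where division by 0 returns 0) are
   irrelevant *)
Definition meromorphic_at (f : R[i] -> R[i]) z :=
  exists (k : nat) (g : R[i] -> R[i]), holomorphic_at g z /\
    \forall w \near (z : R[i]^o)^', (w - z) ^+ k * f w = g w.

Definition meromorphic_continuation (U : set R[i]) (f g : R[i] -> R[i]) :=
  (forall z, meromorphic_at g z) /\ (forall z, U z -> f z = g z).

(* Euler's integral, convergent for 0 < Re s *)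
Definition gamma_integral s : R[i] :=
  cintegral `]0, +oo[ (fun t => cpow t (s - 1) * (expR (- t))%:C).

(* Continuation by Gamma(s) = Gamma(s + n) / (s (s + 1) ... (s + n - 1)), which
   does not depend on n as long as 0 < Re (s + n) *)
Definition Gamma s : R[i] :=
  let n := (Num.truncn `|Re s|).+1 in
  gamma_integral (s + n%:R) / \prod_(k < n) (s + k%:R).

Definition is_zeta (f : R[i] -> R[i]) :=
  (forall s, s != 1 -> holomorphic_at f s) /\
  (forall s, 1 < Re s ->
     (series (fun n => cpow n.+1%:R (- s) : R[i]^o) : nat -> R[i]^o)
       @ \oo --> (f s : R[i]^o)).

(* The analytic continuation of the Dirichlet series; it is unique away from
   the pole 1, at which the value is unspecified *)
Definition zeta : R[i] -> R[i] := xget (fun=> 0) is_zeta.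

(* K_nu(y) = \int_0^oo exp(- y cosh t) cosh(nu t) dt for 0 < y *)
Definition besselK nu y : R[i] :=
  cintegral `[0, +oo[ (fun t =>
    (expR (- (y * ((expR t + expR (- t)) / 2))))%:C *
    ((cexp (nu * t%:C) + cexp (- (nu * t%:C))) / 2)).

(* W_s(mz) *)
Definition whittaker s (m : int) z : R[i] :=
  2 * (Num.sqrt (`|m|%:~R * Im z))%:C *
  besselK (s - 2^-1) (2 * pi * `|m|%:~R * Im z) * e (m%:~R * (Re z)%:C).

End ComplexAnalysis.

Definition squarefree (N : nat) :=
  forall p : nat, prime p -> ~~ (p ^ 2 %| N)%N.

Section Eisenstein.
Variable R : realType.
Implicit Types (g : 'M[R]_2) (s z : R[i]).

Definition mx2 (a b c d : R) : 'M[R]_2 :=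
  \matrix_(i, j) if i == 0 then if j == 0 then a else b
                 else if j == 0 then c else d.

Definition Gamma0plus (N : nat) : set 'M[R]_2 :=
  [set g | exists (a b c d : int) (e : nat),
     [/\ (0 < e)%N, a * d - b * c = e%:Z & (e %| N)%N] /\
     [/\ (e %| a)%Z, (e %| d)%Z, (N %| c)%Z &
       g = (Num.sqrt e%:R)^-1 *: mx2 a%:~R b%:~R c%:~R d%:~R]].

(* The stabilizer of the cusp i oo *)
Definition Gamma_infty (N : nat) : set 'M[R]_2 :=
  Gamma0plus N `&` [set g | g 1 0 = 0].

Definition right_coset (H : set 'M[R]_2) g : set 'M[R]_2 :=
  [set h *m g | h in H].

(* Gamma_infty(N) \ Gamma_0(N)^+ *)
Definition cosets (N : nat) : set (set 'M[R]_2) :=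
  [set right_coset (Gamma_infty N) g | g in Gamma0plus N].

Definition mobius g z : R[i] :=
  ((g 0 0)%:C * z + (g 0 1)%:C) / ((g 1 0)%:C * z + (g 1 1)%:C).

(* The summand Im(gamma z)^s depends only on the coset K of gamma, of which
   xget picks a representative; the sum is unordered *)
Definition eisenstein (N : nat) z s : R[i] :=
  summability.sum (fun K : set 'M[R]_2 =>
    (if K \in cosets N then cpow (Im (mobius (xget 1%:M K) z)) s else 0)
    : R[i]^o).

(* phi0 and phi are the coefficients of the Fourier expansion of the Eisenstein
   series in the half plane 1 < Re s, where it converges absolutely, i.e. as an
   unordered sum over the nonzero integers *)
Definition eisenstein_fourier_coefs (N : nat)
    (phi0 : R[i] -> R[i]) (phi : int -> R[i] -> R[i]) :=
  forall s, 1 < Re s -> forall z, 0 < Im z ->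
    partial_sum (fun m : int =>
      (if m == 0 then 0 else phi m s * whittaker s m z) : R[i]^o) @ totally -->
    (eisenstein N z s - cpow (Im z) s - phi0 s * cpow (Im z) (1 - s) : R[i]^o).

End Eisenstein.

Section Coefficients.
Variable R : realType.
Implicit Types s alpha : R[i].

Definition sigma alpha (m : nat) : R[i] :=
  \sum_(d <- divisors m) cpow d%:R alpha.

Definition Fp (p m : nat) s : R[i] :=
  (1 - (cpow p%:R s)^-1) *
  \sum_(j < (logn p m).+1) (cpow p%:R (j%:R * (s - 1)))^-1.

Definition DN (N m : nat) s : R[i] :=
  \sum_(v <- divisors N) cpow v%:R (- s) *
    (\prod_(p <- primes v) (Fp p m (2 * s))^-1) *
    (\prod_(p <- primes (N %/ v)) (1 - (Fp p m (2 * s))^-1)).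

End Coefficients.

(* Main.v *)
Require Import Defs.
From HB Require Import structures.
From mathcomp Require Import all_boot all_order all_algebra.
From mathcomp Require Import all_classical all_reals all_analysis.
From mathcomp Require Import measurable_realfun.
From mathcomp Require Import finmap ring lra zify.
From mathcomp.analysis.showcase Require Import summability.

Set Implicit Arguments.
Unset Strict Implicit.
Unset Printing Implicit Defensive.

Import Order.TTheory GRing.Theory Num.Theory.
Import numFieldNormedType.Exports.
From mathcomp Require Import complex.

Local Open Scope classical_set_scope.
Local Open Scope ring_scope.
Local Open Scope complex_scope.

(** The coefficient is found by unfolding.  A coset of Gamma_infty(N) consists of
    the matrices with a given bottom row sqrt e (q, d), up to sign, where e
    divides N, N / e divides q and e d is prime to q (cosets_row); it contributes
    (y / (e |q z + d|^2)) ^ s to the Eisenstein series (Im_row_coset).  In the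
    integral of the series against e(- m x) over a period, write d = r + k q: the
    translates by k turn the period into the real line (ccvg_translate_coef), and
    the residues r yield the Ramanujan sum c_q(m) (ccvg_row_term_coef).  The
    integral over the line is the Fourier transform I of (x^2 + y^2) ^ (- s), and
    fourier_coefficient compares the two sides of the expansion:
      phi(m, s) 2 sqrt(m y) K(2 pi m y)
        = y^s I sum_(e | N) e^(- s) sum_(N/e | q, (q, e) = 1) c_q(m) q^(- 2 s).

    The transform is computed by writing the power as a Gamma integral of
    Gaussians: Gamma(s) I is again the Bessel function, up to elementary factors
    (fourier_bessel).  As K does not vanish at every height (besselK_neq0), it can
    be cancelled, which leaves pi^s m^(s - 1) / Gamma(s).

    For the arithmetic factor, the Ramanujan sums add up over the divisors of k
    to k or 0 according as k divides m, so that the Dirichlet series of c_q(m)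
    times zeta(2 s) is sigma_(1 - 2 s)(m) (ramanujan_series_zeta).  Restricting
    the moduli q to those prime to p removes Euler factors, which divides the
    series by F_p; restricting to the multiples of p therefore multiplies it by
    1 - 1 / F_p.  Summing over e gives D_N (ramanujan_series_DN).

    Meromorphy of the right-hand side needs Gamma and zeta on the whole plane, and
    that inverses of meromorphic functions are meromorphic (meromorphicV), which
    holds because the zeros of a holomorphic function have finite order
    (hol_zero_dichotomy).  This local theory is derived from Cauchy's formula,
    and that from Goursat's argument for a homotopy of circles.  Gamma is a Laplace
    transform in the variable ln t.  The continuation of (s - 1) zeta(s)
    (zeta_entire) comes from the telescoping sum of n^(1 - s) - (n + 1)^(1 - s),
    expanded in powers of 1 / n. *)

Local Notation normc := Normc.normc.

(** * Complex numbers *)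

Section ComplexBasics.
Context {R : realType}.
Implicit Types (w z s : R[i]) (t x y : R).

Lemma ReD w z : Re (w + z) = Re w + Re z. Proof. by case: w z => ? ? []. Qed.
Lemma ImD w z : Im (w + z) = Im w + Im z. Proof. by case: w z => ? ? []. Qed.
Lemma ReN z : Re (- z) = - Re z. Proof. by case: z. Qed.
Lemma ImN z : Im (- z) = - Im z. Proof. by case: z. Qed.
Lemma ReB w z : Re (w - z) = Re w - Re z. Proof. by rewrite ReD ReN. Qed.
Lemma ImB w z : Im (w - z) = Im w - Im z. Proof. by rewrite ImD ImN. Qed.
Lemma ReM w z : Re (w * z) = Re w * Re z - Im w * Im z.
Proof. by case: w z => ? ? []. Qed.
Lemma ImM w z : Im (w * z) = Re w * Im z + Im w * Re z.
Proof. by case: w z => ? ? []. Qed.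
Lemma ReC x : Re (x%:C) = x. Proof. by []. Qed.
Lemma ImC x : Im (x%:C) = 0. Proof. by []. Qed.
Lemma Re0 : Re (0 : R[i]) = 0. Proof. by []. Qed.
Lemma Im0 : Im (0 : R[i]) = 0. Proof. by []. Qed.
Lemma Re1 : Re (1 : R[i]) = 1. Proof. by []. Qed.
Lemma Im1 : Im (1 : R[i]) = 0. Proof. by []. Qed.
Lemma natC n : (n%:R : R[i]) = (n%:R : R)%:C. Proof. by rewrite rmorph_nat. Qed.
Lemma ReMC w x : Re (w * x%:C) = Re w * x.
Proof. by rewrite ReM ReC ImC mulr0 subr0. Qed.
Lemma ImMC w x : Im (w * x%:C) = Im w * x.
Proof. by rewrite ImM ReC ImC mulr0 add0r. Qed.
Lemma ReCM x w : Re (x%:C * w) = x * Re w.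
Proof. by rewrite mulrC ReMC mulrC. Qed.
Lemma ImCM x w : Im (x%:C * w) = x * Im w.
Proof. by rewrite mulrC ImMC mulrC. Qed.

Lemma eqC w z : Re w = Re z -> Im w = Im z -> w = z.
Proof. by case: w z => a b [c d] /= -> ->. Qed.

Lemma Re_sum (I : Type) (r : seq I) (P : pred I) (F : I -> R[i]) :
  Re (\sum_(i <- r | P i) F i) = \sum_(i <- r | P i) Re (F i).
Proof. exact: (big_morph (fun z : R[i] => Re z) ReD Re0). Qed.

Lemma Im_sum (I : Type) (r : seq I) (P : pred I) (F : I -> R[i]) :
  Im (\sum_(i <- r | P i) F i) = \sum_(i <- r | P i) Im (F i).
Proof. exact: (big_morph (fun z : R[i] => Im z) ImD Im0). Qed.

Lemma normCE z : `|z| = (normc z)%:C. Proof. by case: z. Qed.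
Lemma normc_ge0 z : 0 <= normc z. Proof. by case: z => ? ?; rewrite sqrtr_ge0. Qed.
Lemma normcD w z : normc (w + z) <= normc w + normc z.
Proof. exact: le_normcD. Qed.
Lemma normcB w z : normc (w - z) <= normc w + normc z.
Proof. by rewrite -[normc z]normcN; exact: le_normcD. Qed.
Lemma normc_distC w z : normc (w - z) = normc (z - w).
Proof. by rewrite -normcN opprB. Qed.
Lemma normc_triB w z : normc w - normc z <= normc (w - z).
Proof. have := normcD (w - z) z; rewrite subrK; lra. Qed.
Lemma normcM w z : normc (w * z) = normc w * normc z.
Proof. exact: Normc.normcM. Qed.
Lemma normcV z : normc z^-1 = (normc z)^-1. Proof. exact: Normc.normcV. Qed.
Lemma normc0 : normc (0 : R[i]) = 0. Proof. exact: Normc.normc0. Qed.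
Lemma normc1 : normc (1 : R[i]) = 1. Proof. exact: Normc.normc1. Qed.
Lemma normcX z n : normc (z ^+ n) = normc z ^+ n.
Proof. by elim: n => [|n IH]; rewrite ?expr0 ?normc1// !exprS normcM IH. Qed.
Lemma normc_real x : normc (x%:C) = `|x|.
Proof. by rewrite /= expr0n addr0 sqrtr_sqr. Qed.
Lemma normc_nat n : normc (n%:R : R[i]) = n%:R.
Proof. by rewrite natC normc_real ger0_norm. Qed.
Lemma normc_eq0 z : (normc z == 0) = (z == 0).
Proof.
by apply/eqP/eqP => [/Normc.eq0_normc//|->]; rewrite normc0.
Qed.
Lemma normc_gt0 z : (0 < normc z) = (z != 0).
Proof. by rewrite lt_neqAle normc_ge0 andbT eq_sym normc_eq0. Qed.
Lemma normc_sum (I : Type) (r : seq I) (P : pred I) (F : I -> R[i]) :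
  normc (\sum_(i <- r | P i) F i) <= \sum_(i <- r | P i) normc (F i).
Proof.
elim/big_ind2 : _ => [|a b c d h1 h2|//]; first by rewrite normc0.
by rewrite (le_trans (normcD _ _))// lerD.
Qed.
Lemma Re_le_normc z : `|Re z| <= normc z.
Proof.
case: z => a b /=; rewrite -sqrtr_sqr; apply: ler_wsqrtr; by rewrite lerDl sqr_ge0.
Qed.
Lemma Im_le_normc z : `|Im z| <= normc z.
Proof.
case: z => a b /=; rewrite -sqrtr_sqr; apply: ler_wsqrtr; by rewrite lerDr sqr_ge0.
Qed.
Lemma normc_le_ReIm z : normc z <= `|Re z| + `|Im z|.
Proof.
have h : z = (Re z)%:C + (0 +i* Im z) by case: z => a b /=; simpc.
rewrite {1}h (le_trans (normcD _ _))// normc_real lerD2l /=.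
by rewrite expr0n add0r sqrtr_sqr.
Qed.
Lemma nearC z (P : R[i] -> Prop) :
  (\forall w \near (z : R[i]^o), P w) <->
  exists2 d : R, 0 < d & forall w, normc (w - z) < d -> P w.
Proof.
split.
  move=> /nbhs_ballP[e /= e0 eP].
  have [Ie Ree] : Im e = 0 /\ 0 < Re e.
    by move: e0; rewrite ltcE /= => /andP[/eqP -> ->].
  exists (Re e) => // w wz; apply: eP.
  rewrite -ball_normE /= distrC normCE ltcE /= Ie eqxx /=.
  by [].
move=> [d d0 dP]; apply/nbhs_ballP; exists d%:C => /=; first by rewrite ltcR.
move=> w; rewrite -ball_normE /= distrC normCE ltcR => /dP; exact.
Qed.

Lemma dnearC z (P : R[i] -> Prop) :
  (\forall w \near (z : R[i]^o)^', P w) <->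
  exists2 d : R, 0 < d & forall w, w != z -> normc (w - z) < d -> P w.
Proof.
split.
  move=> h.
  have /nearC[d d0 hd] : \forall w \near (z : R[i]^o), w != z -> P w by exact: h.
  by exists d => // w h1 h2; exact: hd.
move=> [d d0 hd].
suff h : \forall w \near (z : R[i]^o), w != z -> P w by exact: h.
by apply/nearC; exists d => // w h1 h2; exact: hd.
Qed.

Lemma cvgCP (T : Type) (F : set_system T) (FF : Filter F) (f : T -> R[i]) (l : R[i]) :
  ((f : T -> R[i]^o) @ F --> (l : R[i]^o)) <->
  forall e : R, 0 < e -> \forall x \near F, normc (f x - l) < e.
Proof.
split=> [/cvgrPdist_lt h e e0|h].
  have := h e%:C; rewrite ltcR => /(_ e0).
  by apply: filterS => x; rewrite distrC normCE ltcR.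
apply/cvgrPdist_lt => e e0.
have [Ie Ree] : Im e = 0 /\ 0 < Re e.
  by move: e0; rewrite ltcE /= => /andP[/eqP -> ->].
apply: filterS (h _ Ree) => x; rewrite distrC normCE => hx.
by rewrite ltcE /= Ie eqxx.
Qed.

Lemma cvgC_ReIm (T : Type) (F : set_system T) (FF : Filter F) (f : T -> R[i]) (l : R[i]) :
  ((f : T -> R[i]^o) @ F --> (l : R[i]^o)) <->
  ((Re (f x) @[x --> F] --> Re l) /\ (Im (f x) @[x --> F] --> Im l)).
Proof.
rewrite cvgCP; split=> [h|[/cvgrPdist_lt h1 /cvgrPdist_lt h2] e e0].
  split; apply/cvgrPdist_lt => e e0; apply: filterS (h _ e0) => x hx.
    by rewrite distrC -ReB (le_lt_trans (Re_le_normc _)).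
  by rewrite distrC -ImB (le_lt_trans (Im_le_normc _)).
have e2 : 0 < e / 2 by lra.
apply: filterS2 (h1 _ e2) (h2 _ e2) => x k1 k2.
rewrite (le_lt_trans (normc_le_ReIm _))// ReB ImB.
by rewrite [e]splitr ltrD// distrC.
Qed.

Let growthE (f : R[i] -> R[i]) z (k : R[i]) :
  (k^-1 *: ((f (k%:A + z) : R[i]^o) - f z) : R[i]^o) = k^-1 * (f (k + z) - f z).
Proof. by rewrite [k%:A](mulr1 k). Qed.

Lemma derivableCP (f : R[i] -> R[i]) z :
  derivable (f : R[i]^o -> R[i]^o) z 1 <->
  exists l, forall e : R, 0 < e -> exists2 d : R, 0 < d &
    forall w, normc (w - z) < d ->
      normc (f w - f z - l * (w - z)) <= e * normc (w - z).
Proof.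
split.
  move=> /cvg_ex[/= l /cvgrPdist_lt hl]; exists l => e e0.
  have := hl e%:C; rewrite ltcR => /(_ e0) /dnearC[d d0 hd].
  exists d => // w; have [->|wz wd] := eqVneq w z.
    by rewrite !subrr mulr0 subr0 normc0 mulr0.
  have wz0 : w - z != 0 by rewrite subr_eq0.
  have := hd (w - z); rewrite subr0 => /(_ wz0 wd).
  rewrite distrC normCE ltcR /= => hh.
  have -> : f w - f z - l * (w - z) =
      (w - z) * ((w - z)^-1 *: ((f ((w - z) *: 1 + z) : R[i]^o) - f z) - l).
    rewrite growthE subrK; move: (f w) (f z) (w - z) wz0 (l : R[i]) => a b k k0 m.
    by field.
  by rewrite normcM mulrC ler_wpM2r ?normc_ge0// ltW.
move=> [l h]; apply/cvg_ex; exists l; apply/cvgrPdist_lt => e e0.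
have [Ie Ree] : Im e = 0 /\ 0 < Re e.
  by move: e0; rewrite ltcE /= => /andP[/eqP -> ->].
have Ree2 : 0 < Re e / 2 by lra.
have [d d0 hd] := h _ Ree2.
apply/dnearC; exists d => // k k0; rewrite subr0 => kd.
have := hd (k + z); rewrite addrK => /(_ kd) hh.
rewrite distrC normCE ltcE /= Ie eqxx /=.
have -> : (k^-1 *: ((f (k *: 1 + z) : R[i]^o) - f z) - l) =
   k^-1 * (f (k + z) - f z - l * k).
  by rewrite growthE; move: (f _) (f _) => a b; field.
rewrite normcM normcV mulrC ltr_pdivrMr ?normc_gt0//.
apply: (le_lt_trans hh); rewrite ltr_pM2r ?normc_gt0//; lra.
Qed.

End ComplexBasics.

(** * Complex-valued functions of a real variable *)

Section RealDerivative.
Context {R : realType}.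
Implicit Types (f g : R -> R[i]) (l m : R[i]).

Definition rdrv f (t : R) l :=
  is_derive t 1 (fun x => Re (f x)) (Re l) /\
  is_derive t 1 (fun x => Im (f x)) (Im l).

Lemma rdrv_eq f t l m : l = m -> rdrv f t l -> rdrv f t m.
Proof. by move=> ->. Qed.

Lemma rdrv_cst c t : rdrv (fun=> c) t 0.
Proof. by split; apply: is_derive_cst. Qed.

Lemma rdrvD f g t l m : rdrv f t l -> rdrv g t m ->
  rdrv (fun x => f x + g x) t (l + m).
Proof.
move=> [f1 f2] [g1 g2]; split.
  rewrite [X in is_derive _ _ X](_ : _ = (fun x => Re (f x)) + (fun x => Re (g x)));
    last by apply/funext => x; rewrite ReD.
  by rewrite ReD; apply: is_deriveD.
rewrite [X in is_derive _ _ X](_ : _ = (fun x => Im (f x)) + (fun x => Im (g x)));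
  last by apply/funext => x; rewrite ImD.
by rewrite ImD; apply: is_deriveD.
Qed.

Lemma rdrvM f g t l m : rdrv f t l -> rdrv g t m ->
  rdrv (fun x => f x * g x) t (l * g t + f t * m).
Proof.
move=> [f1 f2] [g1 g2]; split.
  rewrite [X in is_derive _ _ X](_ : _ =
    (fun x => Re (f x)) * (fun x => Re (g x)) -
    (fun x => Im (f x)) * (fun x => Im (g x)));
    last by apply/funext => x; rewrite ReM.
  apply: (is_derive_eq (is_deriveB (is_deriveM f1 g1) (is_deriveM f2 g2))).
  by rewrite ReD !ReM /GRing.scale /=; ring.
rewrite [X in is_derive _ _ X](_ : _ =
  (fun x => Re (f x)) * (fun x => Im (g x)) +
  (fun x => Im (f x)) * (fun x => Re (g x)));
  last by apply/funext => x; rewrite ImM.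
apply: (is_derive_eq (is_deriveD (is_deriveM f1 g2) (is_deriveM f2 g1))).
by rewrite ImD !ImM /GRing.scale /=; ring.
Qed.

Lemma rdrvZ f t l c : rdrv f t l -> rdrv (fun x => c * f x) t (c * l).
Proof.
by move=> h; have := rdrvM (rdrv_cst c t) h; apply: rdrv_eq; rewrite mul0r add0r.
Qed.

Lemma rdrvN f t l : rdrv f t l -> rdrv (fun x => - f x) t (- l).
Proof.
move=> /(rdrvZ (-1)); rewrite mulN1r => h.
by under eq_fun do rewrite -mulN1r.
Qed.

Lemma rdrvB f g t l m : rdrv f t l -> rdrv g t m ->
  rdrv (fun x => f x - g x) t (l - m).
Proof. by move=> hf hg; apply: rdrvD => //; exact: rdrvN. Qed.

Lemma rdrv_real (f : R -> R) (t l : R) : is_derive t 1 f l ->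
  rdrv (fun x => (f x)%:C) t l%:C.
Proof. by move=> h; split => //=; apply: is_derive_cst. Qed.

Lemma rdrv_id t : rdrv (fun x => x%:C) t 1.
Proof. by have := rdrv_real (is_derive_id t 1). Qed.

Lemma rdrv_comp f (g : R -> R) (t : R) l (m : R) : rdrv f (g t) l -> is_derive t 1 g m ->
  rdrv (fun x => f (g x)) t (l * m%:C).
Proof.
move=> [f1 f2] hg; split; [rewrite ReMC | rewrite ImMC].
  exact: (is_derive1_comp f1 hg).
exact: (is_derive1_comp f2 hg).
Qed.

Lemma rdrv_cexp f t l : rdrv f t l ->
  rdrv (fun x => cexp (f x)) t (l * cexp (f t)).
Proof.
move=> [f1 f2].
have e1 : is_derive t 1 (fun x => expR (Re (f x))) (Re l * expR (Re (f t))).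
  rewrite mulrC; exact: (is_derive1_comp (is_derive_expR (Re (f t))) f1).
have c1 : is_derive t 1 (fun x => cos (Im (f x))) (Im l * - sin (Im (f t))).
  rewrite mulrC; exact: (is_derive1_comp (is_derive_cos (Im (f t))) f2).
have s1 : is_derive t 1 (fun x => sin (Im (f x))) (Im l * cos (Im (f t))).
  rewrite mulrC; exact: (is_derive1_comp (is_derive_sin (Im (f t))) f2).
split => /=.
  apply: (is_derive_eq (is_deriveM e1 c1)).
  by rewrite ReM /GRing.scale /=; ring.
apply: (is_derive_eq (is_deriveM e1 s1)).
by rewrite ImM /GRing.scale /=; ring.
Qed.

Lemma rdrv_continuous f t l : rdrv f t l ->
  {for t, continuous (fun x => Re (f x))} /\ {for t, continuous (fun x => Im (f x))}.
Proof.
move=> [[h1 _] [h2 _]].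
by split; apply: differentiable_continuous; apply/derivable1_diffP.
Qed.

(** The real mean value theorem, applied to the two coordinates separately; this
    accounts for the factor 2 *)
Lemma mean_value_ineq f f' (a b M : R) : a <= b ->
  (forall t, a <= t <= b -> rdrv f t (f' t)) ->
  (forall t, a <= t <= b -> normc (f' t) <= M) ->
  normc (f b - f a) <= 2 * M * (b - a).
Proof.
move=> ab df f'M.
have cf1 : {within `[a, b], continuous (fun x => Re (f x))}.
  apply: continuous_in_subspaceT => x /set_mem; rewrite /= in_itv /= => /df.
  by move/rdrv_continuous => [].
have cf2 : {within `[a, b], continuous (fun x => Im (f x))}.
  apply: continuous_in_subspaceT => x /set_mem; rewrite /= in_itv /= => /df.
  by move/rdrv_continuous => [].
have oc x : x \in `]a, b[ -> a <= x <= b.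
  by rewrite in_itv /= => /andP[/ltW -> /ltW ->].
have [c1 c1ab e1] := MVT_segment ab (fun x xab => (df x (oc x xab)).1) cf1.
have [c2 c2ab e2] := MVT_segment ab (fun x xab => (df x (oc x xab)).2) cf2.
rewrite (le_trans (normc_le_ReIm _))// ReB ImB e1 e2 !normrM.
rewrite [X in _ * X + _]ger0_norm ?subr_ge0// [X in _ + _ * X]ger0_norm ?subr_ge0//.
rewrite -mulrDl ler_wpM2r ?subr_ge0// mulrDl mul1r lerD//.
  by rewrite (le_trans (Re_le_normc _))// f'M//; rewrite in_itv in c1ab.
by rewrite (le_trans (Im_le_normc _))// f'M//; rewrite in_itv in c2ab.
Qed.

End RealDerivative.

Section ComplexExponential.
Context {R : realType}.
Implicit Types (w z s : R[i]) (t x y : R).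

Lemma cexpD w z : cexp (w + z) = cexp w * cexp z.
Proof.
by apply: eqC; rewrite ?ReM ?ImM /= ReD ImD expRD ?cosD ?sinD; ring.
Qed.

Lemma cexp0 : cexp 0 = 1 :> R[i].
Proof. by apply: eqC; rewrite /= expR0 ?cos0 ?sin0 ?mulr1 ?mulr0. Qed.

Lemma normc_cexp z : normc (cexp z) = expR (Re z).
Proof.
by rewrite /= !exprMn -mulrDr cos2Dsin2 mulr1 sqrtr_sqr ger0_norm// expR_ge0.
Qed.

Lemma cexp_neq0 z : cexp z != 0.
Proof. by rewrite -normc_gt0 normc_cexp expR_gt0. Qed.

Lemma cexpN z : cexp (- z) = (cexp z)^-1.
Proof.
apply: (mulfI (cexp_neq0 z)); rewrite -cexpD subrr cexp0 divff//.
exact: cexp_neq0.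
Qed.

Lemma cexpMn z n : cexp (n%:R * z) = cexp z ^+ n.
Proof.
elim: n => [|n IH]; first by rewrite mul0r cexp0 expr0.
by rewrite exprS -IH -cexpD -[n.+1]add1n natrD mulrDl mul1r.
Qed.

Lemma cexp_real x : cexp x%:C = (expR x)%:C :> R[i].
Proof. by apply: eqC; rewrite /= ?cos0 ?sin0 ?mulr1 ?mulr0. Qed.

Lemma rdrv_cexp_line w (t : R) : rdrv (fun x => cexp (x%:C * w)) t (w * cexp (t%:C * w)).
Proof.
apply: (@rdrv_cexp R (fun x : R => x%:C * w)).
by have := rdrvM (rdrv_id t) (rdrv_cst w t); apply: rdrv_eq; ring.
Qed.

Let Re_le_expn w t : 0 <= t <= 1 -> expR (Re (t%:C * w)) <= expR (normc w).
Proof.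
move=> /andP[t0 t1]; rewrite ler_expR ReCM.
have := Re_le_normc w; rewrite ler_norml => /andP[_ h].
have := normc_ge0 w; nra.
Qed.

Lemma normc_cexpB1 w : normc (cexp w - 1) <= 2 * normc w * expR (normc w).
Proof.
have := @mean_value_ineq R (fun t => cexp (t%:C * w))
  (fun t => w * cexp (t%:C * w)) 0 1 (normc w * expR (normc w)) ler01.
rewrite mul1r mul0r cexp0 subr0 mulr1 mulrA; apply.
  by move=> t _; exact: rdrv_cexp_line.
move=> t t01; rewrite normcM normc_cexp ler_wpM2l ?normc_ge0//.
exact: Re_le_expn.
Qed.

(** The mean value inequality for t |-> cexp (t w) - t w, whose derivative is
    bounded by normc_cexpB1 *)
Lemma normc_cexpB1B w :
  normc (cexp w - 1 - w) <= 4 * normc w ^+ 2 * expR (normc w).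
Proof.
have := @mean_value_ineq R (fun t => cexp (t%:C * w) - t%:C * w)
  (fun t => w * (cexp (t%:C * w) - 1)) 0 1
  (2 * normc w ^+ 2 * expR (normc w)) ler01.
rewrite !mul1r !mul0r cexp0 !subr0 mulr1.
have -> : cexp w - w - 1 = cexp w - 1 - w by ring.
have -> : 2 * (2 * normc w ^+ 2 * expR (normc w)) =
  4 * normc w ^+ 2 * expR (normc w) by ring.
apply => t t01.
  rewrite mulrBr mulr1; apply: rdrvB; first exact: rdrv_cexp_line.
  by have := rdrvM (rdrv_id t) (rdrv_cst w t); apply: rdrv_eq; ring.
have t1 : normc (t%:C * w) <= normc w.
  move: t01 => /andP[t0 t1]; rewrite normcM normc_real ger0_norm//.
  have := normc_ge0 w; nra.
rewrite normcM [leRHS](_ : _ = normc w * (2 * (normc w * expR (normc w)))); last by ring.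
rewrite ler_wpM2l ?normc_ge0// (le_trans (normc_cexpB1 _))// -mulrA ler_wpM2l//.
by rewrite ler_pM ?normc_ge0 ?expR_ge0// ler_expR.
Qed.

End ComplexExponential.

Section Cpow.
Context {R : realType}.
Implicit Types (w z s : R[i]) (t x y : R).

Lemma cpowD t s w : cpow t (s + w) = cpow t s * cpow t w.
Proof. by rewrite /cpow mulrDl cexpD. Qed.

Lemma cpowN t s : cpow t (- s) = (cpow t s)^-1.
Proof. by rewrite /cpow mulNr cexpN. Qed.

Lemma cpow_neq0 t s : cpow t s != 0. Proof. exact: cexp_neq0. Qed.

Lemma cpow_1 t : 0 < t -> cpow t 1 = t%:C :> R[i].
Proof. by move=> t0; rewrite /cpow mul1r cexp_real lnK. Qed.

Lemma cpow1 s : cpow 1 s = 1. Proof. by rewrite /cpow ln1 mulr0 cexp0. Qed.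

Lemma cpowMl t x s : 0 < t -> 0 < x -> cpow (t * x) s = cpow t s * cpow x s.
Proof. by move=> t0 x0; rewrite /cpow lnM// rmorphD mulrDr cexpD. Qed.

Lemma cpowVl t s : 0 < t -> cpow t^-1 s = (cpow t s)^-1.
Proof. by move=> t0; rewrite /cpow lnV// rmorphN mulrN cexpN. Qed.

Lemma normc_cpow t s : normc (cpow t s) = expR (Re s * ln t).
Proof. by rewrite normc_cexp ReMC. Qed.

End Cpow.

(** * Holomorphic functions *)

Section Derivable.
Context {R : realType}.
Implicit Types (f g : R[i] -> R[i]) (w z s c : R[i]).

(** Complex differentiability with explicit bounds on the first order remainder,
    which avoids the topology of R[i]^o in all the estimates *)
Definition cderivable f z := exists l, forall e : R, 0 < e ->
  exists2 d : R, 0 < d & forall w, normc (w - z) < d ->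
    normc (f w - f z - l * (w - z)) <= e * normc (w - z).

Lemma cderivableP f z :
  derivable (f : R[i]^o -> R[i]^o) z 1 <-> cderivable f z.
Proof. exact: derivableCP. Qed.

Lemma cderivableD f g z : cderivable f z -> cderivable g z ->
  cderivable (fun w => f w + g w) z.
Proof.
move=> /cderivableP h1 /cderivableP h2; apply/cderivableP.
exact: (@derivableD R[i] R[i]^o R[i]^o f g z 1 h1 h2).
Qed.

Lemma cderivableM f g z : cderivable f z -> cderivable g z ->
  cderivable (fun w => f w * g w) z.
Proof.
move=> /cderivableP h1 /cderivableP h2; apply/cderivableP.
exact: (@derivableM R[i] R[i]^o f g z 1 h1 h2).
Qed.

Lemma cderivableV f z : f z != 0 -> cderivable f z ->
  cderivable (fun w => (f w)^-1) z.
Proof.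
move=> h1 /cderivableP h2; apply/cderivableP.
exact: (@derivableV R[i] R[i]^o f z 1 h1 h2).
Qed.

Lemma cderivable_cst c z : cderivable (fun=> c) z.
Proof.
apply/cderivableP; exact: (@derivable_cst R[i] R[i]^o R[i]^o c z 1).
Qed.

Lemma cderivable_id z : cderivable (fun w => w) z.
Proof. apply/cderivableP; exact: (@derivable_id R[i] R[i]^o z 1). Qed.

Lemma cderivableN f z : cderivable f z -> cderivable (fun w => - f w) z.
Proof.
move=> /cderivableP h; apply/cderivableP.
exact: (@derivableN R[i] R[i]^o R[i]^o f z 1 h).
Qed.

Lemma cderivableB f g z : cderivable f z -> cderivable g z ->
  cderivable (fun w => f w - g w) z.
Proof. by move=> h1 h2; apply: cderivableD => //; exact: cderivableN. Qed.

Lemma cderivableX f n z : cderivable f z -> cderivable (fun w => f w ^+ n) z.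
Proof.
move=> h; elim: n => [|n IH].
  by under eq_fun do rewrite expr0; exact: cderivable_cst.
by under eq_fun do rewrite exprS; exact: cderivableM.
Qed.

Lemma cderivable_sum (I : Type) (r : seq I) (P : pred I) (F : I -> R[i] -> R[i]) z :
  (forall i, P i -> cderivable (F i) z) ->
  cderivable (fun w => \sum_(i <- r | P i) F i w) z.
Proof.
move=> h; elim: r => [|i r IH].
  by under eq_fun do rewrite big_nil; exact: cderivable_cst.
under eq_fun do rewrite big_cons.
by case: (boolP (P i)) => [/h Pi|//]; exact: cderivableD.
Qed.

Lemma cderivable_prod (I : Type) (r : seq I) (P : pred I) (F : I -> R[i] -> R[i]) z :
  (forall i, P i -> cderivable (F i) z) ->
  cderivable (fun w => \prod_(i <- r | P i) F i w) z.
Proof.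
move=> h; elim: r => [|i r IH].
  by under eq_fun do rewrite big_nil; exact: cderivable_cst.
under eq_fun do rewrite big_cons.
by case: (boolP (P i)) => [/h Pi|//]; exact: cderivableM.
Qed.

Lemma cderivable_comp f g z : cderivable f z -> cderivable g (f z) ->
  cderivable (fun w => g (f w)) z.
Proof.
move=> /cderivableP h1 /cderivableP h2; apply/cderivableP.
have /derivable1_diffP h1' := h1; have /derivable1_diffP h2' := h2.
by apply/derivable1_diffP; exact: (@differentiable_comp R[i] R[i]^o R[i]^o R[i]^o f g z h1' h2').
Qed.

Lemma cderivable_cexp z : cderivable (@cexp R) z.
Proof.
exists (cexp z) => e e0.
pose K := 4 * normc (cexp z) * expR 1.
have K0 : 0 < K by rewrite !mulr_gt0 ?expR_gt0// normc_gt0 cexp_neq0.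
exists (Num.min 1 (e / K)); first by rewrite lt_min ltr01 divr_gt0.
move=> w; rewrite lt_min => /andP[w1 w2].
have -> : cexp w - cexp z - cexp z * (w - z) = cexp z * (cexp (w - z) - 1 - (w - z)).
  have h : cexp w = cexp z * cexp (w - z) by rewrite -cexpD addrC subrK.
  by rewrite h; ring.
rewrite normcM.
have h := normc_cexpB1B (w - z).
apply: (@le_trans _ _ (normc (cexp z) * (4 * normc (w - z) ^+ 2 * expR 1))).
  rewrite ler_wpM2l ?normc_ge0// (le_trans h)// ler_wpM2l//.
    by rewrite mulr_ge0// exprn_ge0// normc_ge0.
  by rewrite ler_expR ltW.
have -> : normc (cexp z) * (4 * normc (w - z) ^+ 2 * expR 1) =
  K * normc (w - z) * normc (w - z) by rewrite /K; ring.
rewrite ler_wpM2r ?normc_ge0//.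
by move: w2; rewrite ltr_pdivlMr// mulrC => /ltW.
Qed.

Lemma cderivable_cpow t f z : cderivable f z -> cderivable (fun w => cpow t (f w)) z.
Proof.
move=> h; apply: (@cderivable_comp (fun w => f w * (ln t)%:C)).
  by apply: cderivableM => //; exact: cderivable_cst.
exact: cderivable_cexp.
Qed.

Lemma cderivable_ext f g z (d : R) : 0 < d ->
  (forall w, normc (w - z) < d -> f w = g w) -> cderivable f z -> cderivable g z.
Proof.
move=> d0 fg [l h]; exists l => e e0.
have [d1 d10 hd] := h _ e0; exists (Num.min d d1); first by rewrite lt_min d0.
move=> w; rewrite lt_min => /andP[w1 w2]; rewrite -!fg//; first exact: hd.
by rewrite subrr normc0.
Qed.

Lemma cderivable_continuous f z : cderivable f z ->
  forall e : R, 0 < e -> exists2 d : R, 0 < d &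
    forall w, normc (w - z) < d -> normc (f w - f z) < e.
Proof.
move=> [l h] e e0; have [d d0 hd] := h 1 ltr01.
have l0 : 0 < 1 + normc l by rewrite ltr_wpDr ?normc_ge0.
exists (Num.min d (e / (1 + normc l))); first by rewrite lt_min d0 divr_gt0.
move=> w; rewrite lt_min => /andP[/hd h1].
rewrite ltr_pdivlMr// => h2; rewrite mul1r in h1.
have -> : f w - f z = (f w - f z - l * (w - z)) + l * (w - z) by ring.
rewrite (le_lt_trans (normcD _ _))// normcM; lra.
Qed.

End Derivable.

Arguments Normc.normc : simpl never.
Arguments cexp : simpl never.

(** * Integrals of complex-valued functions *)

Section ComplexIntegral.
Context {R : realType}.
Notation mu := (@lebesgue_measure R).
Implicit Types (D E : set R) (f g : R -> R[i]) (c : R[i]).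

Definition mfunC D f := measurable_fun D (fun x => Re (f x)) /\
  measurable_fun D (fun x => Im (f x)).

Definition cintegrable D f := mu.-integrable D (EFin \o (fun x => Re (f x))) /\
  mu.-integrable D (EFin \o (fun x => Im (f x))).

Lemma cintegrable_mfun D f : cintegrable D f -> mfunC D f.
Proof.
by move=> [/integrableP[/measurable_EFinP h1 _] /integrableP[/measurable_EFinP h2 _]].
Qed.

Lemma eq_cintegral D g f : (forall x, D x -> f x = g x) ->
  cintegral D f = cintegral D g.
Proof.
by move=> fg; rewrite /cintegral; congr (_ +i* _); apply: eq_Rintegral => x /set_mem /fg ->.
Qed.

Lemma cintegral0 D : cintegral D (fun=> 0) = 0 :> R[i].
Proof. by rewrite /cintegral /= /Rintegral !integral0. Qed.

Lemma mfunC_cst D c : measurable D -> mfunC D (fun=> c).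
Proof. by move=> mD; split; exact: measurable_cst. Qed.

Lemma mfunCD D f g : mfunC D f -> mfunC D g -> mfunC D (fun x => f x + g x).
Proof.
move=> [f1 f2] [g1 g2]; split.
  by under eq_fun do rewrite ReD; exact: measurable_funD.
by under eq_fun do rewrite ImD; exact: measurable_funD.
Qed.

Lemma mfunCM D f g : mfunC D f -> mfunC D g -> mfunC D (fun x => f x * g x).
Proof.
move=> [f1 f2] [g1 g2]; split.
  by under eq_fun do rewrite ReM; apply: measurable_funB; exact: measurable_funM.
by under eq_fun do rewrite ImM; apply: measurable_funD; exact: measurable_funM.
Qed.

Lemma mfunC_normc D f : measurable D -> mfunC D f ->
  measurable_fun D (fun x => normc (f x)).
Proof.
move=> mD [f1 f2].
rewrite (_ : (fun x => _) = (fun x => Num.sqrt (Re (f x) ^+ 2 + Im (f x) ^+ 2))).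
  apply: measurableT_comp => //.
    by apply: continuous_measurable_fun; exact: sqrt_continuous.
  by apply: measurable_funD; exact: measurable_funX.
by apply/funext => x; case: (f x).
Qed.

Lemma cintegrable_le D f (g : R -> R) : measurable D -> mfunC D f ->
  mu.-integrable D (EFin \o g) -> (forall x, D x -> normc (f x) <= g x) ->
  cintegrable D f.
Proof.
move=> mD [f1 f2] ig fg; split; apply: le_integrable ig => //.
- exact/measurable_EFinP.
- move=> x Dx /=; rewrite lee_fin (le_trans (Re_le_normc _))//.
  by rewrite (le_trans (fg _ Dx))// ler_norm.
- exact/measurable_EFinP.
- move=> x Dx /=; rewrite lee_fin (le_trans (Im_le_normc _))//.
  by rewrite (le_trans (fg _ Dx))// ler_norm.
Qed.

Lemma cintegrable_normc D f : measurable D -> cintegrable D f ->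
  mu.-integrable D (EFin \o (fun x => normc (f x))).
Proof.
move=> mD hf; have [h1 h2] := hf.
have h : mu.-integrable D ((EFin \o (fun x => `|Re (f x)|%R)) \+
    (EFin \o (fun x => `|Im (f x)|%R)))%E.
  by apply: integrableD => //; [exact: (integrable_norm h1)|exact: (integrable_norm h2)].
apply: le_integrable h => //.
  by apply/measurable_EFinP; apply: mfunC_normc => //; exact: cintegrable_mfun.
move=> x Dx /=; rewrite lee_fin ger0_norm ?normc_ge0//.
by rewrite (le_trans (normc_le_ReIm _))// ler_norm.
Qed.

Lemma cintegrableD D f g : measurable D -> cintegrable D f -> cintegrable D g ->
  cintegrable D (fun x => f x + g x).
Proof.
move=> mD [f1 f2] [g1 g2]; split.
  rewrite (_ : EFin \o _ = (EFin \o (fun x => Re (f x))) \+ (EFin \o (fun x => Re (g x))))%E.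
    exact: integrableD.
  by apply/funext => x; rewrite /= ReD EFinD.
rewrite (_ : EFin \o _ = (EFin \o (fun x => Im (f x))) \+ (EFin \o (fun x => Im (g x))))%E.
  exact: integrableD.
by apply/funext => x; rewrite /= ImD EFinD.
Qed.

Lemma cintegrableZ D f c : measurable D -> cintegrable D f ->
  cintegrable D (fun x => c * f x).
Proof.
move=> mD hf; apply: (@cintegrable_le D _ (fun x => normc c * normc (f x))) => //.
- by apply: mfunCM; [exact: mfunC_cst|exact: cintegrable_mfun].
- rewrite (_ : EFin \o _ = fun x => (normc c)%:E * (EFin \o (fun x => normc (f x))) x)%E.
    by apply: integrableZl => //; exact: cintegrable_normc.
  by apply/funext => x; rewrite /= EFinM.
- by move=> x Dx; rewrite normcM.
Qed.

Lemma cintegrableN D f : measurable D -> cintegrable D f ->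
  cintegrable D (fun x => - f x).
Proof.
by move=> mD /(cintegrableZ (-1) mD); under eq_fun do rewrite mulN1r.
Qed.

Lemma cintegrable0 D : measurable D -> cintegrable D (fun=> 0).
Proof. by move=> mD; split; exact: integrable0. Qed.

Lemma cintegrable_sum D (I : Type) (r : seq I) (P : pred I) (F : I -> R -> R[i]) :
  measurable D -> (forall i, P i -> cintegrable D (F i)) ->
  cintegrable D (fun x => \sum_(i <- r | P i) F i x).
Proof.
move=> mD h; elim: r => [|i r IH].
  by under eq_fun do rewrite big_nil; exact: cintegrable0.
under eq_fun do rewrite big_cons.
by case: (boolP (P i)) => [/h Pi|_]; [exact: cintegrableD|exact: IH].
Qed.

Lemma cintegralD D f g : measurable D -> cintegrable D f -> cintegrable D g ->
  cintegral D (fun x => f x + g x) = cintegral D f + cintegral D g.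
Proof.
move=> mD [f1 f2] [g1 g2]; apply: eqC; rewrite ?ReD ?ImD /=.
  by rewrite -RintegralD//; apply: eq_Rintegral => x _; rewrite ReD.
by rewrite -RintegralD//; apply: eq_Rintegral => x _; rewrite ImD.
Qed.

Lemma cintegralZ D f c : measurable D -> cintegrable D f ->
  cintegral D (fun x => c * f x) = c * cintegral D f.
Proof.
move=> mD [f1 f2].
have iZ (a : R) (h : R -> R) : mu.-integrable D (EFin \o h) ->
    mu.-integrable D (EFin \o (fun x => a * h x)).
  move=> ih; rewrite (_ : EFin \o _ = fun x => a%:E * (EFin \o h) x)%E.
    exact: integrableZl.
  by apply/funext => x; rewrite /= EFinM.
apply: eqC; rewrite ?ReM ?ImM /= -!RintegralZl//.
  rewrite -RintegralB//; [|exact: iZ|exact: iZ].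
  by apply: eq_Rintegral => x _; rewrite ReM.
rewrite -RintegralD//; [|exact: iZ|exact: iZ].
by apply: eq_Rintegral => x _; rewrite ImM.
Qed.

Lemma cintegralN D f : measurable D -> cintegrable D f ->
  cintegral D (fun x => - f x) = - cintegral D f.
Proof.
move=> mD hf; rewrite -mulN1r -cintegralZ//.
by apply: eq_cintegral => x _; rewrite mulN1r.
Qed.

Lemma cintegralB D f g : measurable D -> cintegrable D f -> cintegrable D g ->
  cintegral D (fun x => f x - g x) = cintegral D f - cintegral D g.
Proof.
by move=> mD hf hg; rewrite cintegralD ?cintegralN//; exact: cintegrableN.
Qed.

Lemma cintegral_sum D (I : Type) (r : seq I) (P : pred I) (F : I -> R -> R[i]) :
  measurable D -> (forall i, P i -> cintegrable D (F i)) ->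
  cintegral D (fun x => \sum_(i <- r | P i) F i x) =
  \sum_(i <- r | P i) cintegral D (F i).
Proof.
move=> mD h; elim: r => [|i r IH].
  rewrite big_nil -[RHS](cintegral0 D).
  by apply: eq_cintegral => x _; rewrite big_nil.
rewrite big_cons; case: (boolP (P i)) => Pi.
  rewrite -IH -cintegralD//; [|exact: h|exact: cintegrable_sum].
  by apply: eq_cintegral => x _; rewrite big_cons Pi.
by rewrite -IH; apply: eq_cintegral => x _; rewrite big_cons (negbTE Pi).
Qed.

Lemma cintegral_real D (f : R -> R) :
  cintegral D (fun x => (f x)%:C) = (\int[mu]_(x in D) f x)%:C.
Proof. by apply: eqC => //=; rewrite /Rintegral integral0. Qed.

(** The integral I is rotated onto the positive real axis: |I| is the real part
    of the integral of u f for the unit complex number u = |I| / I *)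
Lemma normc_cintegral_le D f (g : R -> R) : measurable D -> mfunC D f ->
  mu.-integrable D (EFin \o g) -> (forall x, D x -> normc (f x) <= g x) ->
  normc (cintegral D f) <= \int[mu]_(x in D) g x.
Proof.
move=> mD mf ig fg; have hf := cintegrable_le mD mf ig fg.
set I := cintegral D f.
have [I0|I0] := eqVneq I 0.
  rewrite I0 normc0; apply: Rintegral_ge0 => x Dx.
  by rewrite (le_trans (normc_ge0 _) (fg _ Dx)).
have nI0 : normc I != 0 by rewrite normc_eq0.
pose u := conjc I / (normc I)%:C.
have uI : u * I = (normc I)%:C.
  rewrite /u mulrAC [conjc I * I]mulrC -sqr_normc normCE expr2 mulfK//.
  by rewrite (_ : 0 = 0%:C)// (inj_eq (@complexI _)).
have nu : normc u = 1.
  apply: (mulIf nI0); rewrite mul1r -normcM uI normc_real ger0_norm//.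
  exact: normc_ge0.
rewrite -[normc I]/(Re (normc I)%:C) -uI -cintegralZ//=.
apply: le_Rintegral => //.
  by have [] := cintegrableZ u mD hf.
move=> x Dx; rewrite (le_trans (ler_norm _))// (le_trans (Re_le_normc _))//.
by rewrite normcM nu mul1r fg.
Qed.

Lemma cintegrableS D E f : measurable D -> measurable E -> E `<=` D ->
  cintegrable D f -> cintegrable E f.
Proof. by move=> mD mE ED [h1 h2]; split; [exact: integrableS h1|exact: integrableS h2]. Qed.

Lemma cintegral_dominated D (f_ : nat -> R -> R[i]) f (g : R -> R) :
  measurable D -> (forall n, mfunC D (f_ n)) ->
  (forall x, D x -> ((fun n => f_ n x) : nat -> R[i]^o) @ \oo --> (f x : R[i]^o)) ->
  mu.-integrable D (EFin \o g) ->
  (forall n x, D x -> normc (f_ n x) <= g x) ->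
  cintegrable D f /\
  ((fun n => cintegral D (f_ n)) : nat -> R[i]^o) @ \oo --> (cintegral D f : R[i]^o).
Proof.
move=> mD mf ff ig fg.
have if_ n : cintegrable D (f_ n) by exact: (cintegrable_le mD (mf n) ig (fg n)).
have aux (p : R[i] -> R) : (forall n, measurable_fun D (fun x => p (f_ n x))) ->
   (forall z, `|p z| <= normc z) ->
   (forall x, D x -> p (f_ n x) @[n --> \oo] --> p (f x)) ->
   mu.-integrable D (EFin \o (fun x => p (f x))) /\
   (\int[mu]_(x in D) p (f_ n x))%R @[n --> \oo] --> (\int[mu]_(x in D) p (f x))%R.
  move=> mp pn pf.
  have pf' x : D x -> (p (f_ n x))%:E @[n --> \oo] --> (p (f x))%:E.
    by move=> Dx; apply: cvg_EFin; [exact: nearW|exact: pf].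
  have pg n x : D x -> (`|(p (f_ n x))%:E| <= (g x)%:E)%E.
    by move=> Dx; rewrite abse_EFin lee_fin (le_trans (pn _))// fg.
  have mpE n : measurable_fun D (EFin \o (fun x => p (f_ n x))).
    exact/measurable_EFinP.
  have mpf : measurable_fun D (EFin \o (fun x => p (f x))).
    apply/measurable_EFinP.
    exact: (@measurable_fun_cvg _ _ _ _ (fun n x => p (f_ n x))).
  have [| |ip _ cp] := @dominated_convergence _ _ _ mu D mD
      (fun n => EFin \o (fun x => p (f_ n x))) (EFin \o (fun x => p (f x)))
      (EFin \o g) mpE mpf _ ig.
  - by apply: aeW => x; exact: pf'.
  - by apply: aeW => x n; exact: pg.
  by split => //; apply: fine_cvg; rewrite fineK//; exact: integrable_fin_num.
have [h1 h2] : (forall x, D x -> Re (f_ n x) @[n --> \oo] --> Re (f x)) /\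
   (forall x, D x -> Im (f_ n x) @[n --> \oo] --> Im (f x)).
  by split => x Dx; have /cvgC_ReIm[] := ff x Dx.
have [r1 r2] := aux (@Re R) (fun n => (mf n).1) (@Re_le_normc R) h1.
have [i1 i2] := aux (@Im R) (fun n => (mf n).2) (@Im_le_normc R) h2.
by split => //; apply/cvgC_ReIm; split.
Qed.

Lemma cintegral_restrict D f :
  cintegral D f = cintegral setT (fun x => if x \in D then f x else 0).
Proof.
apply: eqC => /=; rewrite Rintegral_mkcond; apply: eq_Rintegral => x _.
  by rewrite patchE; case: ifP.
by rewrite patchE; case: ifP.
Qed.

Lemma mfunC_restrict D E f : measurable D -> measurable E -> mfunC D f ->
  mfunC D (fun x => if x \in E then f x else 0).
Proof.
move=> mD mE mf.
rewrite (_ : (fun x => _) = fun x => (\1_E x)%:C * f x).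
  apply: mfunCM => //; split => //=.
  by apply: measurable_funTS; exact: measurable_indic.
apply/funext => x; rewrite indicE; case: ifP => _ /=; first by rewrite mul1r.
by rewrite mul0r.
Qed.

Lemma cvg_cintegral_exhaust D (E : nat -> set R) f : measurable D ->
  (forall n, measurable (E n)) -> (forall n, E n `<=` D) -> cintegrable D f ->
  (forall x, D x -> \forall n \near \oo, E n x) ->
  ((fun n => cintegral (E n) f) : nat -> R[i]^o) @ \oo --> (cintegral D f : R[i]^o).
Proof.
move=> mD mE ED hf hE.
have := @cintegral_dominated D (fun n x => if x \in E n then f x else 0) f
  (fun x => normc (f x)) mD.
case.
- by move=> n; apply: mfunC_restrict => //; exact: cintegrable_mfun.
- move=> x Dx; apply/cvgCP => e e0; apply: filterS (hE x Dx) => n /mem_set ->.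
  by rewrite subrr normc0.
- exact: cintegrable_normc.
- by move=> n x Dx; case: ifP => _//; rewrite normc0 normc_ge0.
move=> _; rewrite (_ : (fun n => _) = (fun n => cintegral (E n) f))//.
apply/funext => n.
rewrite [LHS]cintegral_restrict [RHS]cintegral_restrict.
apply: eq_cintegral => x _; case: ifPn => xD //.
case: ifPn => // /set_mem /ED /mem_set.
by rewrite (negbTE xD).
Qed.

End ComplexIntegral.

Section ContinuousIntegrands.
Context {R : realType}.
Notation mu := (@lebesgue_measure R).
Implicit Types (f g : R -> R[i]) (c : R[i]) (a b t : R).

Definition ccont f t := {for t, continuous (fun x => Re (f x))} /\
  {for t, continuous (fun x => Im (f x))}.

Lemma ccontP f t : ccont f t <->
  forall e : R, 0 < e -> exists2 d : R, 0 < d &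
    forall x, `|x - t| < d -> normc (f x - f t) < e.
Proof.
have -> : ccont f t <-> ((f : R -> R[i]^o) @ (nbhs t) --> (f t : R[i]^o)).
  by rewrite cvgC_ReIm.
rewrite cvgCP; split => h e e0.
  have /nbhs_ballP[d /= d0 hd] := h e e0; exists d => // x xd.
  by apply: hd; rewrite -ball_normE /= distrC.
have [d d0 hd] := h e e0; apply/nbhs_ballP; exists d => //= x.
by rewrite -ball_normE /= distrC => /hd.
Qed.

Lemma ccont_cst c t : ccont (fun=> c) t.
Proof. by split; exact: cst_continuous. Qed.

Lemma ccontD f g t : ccont f t -> ccont g t -> ccont (fun x => f x + g x) t.
Proof.
move=> [f1 f2] [g1 g2]; split.
  rewrite (_ : (fun x => _) = (fun x => Re (f x)) \+ (fun x => Re (g x))).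
    exact: continuousD.
  by apply/funext => x; rewrite ReD.
rewrite (_ : (fun x => _) = (fun x => Im (f x)) \+ (fun x => Im (g x))).
  exact: continuousD.
by apply/funext => x; rewrite ImD.
Qed.

Lemma ccontM f g t : ccont f t -> ccont g t -> ccont (fun x => f x * g x) t.
Proof.
move=> [f1 f2] [g1 g2]; split.
  rewrite (_ : (fun x => _) = (fun x => Re (f x)) \* (fun x => Re (g x)) \-
      ((fun x => Im (f x)) \* (fun x => Im (g x)))).
    by apply: continuousB; exact: continuousM.
  by apply/funext => x; rewrite ReM.
rewrite (_ : (fun x => _) = (fun x => Re (f x)) \* (fun x => Im (g x)) \+
    ((fun x => Im (f x)) \* (fun x => Re (g x)))).
  by apply: continuousD; exact: continuousM.
by apply/funext => x; rewrite ImM.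
Qed.

Lemma ccontN f t : ccont f t -> ccont (fun x => - f x) t.
Proof.
by move=> h; under eq_fun do rewrite -mulN1r; apply: ccontM => //; exact: ccont_cst.
Qed.

Lemma ccont_real (g : R -> R) t : {for t, continuous g} -> ccont (fun x => (g x)%:C) t.
Proof. by move=> h; split => //=; exact: cst_continuous. Qed.

Lemma ccont_comp f (g : R -> R) t : ccont f (g t) -> {for t, continuous g} ->
  ccont (fun x => f (g x)) t.
Proof.
move=> [f1 f2] hg; split.
  exact: (continuous_comp hg f1).
exact: (continuous_comp hg f2).
Qed.

Lemma ccont_hol F f t : cderivable F (f t) -> ccont f t -> ccont (fun x => F (f x)) t.
Proof.
move=> hF /ccontP hf; apply/ccontP => e e0.
have [d d0 hd] := cderivable_continuous hF e0.
by have [d' d'0 hd'] := hf d d0; exists d' => // x /hd'; exact: hd.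
Qed.

Lemma rdrv_ccont f t l : rdrv f t l -> ccont f t.
Proof. exact: rdrv_continuous. Qed.

Lemma mfunC_cont D f : measurable D -> (forall x, ccont f x) -> mfunC D f.
Proof.
move=> mD cf; split.
  apply: (@measurable_funTS _ _ _ _ D (fun x => Re (f x))).
  by apply: continuous_measurable_fun => x; have [] := cf x.
apply: (@measurable_funTS _ _ _ _ D (fun x => Im (f x))).
by apply: continuous_measurable_fun => x; have [] := cf x.
Qed.

Lemma continuous_itv_within (h : R -> R) a b :
  (forall x, a <= x <= b -> {for x, continuous h}) -> {within `[a, b], continuous h}.
Proof.
by move=> hh; apply: continuous_in_subspaceT => x /set_mem; rewrite /= in_itv /= => /hh.
Qed.

Lemma ccont_cintegrable f a b :
  (forall x, a <= x <= b -> ccont f x) -> cintegrable `[a, b] f.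
Proof.
move=> cf; split; apply: continuous_compact_integrable; try exact: segment_compact.
  by apply: continuous_itv_within => x /cf[].
by apply: continuous_itv_within => x /cf[].
Qed.

Lemma cintegral_itv1 f a b : b <= a -> cintegral `[a, b] f = 0.
Proof.
move=> ba; have [->|bna] := eqVneq b a.
  by rewrite set_itv1 /cintegral !Rintegral_set1.
have {}ba : b < a by rewrite lt_neqAle bna.
by rewrite set_itv_ge /cintegral ?Rintegral_set0// bnd_simp -ltNge.
Qed.

Let cont_at_right (h : R -> R) x : {for x, continuous h} -> h @ x^'+ --> h x.
Proof. by move=> hh; exact: cvg_at_right_filter. Qed.

Let cont_at_left (h : R -> R) x : {for x, continuous h} -> h @ x^'- --> h x.
Proof. by move=> hh; exact: cvg_at_left_filter. Qed.

Lemma cintegral_FTC2 F f a b : a <= b ->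
  (forall x, a <= x <= b -> rdrv F x (f x)) ->
  (forall x, a <= x <= b -> ccont f x) ->
  cintegral `[a, b] f = F b - F a.
Proof.
rewrite le_eqVlt => /predU1P[<-|ab] dF cf; first by rewrite cintegral_itv1// subrr.
have oc x : x \in `]a, b[ -> a <= x <= b.
  by rewrite in_itv /= => /andP[/ltW -> /ltW ->].
have ha : a <= a <= b by rewrite lexx ltW.
have hb : a <= b <= b by rewrite lexx ltW.
have [dFa1 dFa2] := rdrv_continuous (dF a ha).
have [dFb1 dFb2] := rdrv_continuous (dF b hb).
apply: eqC; rewrite ?ReB ?ImB /= /Rintegral.
  rewrite (@continuous_FTC2 _ (fun x => Re (f x)) (fun x => Re (F x)) a b)//.
  - by apply: continuous_itv_within => x /cf[].
  - split; [|exact: cont_at_right|exact: cont_at_left].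
    by move=> x /oc /dF[[]].
  - by move=> x /oc /dF[[_ h] _]; rewrite derive1E.
rewrite (@continuous_FTC2 _ (fun x => Im (f x)) (fun x => Im (F x)) a b)//.
- by apply: continuous_itv_within => x /cf[].
- split; [|exact: cont_at_right|exact: cont_at_left].
  by move=> x /oc /dF[_ []].
- by move=> x /oc /dF[_ [_ h]]; rewrite derive1E.
Qed.

Lemma cintegral_split f a b t : a <= b -> b <= t ->
  (forall x, a <= x <= t -> ccont f x) ->
  cintegral `[a, t] f = cintegral `[a, b] f + cintegral `[b, t] f.
Proof.
move=> ab bt cf; have [i1 i2] := ccont_cintegrable cf.
have aux (h : R -> R) : mu.-integrable `[a, t] (EFin \o h) ->
  (\int[mu]_(x in `[a, t]) h x = \int[mu]_(x in `[a, b]) h x + \int[mu]_(x in `[b, t]) h x)%R.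
  move=> ih; apply/eqP; rewrite addrC -subr_eq; apply/eqP.
  rewrite (@Rintegral_itvB _ h (BLeft a) (BRight t) b)// ?bnd_simp//.
  rewrite Rintegral_itv_obnd_cbnd//.
  by apply: integrableS ih => //; apply: subset_itvr; rewrite bnd_simp.
by apply: eqC; rewrite ?ReD ?ImD /=; exact: aux.
Qed.

Lemma Rintegral_itv_cst a b (M : R) : a <= b ->
  (\int[mu]_(x in `[a, b]) M)%R = M * (b - a).
Proof.
move=> ab; rewrite Rintegral_cst//; congr (_ * _).
have := lebesgue_measure_itv `[a, b]; rewrite /= lte_fin => ->.
case: ltgtP ab => // -> _.
by rewrite subrr.
Qed.

Lemma integrable_itv_cst a b (M : R) : mu.-integrable `[a, b] (EFin \o (fun=> M)).
Proof.
apply: continuous_compact_integrable; first exact: segment_compact.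
by apply: continuous_itv_within => x _; exact: cst_continuous.
Qed.

Lemma normc_cintegral_itv f a b (M : R) : a <= b ->
  (forall x, a <= x <= b -> ccont f x) ->
  (forall x, a <= x <= b -> normc (f x) <= M) ->
  normc (cintegral `[a, b] f) <= M * (b - a).
Proof.
move=> ab cf fM; rewrite -Rintegral_itv_cst//.
apply: normc_cintegral_le => //.
- by apply: cintegrable_mfun; exact: ccont_cintegrable.
- exact: integrable_itv_cst.
Qed.

Lemma primitive_exists f a : (forall x, a <= x -> ccont f x) ->
  exists F, forall x, a < x -> rdrv F x (f x).
Proof.
move=> cf; exists (fun x => cintegral `[a, x] f) => x ax.
have xx1 : x < x + 1 by rewrite ltrDl.
have [i1 i2] : cintegrable `[a, x + 1] f.
  by apply: ccont_cintegrable => y /andP[/cf].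
have [c1 c2] := cf x (ltW ax).
split => /=.
  have [h1 h2] := continuous_FTC1_closed xx1 i1 ax c1.
  by rewrite -h2 derive1E; exact: derivableP.
have [h1 h2] := continuous_FTC1_closed xx1 i2 ax c2.
by rewrite -h2 derive1E; exact: derivableP.
Qed.

(** A primitive of f turns the substitution into the chain rule; the open ray
    beyond lo is where f has one *)
Lemma cintegral_subst f (p p' : R -> R) lo a b : a <= b ->
  (forall x, lo < x -> ccont f x) ->
  (forall x, a <= x <= b -> lo < p x) ->
  (forall x, a <= x <= b -> is_derive x 1 p (p' x)) ->
  (forall x, a <= x <= b -> {for x, continuous p'}) ->
  p a <= p b ->
  cintegral `[p a, p b] f = cintegral `[a, b] (fun x => f (p x) * (p' x)%:C).
Proof.
move=> ab cf lop dp cp' pab.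
have cp x : a <= x <= b -> {for x, continuous p}.
  by move=> /dp[h _]; apply: differentiable_continuous; exact/derivable1_diffP.
have [m mab mP] := @EVT_min _ p a b ab (continuous_itv_within cp).
have lopm : lo < p m by apply: lop; move: mab; rewrite in_itv.
have [l /andP[lol lpm]] : exists l, lo < l < p m.
  by exists ((lo + p m) / 2); apply/andP; split; lra.
have [F hF] := @primitive_exists f l (fun x h => cf x (lt_le_trans lol h)).
have lp x : a <= x <= b -> l < p x.
  by move=> xab; apply: (lt_le_trans lpm); apply: mP; rewrite in_itv.
have ha : a <= a <= b by rewrite lexx ab.
have hb : a <= b <= b by rewrite ab lexx.
rewrite (@cintegral_FTC2 F f)//; last 2 first.
- by move=> x /andP[h _]; apply: hF; apply: lt_le_trans h; exact: lp.
- by move=> x /andP[h _]; apply: cf; apply: lt_le_trans h; exact: lop.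
rewrite (@cintegral_FTC2 (fun x => F (p x)))//.
- by move=> x xab; apply: rdrv_comp; [apply: hF; exact: lp|exact: dp].
- move=> x xab; apply: ccontM; last exact: (ccont_real (cp' x xab)).
  by apply: ccont_comp; [apply: cf; exact: lop|exact: cp].
Qed.

End ContinuousIntegrands.

(** * Cauchy's theorem *)

Section Goursat.
Context {R : realType}.
Implicit Types (q P : R[i] -> R[i]) (a b t x : R).

Definition path_integral q (g g' : R -> R[i]) a b := cintegral `[a, b] (fun x => q (g x) * g' x).

Definition regular_path q (g g' : R -> R[i]) a b := forall x, a <= x <= b ->
  [/\ rdrv g x (g' x), ccont g' x & cderivable q (g x)].

Lemma regular_path_ccont q (g g' : R -> R[i]) a b : regular_path q g g' a b ->
  forall x, a <= x <= b -> ccont (fun x => q (g x) * g' x) x.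
Proof.
move=> h x /h[h1 h2 h3]; apply: ccontM => //.
by apply: ccont_hol => //; exact: rdrv_ccont h1.
Qed.

Lemma path_integral_split q (g g' : R -> R[i]) a b t : a <= b -> b <= t ->
  regular_path q g g' a t ->
  path_integral q g g' a t = path_integral q g g' a b + path_integral q g g' b t.
Proof.
by move=> ab bt h; apply: cintegral_split => //; exact: regular_path_ccont.
Qed.

Lemma path_integralB q P (g g' : R -> R[i]) a b :
  regular_path q g g' a b -> regular_path P g g' a b ->
  path_integral (fun z => q z - P z) g g' a b =
  path_integral q g g' a b - path_integral P g g' a b.
Proof.
move=> h1 h2; rewrite /path_integral -cintegralB//.
- by apply: eq_cintegral => x _; rewrite mulrBl.
- by apply: ccont_cintegrable; exact: regular_path_ccont.
- by apply: ccont_cintegrable; exact: regular_path_ccont.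
Qed.

Lemma normc_path_integral q (g g' : R -> R[i]) a b (M L : R) : a <= b ->
  regular_path q g g' a b ->
  (forall x, a <= x <= b -> normc (q (g x)) <= M) ->
  (forall x, a <= x <= b -> normc (g' x) <= L) ->
  normc (path_integral q g g' a b) <= M * L * (b - a).
Proof.
move=> ab h qM gL; apply: normc_cintegral_itv => //.
  exact: regular_path_ccont.
by move=> x xab; rewrite normcM ler_pM ?normc_ge0// ?qM// gL.
Qed.

(** An affine function has a primitive *)
Lemma path_integral_affine (A B z0 : R[i]) (g g' : R -> R[i]) a b : a <= b ->
  regular_path (fun z => A + B * (z - z0)) g g' a b ->
  let P z := A * z + B / 2 * (z - z0) ^+ 2 in
  path_integral (fun z => A + B * (z - z0)) g g' a b = P (g b) - P (g a).
Proof.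
move=> ab h P; apply: (@cintegral_FTC2 _ (fun x => P (g x))) => //.
  move=> x /h[h1 _ _]; rewrite /P.
  have h2 := rdrvB h1 (rdrv_cst z0 x).
  have := rdrvD (rdrvZ A h1) (rdrvZ (B / 2) (rdrvM h2 h2)).
  by apply: rdrv_eq; field.
exact: (regular_path_ccont h).
Qed.

Lemma nested_intervals (u v : nat -> R) :
  (forall n, u n <= u n.+1) -> (forall n, v n.+1 <= v n) ->
  (forall n, u n <= v n) -> exists x, forall n, u n <= x <= v n.
Proof.
move=> uS vS uv.
have um n m : (n <= m)%N -> u n <= u m by move/nondecreasing_seqP: uS; exact.
have vm n m : (n <= m)%N -> v m <= v n by move/nonincreasing_seqP: vS; exact.
have ub n : ubound (range u) (v n).
  move=> _ [m _ <-]; have [nm|mn] := leqP n m.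
    by rewrite (le_trans (uv m))// vm.
  by rewrite (le_trans (um _ _ (ltnW mn)))// uv.
have hs : has_sup (range u) by split; [exists (u 0%N), 0%N|exists (v 0%N)].
exists (sup (range u)) => n; apply/andP; split.
  by apply: sup_upper_bound => //; exists n.
by apply: sup_le_ub => //; exists (u 0%N), 0%N.
Qed.

(** The boundary integral of q dz over a rectangle of the parameters (t, x) of
    a C^1 map H vanishes if q is differentiable along the image of H: if it did
    not, repeated quartering would produce rectangles shrinking to a point, on
    which the integral is not small compared with the area. *)
Section Rectangle.
Variables (H Ht Hx : R -> R -> R[i]) (q : R[i] -> R[i]).
Variables (t0 h x0 k L : R).
Hypotheses (h_ge0 : 0 <= h) (k_ge0 : 0 <= k).

Let inside t x := (t0 <= t <= t0 + h) && (x0 <= x <= x0 + k).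

Hypothesis dHt : forall t x, inside t x ->
  rdrv (fun t => H t x) t (Ht t x) /\ ccont (fun t => Ht t x) t.
Hypothesis dHx : forall t x, inside t x ->
  rdrv (H t) x (Hx t x) /\ ccont (Hx t) x.
Hypothesis HL : forall t x, inside t x -> normc (Ht t x) <= L /\ normc (Hx t x) <= L.
Hypothesis dq : forall t x, inside t x -> cderivable q (H t x).

Let St p x a b := path_integral p (fun t => H t x) (fun t => Ht t x) a b.
Let Sx p t a b := path_integral p (H t) (Hx t) a b.
Let J p a b c d := Sx p b c d - Sx p a c d - St p d a b + St p c a b.

Let inP a b c d t x : t0 <= a -> b <= t0 + h -> x0 <= c -> d <= x0 + k ->
  a <= t <= b -> c <= x <= d -> inside t x.
Proof.
move=> h1 h2 h3 h4 /andP[h5 h6] /andP[h7 h8]; rewrite /inside.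
by apply/andP; split; apply/andP; split; lra.
Qed.

Let regT p x a b : (forall t, a <= t <= b -> cderivable p (H t x)) ->
  t0 <= a -> b <= t0 + h -> x0 <= x <= x0 + k ->
  regular_path p (fun t => H t x) (fun t => Ht t x) a b.
Proof.
move=> dp h1 h2 hx t tab; have it : inside t x.
  by apply: (@inP a b x0 (x0 + k)) => //; rewrite ?lexx.
by have [? ?] := dHt it; split => //; exact: dp.
Qed.

Let regX p t a b : (forall x, a <= x <= b -> cderivable p (H t x)) ->
  x0 <= a -> b <= x0 + k -> t0 <= t <= t0 + h ->
  regular_path p (H t) (Hx t) a b.
Proof.
move=> dp h1 h2 ht x xab; have it : inside t x.
  by apply: (@inP t0 (t0 + h) a b) => //; rewrite ?lexx.
by have [? ?] := dHx it; split => //; exact: dp.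
Qed.

Let J_quarter a m b c n d : t0 <= a -> a <= m -> m <= b -> b <= t0 + h ->
  x0 <= c -> c <= n -> n <= d -> d <= x0 + k ->
  J q a b c d = J q a m c n + J q a m n d + J q m b c n + J q m b n d.
Proof.
move=> h1 h2 h3 h4 h5 h6 h7 h8.
have sT x : x0 <= x <= x0 + k -> St q x a b = St q x a m + St q x m b.
  move=> hx; apply: path_integral_split => //; apply: regT => // t tab.
  by apply: dq; apply: (@inP a b x0 (x0 + k)).
have sX t : t0 <= t <= t0 + h -> Sx q t c d = Sx q t c n + Sx q t n d.
  move=> ht; apply: path_integral_split => //; apply: regX => // x xcd.
  by apply: dq; apply: (@inP t0 (t0 + h) c d).
have hc : x0 <= c <= x0 + k by apply/andP; split; lra.
have hd : x0 <= d <= x0 + k by apply/andP; split; lra.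
have hn : x0 <= n <= x0 + k by apply/andP; split; lra.
have ha : t0 <= a <= t0 + h by apply/andP; split; lra.
have hb : t0 <= b <= t0 + h by apply/andP; split; lra.
have hm : t0 <= m <= t0 + h by apply/andP; split; lra.
by rewrite /J (sX a)// (sX b)// (sT c)// (sT d)//; ring.
Qed.

Let Lip t x t' x' : inside t x -> inside t' x' ->
  normc (H t x - H t' x') <= 2 * L * (`|t - t'| + `|x - x'|).
Proof.
move=> hi hi'.
have hi2 : inside t' x by move: hi hi' => /andP[_ hx] /andP[ht _]; rewrite /inside ht.
have mvt (g g' : R -> R[i]) (a b a0 k0 : R) : a0 <= a <= a0 + k0 -> a0 <= b <= a0 + k0 ->
    (forall y, a0 <= y <= a0 + k0 -> rdrv g y (g' y) /\ normc (g' y) <= L) ->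
    normc (g a - g b) <= 2 * L * `|a - b|.
  move=> ha hb hg; wlog ba : a b ha hb / b <= a.
    move=> W; have [/W|/ltW /W] := leP b a; first exact.
    by rewrite normc_distC distrC; apply.
  rewrite ger0_norm ?subr_ge0//.
  have sub y : b <= y <= a -> a0 <= y <= a0 + k0.
    by move: ha hb => /andP[? ?] /andP[? ?] /andP[? ?]; apply/andP; split; lra.
  by apply: (@mean_value_ineq _ g g') => // y /sub /hg[].
rewrite (_ : H t x - H t' x' = (H t x - H t' x) + (H t' x - H t' x')); last by ring.
rewrite (le_trans (normcD _ _))// mulrDr lerD//.
  apply: (mvt (fun t => H t x) (fun t => Ht t x) t t' t0 h).
  - by move: hi => /andP[].
  - by move: hi' => /andP[].
  - move=> y hy; have hyx : inside y x by move: hi => /andP[_ hx]; rewrite /inside hy.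
    by have [? _] := dHt hyx; have [? _] := HL hyx.
apply: (mvt (H t') (Hx t') x x' x0 k).
- by move: hi => /andP[].
- by move: hi' => /andP[].
- move=> y hy; have hyx : inside t' y by move: hi' => /andP[ht _]; rewrite /inside ht.
  by have [? _] := dHx hyx; have [_ ?] := HL hyx.
Qed.

Let L_ge0 : 0 <= L.
Proof.
have h0 : inside t0 x0 by rewrite /inside !lexx !lerDl h_ge0.
by have [h1 _] := HL h0; exact: le_trans (normc_ge0 _) h1.
Qed.

(** Up to an affine function, whose boundary integral vanishes, q is o(|z - z0|)
    near the image z0 of the point (ts, xs) *)
Let J_small ts xs (e : R) : inside ts xs -> 0 < e -> exists2 d : R, 0 < d &
  forall a c s l, 0 <= s -> 0 <= l -> t0 <= a -> a + s <= t0 + h ->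
    x0 <= c -> c + l <= x0 + k -> a <= ts <= a + s -> c <= xs <= c + l ->
    s + l < d -> normc (J q a (a + s) c (c + l)) <= e * (s + l) ^+ 2.
Proof.
move=> his e0; set z0 := H ts xs.
have [B hB] := dq his.
have K0 : 0 < 8 * L ^+ 2 + 1 by have := sqr_ge0 L; lra.
have [d d0 hd] := hB (e / (8 * L ^+ 2 + 1)) (divr_gt0 e0 K0).
have L1 : 0 < 2 * L + 1 by have := L_ge0; lra.
exists (d / (2 * L + 1)); first exact: divr_gt0.
move=> a c s l s0 l0 ha hs hc hl hts hxs; rewrite ltr_pdivlMr// => sld.
pose lin z := q z0 + B * (z - z0).
have dlin z : cderivable lin z.
  apply: cderivableD; first exact: cderivable_cst.
  apply: cderivableM; first exact: cderivable_cst.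
  by apply: cderivableB; [exact: cderivable_id|exact: cderivable_cst].
pose rem z := q z - lin z.
have asl : a <= a + s by rewrite lerDl.
have csl : c <= c + l by rewrite lerDl.
have ins t x : a <= t <= a + s -> c <= x <= c + l -> inside t x by exact: inP.
have Ha : a <= a <= a + s by rewrite lexx asl.
have Hb : a <= a + s <= a + s by rewrite lexx asl.
have Hc : c <= c <= c + l by rewrite lexx csl.
have Hd : c <= c + l <= c + l by rewrite lexx csl.
have remM t x : a <= t <= a + s -> c <= x <= c + l ->
    normc (rem (H t x)) <= e / (8 * L ^+ 2 + 1) * (2 * L * (s + l)).
  move=> ht hx; have it := ins _ _ ht hx.
  have D : normc (H t x - z0) <= 2 * L * (s + l).
    rewrite (le_trans (Lip it his))// ler_wpM2l ?mulr_ge0 ?L_ge0// lerD//.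
      move: ht hts => /andP[? ?] /andP[? ?].
      by rewrite ler_norml; apply/andP; split; lra.
    move: hx hxs => /andP[? ?] /andP[? ?].
    by rewrite ler_norml; apply/andP; split; lra.
  have -> : rem (H t x) = q (H t x) - q z0 - B * (H t x - z0) by rewrite /rem /lin; ring.
  rewrite (le_trans (hd _ _))//.
    have sl0 : 0 <= s + l by lra.
    by apply: (le_lt_trans D); apply: le_lt_trans sld; nra.
  by rewrite ler_wpM2l// ltW// divr_gt0.
have x0k y : c <= y <= c + l -> x0 <= y <= x0 + k.
  by move=> /andP[? ?]; apply/andP; split; lra.
have t0h y : a <= y <= a + s -> t0 <= y <= t0 + h.
  by move=> /andP[? ?]; apply/andP; split; lra.
have drem t x : a <= t <= a + s -> c <= x <= c + l -> cderivable rem (H t x).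
  by move=> ht hx; apply: cderivableB; [apply: dq; exact: ins|exact: dlin].
have bT x : c <= x <= c + l ->
    normc (St rem x a (a + s)) <= e / (8 * L ^+ 2 + 1) * (2 * L * (s + l)) * L * (s + l).
  move=> hx; apply: (@le_trans _ _ (e / (8 * L ^+ 2 + 1) * (2 * L * (s + l)) * L * (a + s - a))).
    apply: normc_path_integral => //.
    - by apply: regT => //; [move=> t ht; exact: drem|exact: x0k].
    - by move=> t ht; exact: remM.
    - by move=> t ht; have [] := HL (ins _ _ ht hx).
  apply: ler_wpM2l; last by lra.
  by rewrite !mulr_ge0 ?L_ge0 ?invr_ge0//; lra.
have bX t : a <= t <= a + s ->
    normc (Sx rem t c (c + l)) <= e / (8 * L ^+ 2 + 1) * (2 * L * (s + l)) * L * (s + l).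
  move=> ht; apply: (@le_trans _ _ (e / (8 * L ^+ 2 + 1) * (2 * L * (s + l)) * L * (c + l - c))).
    apply: normc_path_integral => //.
    - by apply: regX => //; [move=> x hx; exact: drem|exact: t0h].
    - by move=> x hx; exact: remM.
    - by move=> x hx; have [] := HL (ins _ _ ht hx).
  apply: ler_wpM2l; last by lra.
  by rewrite !mulr_ge0 ?L_ge0 ?invr_ge0//; lra.
have lT x : c <= x <= c + l -> let P z := q z0 * z + B / 2 * (z - z0) ^+ 2 in
    St q x a (a + s) = St rem x a (a + s) + (P (H (a + s) x) - P (H a x)).
  move=> hx P.
  have <- : St lin x a (a + s) = P (H (a + s) x) - P (H a x).
    apply: (@path_integral_affine (q z0) B z0 (fun t => H t x)) => //.
    by apply: regT => //; exact: x0k.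
  rewrite /St /rem path_integralB ?subrK//.
    by apply: regT => //; [move=> t ht; apply: dq; exact: ins|exact: x0k].
  by apply: regT => //; exact: x0k.
have lX t : a <= t <= a + s -> let P z := q z0 * z + B / 2 * (z - z0) ^+ 2 in
    Sx q t c (c + l) = Sx rem t c (c + l) + (P (H t (c + l)) - P (H t c)).
  move=> ht P.
  have <- : Sx lin t c (c + l) = P (H t (c + l)) - P (H t c).
    apply: (@path_integral_affine (q z0) B z0 (H t)) => //.
    by apply: regX => //; exact: t0h.
  rewrite /Sx /rem path_integralB ?subrK//.
    by apply: regX => //; [move=> x hx; apply: dq; exact: ins|exact: t0h].
  by apply: regX => //; exact: t0h.
have -> : J q a (a + s) c (c + l) = J rem a (a + s) c (c + l).
  by rewrite /J (lX a)// (lX (a + s))// (lT c)// (lT (c + l))//=; ring.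
rewrite /J (le_trans (normcD _ _))//.
apply: (@le_trans _ _ (4 * (e / (8 * L ^+ 2 + 1) * (2 * L * (s + l)) * L * (s + l)) / 2 * 2)).
  have B1 := bT _ Hc; have B2 := bT _ Hd; have B3 := bX _ Ha; have B4 := bX _ Hb.
  have B5 := normcB (Sx rem (a + s) c (c + l) - Sx rem a c (c + l)) (St rem (c + l) a (a + s)).
  have B6 := normcB (Sx rem (a + s) c (c + l)) (Sx rem a c (c + l)).
  by lra.
have -> : 4 * (e / (8 * L ^+ 2 + 1) * (2 * L * (s + l)) * L * (s + l)) / 2 * 2 =
    e * (s + l) ^+ 2 * (8 * L ^+ 2 / (8 * L ^+ 2 + 1)) by field; lra.
rewrite ler_piMr//; first by rewrite mulr_ge0 ?sqr_ge0 ?ltW.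
by rewrite ler_pdivrMr//; lra.
Qed.

Lemma goursat : J q t0 (t0 + h) x0 (x0 + k) = 0.
Proof.
apply: contrapT => /eqP J0.
pose s n := h / 2 ^+ n; pose l n := k / 2 ^+ n.
have sS n : s n = s n.+1 + s n.+1.
  by rewrite /s exprS; field; rewrite expf_neq0.
have lS n : l n = l n.+1 + l n.+1.
  by rewrite /l exprS; field; rewrite expf_neq0.
have s_ge0 n : 0 <= s n by rewrite divr_ge0// exprn_ge0.
have l_ge0 n : 0 <= l n by rewrite divr_ge0// exprn_ge0.
pose valid n (p : R * R) := [/\ t0 <= p.1, p.1 + s n <= t0 + h,
  x0 <= p.2 & p.2 + l n <= x0 + k].
pose Jn n (p : R * R) := normc (J q p.1 (p.1 + s n) p.2 (p.2 + l n)).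
pose near_corner n (p p' : R * R) := [/\ p.1 <= p'.1, p'.1 + s n.+1 <= p.1 + s n,
  p.2 <= p'.2 & p'.2 + l n.+1 <= p.2 + l n].
have step : forall np : nat * (R * R), exists p', valid np.1 np.2 ->
    [/\ valid np.1.+1 p', near_corner np.1 np.2 p' &
        Jn np.1 np.2 <= 4 * Jn np.1.+1 p'].
  move=> [n p]; have [v|nv] := pselect (valid n p); last by exists p => /nv.
  have [v1 v2 v3 v4] := v; move: (sS n) (lS n) (s_ge0 n.+1) (l_ge0 n.+1) => Sn Ln S0 L0.
  have good p' : (p'.1 = p.1 \/ p'.1 = p.1 + s n.+1) ->
      (p'.2 = p.2 \/ p'.2 = p.2 + l n.+1) -> valid n.+1 p' /\ near_corner n p p'.
    rewrite /valid /near_corner => h1 h2.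
    by case: h1 => ->; case: h2 => ->; split; split; lra.
  have := @J_quarter p.1 (p.1 + s n.+1) (p.1 + s n) p.2 (p.2 + l n.+1) (p.2 + l n).
  rewrite (_ : p.1 + s n = p.1 + s n.+1 + s n.+1); last by rewrite Sn; ring.
  rewrite (_ : p.2 + l n = p.2 + l n.+1 + l n.+1); last by rewrite Ln; ring.
  move=> Q; have {}Q : Jn n p <= Jn n.+1 (p.1, p.2) + Jn n.+1 (p.1, p.2 + l n.+1) +
      Jn n.+1 (p.1 + s n.+1, p.2) + Jn n.+1 (p.1 + s n.+1, p.2 + l n.+1).
    rewrite /Jn (_ : p.1 + s n = p.1 + s n.+1 + s n.+1); last by rewrite Sn; ring.
    rewrite (_ : p.2 + l n = p.2 + l n.+1 + l n.+1); last by rewrite Ln; ring.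
    rewrite Q; [|lra..].
    do 3 (rewrite (le_trans (normcD _ _))//; apply: lerD => //).
  have [h1|h1] := leP (Jn n p) (4 * Jn n.+1 (p.1, p.2)).
    by exists (p.1, p.2) => _; have [] := good (p.1, p.2); [left|left|split].
  have [h2|h2] := leP (Jn n p) (4 * Jn n.+1 (p.1, p.2 + l n.+1)).
    by exists (p.1, p.2 + l n.+1) => _;
      have [] := good (p.1, p.2 + l n.+1); [left|right|split].
  have [h3|h3] := leP (Jn n p) (4 * Jn n.+1 (p.1 + s n.+1, p.2)).
    by exists (p.1 + s n.+1, p.2) => _;
      have [] := good (p.1 + s n.+1, p.2); [right|left|split].
  exists (p.1 + s n.+1, p.2 + l n.+1) => _.
  have [] := good (p.1 + s n.+1, p.2 + l n.+1); [by right|by right|split => //].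
  by move: Q h1 h2 h3; lra.
have [F FP] := choice step.
pose p := fix p n := if n is n'.+1 then F (n', p n') else (t0, x0).
have s0 : s 0%N = h by rewrite /s expr0 divr1.
have l0 : l 0%N = k by rewrite /l expr0 divr1.
have pv n : valid n (p n).
  elim: n => [|n IH]; first by rewrite /valid s0 l0 /= !lexx.
  by have [] := FP (n, p n) IH.
have pS n : near_corner n (p n) (p n.+1) by have [] := FP (n, p n) (pv n).
have pJ n : Jn 0%N (p 0%N) <= 4 ^+ n * Jn n (p n).
  elim: n => [|n IH]; first by rewrite expr0 mul1r.
  have [_ _ h1] := FP (n, p n) (pv n); rewrite (le_trans IH)//.
  by rewrite exprSr -mulrA ler_wpM2l// exprn_ge0.
have [ts hts] : exists x, forall n, (p n).1 <= x <= (p n).1 + s n.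
  apply: nested_intervals => n; [by have [] := pS n|by have [] := pS n|].
  by rewrite lerDl.
have [xs hxs] : exists x, forall n, (p n).2 <= x <= (p n).2 + l n.
  apply: nested_intervals => n; [by have [] := pS n|by have [] := pS n|].
  by rewrite lerDl.
have his : inside ts xs.
  by have := hts 0%N; have := hxs 0%N; rewrite s0 l0 /inside /= => -> ->.
have Jpos : 0 < Jn 0%N (p 0%N) by rewrite /Jn s0 l0 normc_gt0; exact: J0.
set eta := Jn 0%N (p 0%N) in Jpos pJ.
have K0 : 0 < 2 * ((h + k) ^+ 2 + 1) by have := sqr_ge0 (h + k); lra.
have [d d0 hd] := J_small his (divr_gt0 Jpos K0).
have [n hn] : exists n, s n + l n < d.
  have [n hn] : exists n : nat, (h + k) / d < n%:R.
    by exists (Num.truncn ((h + k) / d)).+1; rewrite truncnS_gt.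
  exists n; rewrite /s /l -mulrDl ltr_pdivrMr ?exprn_gt0//.
  move: hn; rewrite ltr_pdivrMr// => hn; rewrite (lt_trans hn)// mulrC.
  by rewrite ltr_pM2l// -natrX ltr_nat ltn_expl.
have [v1 v2 v3 v4] := pv n.
have hJ := hd _ _ _ _ (s_ge0 n) (l_ge0 n) v1 v2 v3 v4 (hts n) (hxs n) hn.
have := pJ n; apply/negP; rewrite -ltNge.
apply: (@le_lt_trans _ _ (4 ^+ n * (eta / (2 * ((h + k) ^+ 2 + 1)) * (s n + l n) ^+ 2))).
  by rewrite ler_wpM2l// exprn_ge0.
have -> : 4 ^+ n * (eta / (2 * ((h + k) ^+ 2 + 1)) * (s n + l n) ^+ 2) =
    eta * ((h + k) ^+ 2 / (2 * ((h + k) ^+ 2 + 1))).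
  rewrite /s /l (_ : 4 = 2 ^+ 2 :> R); last by rewrite -natrX.
  rewrite -exprM mulnC exprM; field.
  by rewrite expf_neq0// andbT; apply: lt0r_neq0; have := sqr_ge0 (h + k); lra.
rewrite gtr_pMr// ltr_pdivrMr//; have := sqr_ge0 (h + k); lra.
Qed.

End Rectangle.
End Goursat.

(** * Cauchy's integral formula and its consequences *)

Section CauchyTransform.
Context {R : realType}.
Notation mu := (@lebesgue_measure R).
Implicit Types (phi : R -> R[i]) (w z a c : R[i]).

Definition cis (x : R) : R[i] := cexp (0 +i* x).

Lemma normc_i : normc ('i%C : R[i]) = 1.
Proof. by rewrite /Normc.normc expr0n expr1n add0r sqrtr1. Qed.

Lemma normc_cis x : normc (cis x) = 1.
Proof. by rewrite normc_cexp expR0. Qed.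

Lemma cis_neq0 x : cis x != 0. Proof. exact: cexp_neq0. Qed.

Lemma cis0 : cis 0 = 1. Proof. exact: cexp0. Qed.

Lemma cis_2pi : cis (2 * pi) = 1.
Proof.
apply: eqC; rewrite /= expR0 mul1r mulr_natl.
  by rewrite cos2pi.
by rewrite sin2pi.
Qed.

Lemma rdrv_cis (x : R) : rdrv cis x ('i * cis x).
Proof.
rewrite /cis (_ : (fun x => _) = (fun x : R => cexp (x%:C * 'i))).
  have -> : cexp (0 +i* x) = cexp (x%:C * 'i) by congr cexp; simpc.
  exact: rdrv_cexp_line.
by apply/funext => y; congr cexp; simpc.
Qed.

Lemma ccont_cis x : ccont cis x.
Proof. exact: rdrv_ccont (rdrv_cis x). Qed.

Definition cauchy_transform (r : R) phi w : R[i] :=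
  cintegral `[0, 2 * pi] (fun x => phi x / (1 - w / (r%:C * cis x))).

Let pi2_ge0 : 0 <= 2 * pi :> R. Proof. by rewrite mulr_ge0// pi_ge0. Qed.

Section Fixed.
Variables (r : R) (r_gt0 : 0 < r).

Let rho x := r%:C * cis x.

Let rC_neq0 : r%:C != 0 :> R[i].
Proof. by rewrite (_ : 0 = 0%:C)// (inj_eq (@complexI _)) gt_eqF. Qed.

Let rho_neq0 x : rho x != 0. Proof. by rewrite mulf_neq0// cis_neq0. Qed.

Let normc_rho x : normc (rho x) = r.
Proof. by rewrite normcM normc_cis mulr1 normc_real gtr0_norm. Qed.

Let den_ge w x : normc w < r -> 1 - normc w / r <= normc (1 - w / rho x).
Proof.
move=> wr; have := normc_triB 1 (w / rho x).
by rewrite normc1 normcM normcV normc_rho.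
Qed.

Let gap w : normc w < r -> 0 < 1 - normc w / r.
Proof. by move=> wr; rewrite subr_gt0 ltr_pdivrMr// mul1r. Qed.

Let den_neq0 w x : normc w < r -> 1 - w / rho x != 0.
Proof. by move=> wr; rewrite -normc_gt0 (lt_le_trans (gap wr))// den_ge. Qed.

Definition circle_bounded phi (M : R) := mfunC `[0, 2 * pi] phi /\
  forall x, 0 <= x <= 2 * pi -> normc (phi x) <= M.

Lemma circle_bounded_cont phi :
  (forall x, 0 <= x <= 2 * pi -> ccont phi x) -> exists M, circle_bounded phi M.
Proof.
move=> cp.
have aux (h : R -> R) : (forall x, 0 <= x <= 2 * pi -> {for x, continuous h}) ->
    exists M, forall x, 0 <= x <= 2 * pi -> `|h x| <= M.
  move=> ch; have cn : {within `[0, 2 * pi], continuous (fun x => `|h x|)}.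
    by apply: continuous_itv_within => x /ch hx; apply: continuous_comp hx _;
      exact: norm_continuous.
  have [m _ hm] := EVT_max pi2_ge0 cn.
  by exists `|h m| => x hx; apply: hm; rewrite in_itv.
have [M1 h1] := aux _ (fun x hx => (cp x hx).1).
have [M2 h2] := aux _ (fun x hx => (cp x hx).2).
exists (M1 + M2); split; first by apply: cintegrable_mfun; exact: ccont_cintegrable.
by move=> x hx; rewrite (le_trans (normc_le_ReIm _))// lerD// ?h1// h2.
Qed.

Lemma circle_boundedM phi psi M K :
  (forall x, 0 <= x <= 2 * pi -> ccont psi x) ->
  (forall x, 0 <= x <= 2 * pi -> normc (psi x) <= K) ->
  circle_bounded phi M -> circle_bounded (fun x => phi x * psi x) (M * K).
Proof.
move=> cp pK [mp pM]; split.
  by apply: mfunCM => //; apply: cintegrable_mfun; exact: ccont_cintegrable.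
by move=> x hx; rewrite normcM ler_pM ?normc_ge0// ?pM// pK.
Qed.

Let ccont_inv (psi : R -> R[i]) x : psi x != 0 -> ccont psi x ->
  ccont (fun y => (psi y)^-1) x.
Proof.
move=> h1 h2; apply: (@ccont_hol _ (fun z => z^-1) psi) => //.
by apply: cderivableV => //; exact: cderivable_id.
Qed.

Let ccont_rho x : ccont rho x.
Proof. by apply: ccontM; [exact: ccont_cst|exact: ccont_cis]. Qed.

Let ccont_rhoV x : ccont (fun y => (rho y)^-1) x.
Proof. by apply: ccont_inv => //; exact: ccont_rho. Qed.

Let ccont_den w x : normc w < r -> ccont (fun y => (1 - w / rho y)^-1) x.
Proof.
move=> wr; apply: ccont_inv; first exact: den_neq0.
apply: ccontD; first exact: ccont_cst.
by apply: ccontN; apply: ccontM; [exact: ccont_cst|exact: ccont_rhoV].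
Qed.

Let normc_denV w x : normc w < r -> normc (1 - w / rho x)^-1 <= (1 - normc w / r)^-1.
Proof.
move=> wr; rewrite normcV lef_pV2 ?den_ge//.
  by rewrite posrE normc_gt0 den_neq0.
by rewrite posrE; exact: gap.
Qed.

Let bounded_den phi M w : normc w < r -> circle_bounded phi M ->
  circle_bounded (fun x => phi x / (1 - w / rho x)) (M * (1 - normc w / r)^-1).
Proof.
move=> wr; apply: circle_boundedM => x _; [exact: ccont_den|exact: normc_denV].
Qed.

Let bounded_rho phi M : circle_bounded phi M ->
  circle_bounded (fun x => phi x / rho x) (M * r^-1).
Proof.
apply: circle_boundedM => x _; first exact: ccont_rhoV.
by rewrite normcV normc_rho.
Qed.

Lemma circle_bounded_cintegrable phi M : circle_bounded phi M ->
  cintegrable `[0, 2 * pi] phi.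
Proof.
move=> [mp pM]; apply: (@cintegrable_le _ _ _ (fun=> M)) => //.
  exact: integrable_itv_cst.
Qed.

Lemma normc_cintegral_circle phi M : circle_bounded phi M ->
  normc (cintegral `[0, 2 * pi] phi) <= M * (2 * pi).
Proof.
move=> [mp pM]; rewrite -[2 * pi]subr0 -Rintegral_itv_cst//.
rewrite subr0; apply: normc_cintegral_le => //.
  exact: integrable_itv_cst.
Qed.

Lemma cauchy_kernel_cintegrable phi M w : normc w < r -> circle_bounded phi M ->
  cintegrable `[0, 2 * pi] (fun x => phi x / (1 - w / (r%:C * cis x))).
Proof. by move=> wr hp; exact: circle_bounded_cintegrable (bounded_den wr hp). Qed.

Lemma normc_cauchy_transform phi M w : normc w < r -> circle_bounded phi M ->
  normc (cauchy_transform r phi w) <= M * (1 - normc w / r)^-1 * (2 * pi).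
Proof. by move=> wr hp; apply: normc_cintegral_circle; exact: bounded_den. Qed.

(** One step of the geometric series expansion of the kernel *)
Lemma cauchy_transform_step phi M w : normc w < r -> circle_bounded phi M ->
  cauchy_transform r phi w = cintegral `[0, 2 * pi] phi +
    w * cauchy_transform r (fun x => phi x / rho x) w.
Proof.
move=> wr hp; have h2 := bounded_den wr (bounded_rho hp).
have i2 := circle_bounded_cintegrable h2.
rewrite /cauchy_transform -cintegralZ// -cintegralD//; last 2 first.
- exact: circle_bounded_cintegrable hp.
- exact: cintegrableZ.
apply: eq_cintegral => x _; have := den_neq0 x wr; have := rho_neq0 x.
move: (phi x); rewrite -/(rho x); move: (rho x) => q p q0 d0.
field; rewrite q0 andTb.
by move: d0; apply: contra => /eqP h; rewrite -(mulfK q0 (1 - w / q)) mulrBl mul1r mulfVK// h mul0r.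
Qed.

Lemma cauchy_transformB phi M w w0 : normc w < r -> normc w0 < r ->
  circle_bounded phi M ->
  cauchy_transform r phi w - cauchy_transform r phi w0 =
  (w - w0) * cauchy_transform r (fun x => phi x / (1 - w0 / rho x) / rho x) w.
Proof.
move=> wr wr0 hp.
have i1 := circle_bounded_cintegrable (bounded_den wr hp).
have i2 := circle_bounded_cintegrable (bounded_den wr0 hp).
have i3 := circle_bounded_cintegrable (bounded_den wr (bounded_rho (bounded_den wr0 hp))).
rewrite /cauchy_transform -cintegralB// -cintegralZ//.
apply: eq_cintegral => x _; have := den_neq0 x wr; have := den_neq0 x wr0.
have := rho_neq0 x; rewrite -/(rho x).
move: (phi x) (rho x) => p q q0 d0 d.
have e (u : R[i]) : 1 - u / q != 0 -> q - u != 0.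
  apply: contra => /eqP h; rewrite -(mulfK q0 (1 - u / q)) mulrBl mul1r mulfVK//.
  by rewrite h mul0r.
by field; rewrite q0 !e.
Qed.

(** By cauchy_transformB, used twice, the difference quotient at w0 is the transform
    of psi at w0 up to w - w0 times a transform that stays bounded *)
Lemma cderivable_cauchy_transform phi M w0 : normc w0 < r -> circle_bounded phi M ->
  cderivable (cauchy_transform r phi) w0.
Proof.
move=> wr0 hp; pose psi x := phi x / (1 - w0 / rho x) / rho x.
have hpsi := bounded_rho (bounded_den wr0 hp).
have hpsi2 := bounded_rho (bounded_den wr0 hpsi).
exists (cauchy_transform r psi w0) => e e0.
set M2 := (X in circle_bounded _ X) in hpsi2.
pose rr := (normc w0 + r) / 2.
have rr1 : normc w0 < rr by rewrite /rr; lra.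
have rr2 : rr < r by rewrite /rr; lra.
have rr0 : 0 < 1 - rr / r by rewrite subr_gt0 ltr_pdivrMr// mul1r.
pose K := `|M2| * (1 - rr / r)^-1 * (2 * pi).
have K0 : 0 <= K.
  by rewrite /K; apply: mulr_ge0 => //; rewrite mulr_ge0// invr_ge0 ltW.
exists (Num.min (rr - normc w0) (e / (K + 1))).
  by rewrite lt_min subr_gt0 rr1 divr_gt0//; lra.
move=> w; rewrite lt_min => /andP[h1 h2].
have wrr : normc w < rr.
  have := normcD (w - w0) w0; rewrite subrK; lra.
have wr : normc w < r by lra.
rewrite (cauchy_transformB wr wr0 hp) -/psi [X in normc (_ - X)]mulrC -mulrBr.
rewrite (cauchy_transformB wr wr0 hpsi) !normcM.
apply: (@le_trans _ _ (normc (w - w0) * (normc (w - w0) * K))).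
  do 2 (rewrite ler_wpM2l ?normc_ge0//).
  apply: (le_trans (normc_cauchy_transform wr hpsi2)).
  rewrite /K ler_wpM2r//; apply: (@le_trans _ _ (`|M2| * (1 - normc w / r)^-1)).
    by rewrite ler_wpM2r ?ler_norm// invr_ge0 ltW// gap.
  rewrite ler_wpM2l// lef_pV2 ?posrE ?gap//.
  by rewrite lerB// ler_wpM2r// ?invr_ge0 ltW.
rewrite mulrC ler_wpM2r ?normc_ge0//.
move: h2; rewrite ltr_pdivlMr; last by lra.
have := normc_ge0 (w - w0); nra.
Qed.

Lemma cauchy_transform0 phi : cauchy_transform r phi 0 = cintegral `[0, 2 * pi] phi.
Proof. by apply: eq_cintegral => x _; rewrite mul0r subr0 divr1. Qed.

(** The integrand is a derivative, and cis has period 2 pi *)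
Lemma circle_moment n : cintegral `[0, 2 * pi] (fun x => (rho x)^-1 ^+ n.+1) = 0.
Proof.
pose c : R[i] := - (n.+1%:R * 'i).
have c0 : c != 0.
  rewrite oppr_eq0 mulf_neq0 ?pnatr_eq0//.
  by apply/eqP => -[] /eqP; rewrite oner_eq0.
have dcis x : rdrv (fun x => cexp (x%:C * c)) x (c * cexp (x%:C * c)).
  exact: rdrv_cexp_line.
have E x : (rho x)^-1 ^+ n.+1 = (r%:C)^-1 ^+ n.+1 * cexp (x%:C * c).
  rewrite /rho invfM exprMn; congr (_ * _).
  rewrite -cexpN -cexpMn; congr cexp; rewrite /c.
  have -> : (0 +i* x : R[i]) = x%:C * 'i by simpc.
  by ring.
rewrite (@cintegral_FTC2 _ (fun x => (r%:C)^-1 ^+ n.+1 / c * cexp (x%:C * c)))//.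
- have -> : cexp ((2 * pi)%:C * c) = 1.
    have -> : (2 * pi)%:C * c = - (n.+1%:R * (0 +i* (2 * pi))).
      by rewrite /c mulrN mulrCA; congr (- (_ * _)); simpc.
    by rewrite cexpN cexpMn -/(cis (2 * pi)) cis_2pi expr1n invr1.
  by rewrite mul0r cexp0 subrr.
- move=> x _; rewrite E; have := rdrvZ ((r%:C)^-1 ^+ n.+1 / c) (dcis x).
  by apply: rdrv_eq; rewrite mulrA -[X in X * _]mulrA mulVf// mulr1.
- move=> x _; rewrite (_ : (fun x => _) = (fun x => (r%:C)^-1 ^+ n.+1 * cexp (x%:C * c))).
    by apply: ccontM; [exact: ccont_cst|exact: (rdrv_ccont (dcis x))].
  by apply/funext => y; rewrite E.
Qed.

(** All the moments of phi up to n being zero, the transform is w ^ n times the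
    transform of phi / rho ^ n *)
Lemma cauchy_transform_iter phi M n w : normc w < r -> circle_bounded phi M ->
  (forall k, (k < n)%N -> cintegral `[0, 2 * pi] (fun x => phi x * (rho x)^-1 ^+ k) = 0) ->
  cauchy_transform r phi w =
    w ^+ n * cauchy_transform r (fun x => phi x * (rho x)^-1 ^+ n) w.
Proof.
move=> wr hp; have hpk k : circle_bounded (fun x => phi x * (rho x)^-1 ^+ k) (M * r^-1 ^+ k).
  elim: k => [|k IH].
    by rewrite expr0 mulr1; under eq_fun do rewrite expr0 mulr1.
  have := bounded_rho IH; rewrite -mulrA -exprSr.
  by under eq_fun do rewrite -mulrA -exprSr.
elim: n => [|n IH] hk.
  by rewrite expr0 mul1r; apply: eq_cintegral => x _; rewrite expr0 mulr1.
rewrite IH; last by move=> k kn; apply: hk; rewrite ltnS ltnW.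
rewrite (cauchy_transform_step wr (hpk n)) hk// add0r mulrA -exprSr.
congr (_ * _); apply: eq_cintegral => x _.
by rewrite exprSr !mulrA.
Qed.

(** By cauchy_transform_iter the value is at most a constant times (normc w / r) ^ n
    for every n *)
Lemma cauchy_transform_eq0 phi M w : normc w < r -> circle_bounded phi M ->
  (forall k, cintegral `[0, 2 * pi] (fun x => phi x * (rho x)^-1 ^+ k) = 0) ->
  cauchy_transform r phi w = 0.
Proof.
move=> wr hp hk; apply/eqP; rewrite -normc_eq0; apply/eqP.
apply: contrapT => /eqP; rewrite neq_lt ltNge normc_ge0 /= => ct0.
have hpk k : circle_bounded (fun x => phi x * (rho x)^-1 ^+ k) (M * r^-1 ^+ k).
  apply: circle_boundedM => // x _.
    elim: k => [|k IH]; first by under eq_fun do rewrite expr0; exact: ccont_cst.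
    by under eq_fun do rewrite exprS; apply: ccontM.
  by rewrite normcX normcV normc_rho.
pose x := normc w / r; pose C := M * (1 - x)^-1 * (2 * pi).
have B n : normc (cauchy_transform r phi w) <= x ^+ n * C.
  rewrite (@cauchy_transform_iter _ M n)// normcM normcX.
  have := normc_cauchy_transform wr (hpk n).
  move=> /(ler_wpM2l (exprn_ge0 n (normc_ge0 w))) /le_trans; apply.
  by rewrite /C /x exprMn exprVn le_eqVlt; apply/orP; left; apply/eqP; ring.
have x1 : `|x| < 1.
  by rewrite ger0_norm ?divr_ge0 ?normc_ge0 ?ltW// /x ltr_pdivrMr// mul1r.
have : x ^+ n * C @[n --> \oo] --> 0 * C by apply: cvgMl; exact: cvg_expr.
rewrite mul0r => /cvgrPdist_lt /(_ _ ct0)[N _ /(_ N (leqnn N))].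
rewrite sub0r normrN; apply/negP; rewrite -leNgt (le_trans (B N))//.
exact: ler_norm.
Qed.

(** Apart from the constant term, all the moments vanish *)
Lemma cauchy_transform1 w : normc w < r -> cauchy_transform r (fun=> 1) w = (2 * pi)%:C.
Proof.
move=> wr.
have h1 : circle_bounded (fun=> 1) 1.
  by split; [exact: mfunC_cst|move=> x _; rewrite normc1].
have i1 : cintegral `[0, 2 * pi] (fun=> 1) = (2 * pi)%:C :> R[i].
  have := cintegral_real `[0, 2 * pi] (fun=> (1:R)).
  by rewrite Rintegral_itv_cst// mul1r subr0.
rewrite (cauchy_transform_step wr h1) i1.
rewrite (cauchy_transform_eq0 wr (bounded_rho h1)) ?mulr0 ?addr0// => k.
by rewrite -[RHS](circle_moment k); apply: eq_cintegral => x _; rewrite mul1r exprS.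
Qed.

Lemma cauchy_transform_subc phi M w c : normc w < r -> circle_bounded phi M ->
  cauchy_transform r (fun x => phi x - c) w =
  cauchy_transform r phi w - (2 * pi)%:C * c.
Proof.
move=> wr hp.
have h1 : circle_bounded (fun=> 1) 1.
  by split; [exact: mfunC_cst|move=> x _; rewrite normc1].
have i1 := cauchy_kernel_cintegrable wr h1.
rewrite -(cauchy_transform1 wr) [_ * c]mulrC /cauchy_transform -cintegralZ//.
rewrite -cintegralB//; last 2 first.
- exact: (cauchy_kernel_cintegrable wr hp).
- exact: cintegrableZ.
by apply: eq_cintegral => x _; rewrite mulrBl mul1r.
Qed.

End Fixed.
End CauchyTransform.

Section CauchyFormula.
Context {R : realType}.
Notation mu := (@lebesgue_measure R).
Implicit Types (f u : R[i] -> R[i]) (w z a c : R[i]).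

Let pi2_ge0 : 0 <= 2 * pi :> R. Proof. by rewrite mulr_ge0// pi_ge0. Qed.

Let i_neq0 : 'i%C != 0 :> R[i].
Proof. by apply/eqP => -[] /eqP; rewrite oner_eq0. Qed.

(** Goursat's theorem for q z = f z / (z - a) and the homotopy a + t (rho - a),
    for t in [eps, 1], shrinking the circle rho towards a *)
Lemma cauchy_formula f c (r : R) a : 0 < r ->
  (forall z, normc (z - c) <= r -> cderivable f z) -> normc (a - c) < r ->
  cauchy_transform r (fun x => f (c + r%:C * cis x)) (a - c) = (2 * pi)%:C * f a.
Proof.
move=> r0 df ar; set w := a - c.
pose v x := c + r%:C * cis x - a; pose v' x := r%:C * ('i * cis x) : R[i].
have rC0 : r%:C != 0 :> R[i].
  by rewrite (_ : 0 = 0%:C)// (inj_eq (@complexI _)) gt_eqF.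
have rho0 x : r%:C * cis x != 0 by rewrite mulf_neq0// cis_neq0.
have dv x : rdrv v x (v' x).
  have := rdrvB (rdrvD (rdrv_cst c x) (rdrvZ r%:C (rdrv_cis x))) (rdrv_cst a x).
  by apply: rdrv_eq; rewrite add0r subr0.
have cv' x : ccont v' x.
  by apply: ccontM; [exact: ccont_cst|apply: ccontM; [exact: ccont_cst|exact: ccont_cis]].
have nv' x : normc (v' x) = r.
  by rewrite !normcM normc_cis normc_i !mulr1 normc_real gtr0_norm.
have nrho x : normc (r%:C * cis x) = r.
  by rewrite normcM normc_cis mulr1 normc_real gtr0_norm.
have nv x : normc (v x) <= 2 * r.
  have -> : v x = r%:C * cis x - w by rewrite /v /w; ring.
  by rewrite (le_trans (normcB _ _))// nrho; lra.
have v0 x : v x != 0.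
  rewrite -normc_gt0; have -> : v x = r%:C * cis x - w by rewrite /v /w; ring.
  by have := normc_triB (r%:C * cis x) w; rewrite nrho; lra.
have vker x : v' x / v x = 'i / (1 - w / (r%:C * cis x)).
  have := v0 x; have -> : v x = r%:C * cis x - w by rewrite /v /w; ring.
  rewrite /v' mulrCA; move: (r%:C * cis x) (rho0 x) => q q0 d0.
  by field; rewrite q0.
pose H (t x : R) := a + t%:C * v x.
have Hdisc t x : 0 <= t <= 1 -> normc (H t x - c) <= r.
  move=> /andP[t_ge0 t1].
  have -> : H t x - c = (1 - t)%:C * w + t%:C * (r%:C * cis x).
    by rewrite /H /v /w rmorphB; ring.
  rewrite (le_trans (normcD _ _))// normcM [normc (t%:C * _)]normcM nrho !normc_real.
  rewrite !ger0_norm ?subr_ge0//; have := normc_ge0 w; nra.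
pose phi (t x : R) := f (H t x).
have hphi t : 0 <= t <= 1 -> exists M, circle_bounded (phi t) M.
  move=> ht; apply: circle_bounded_cont => x _; apply: ccont_hol.
    by apply: df; exact: Hdisc.
  apply: ccontD; first exact: ccont_cst.
  by apply: ccontM; [exact: ccont_cst|exact: rdrv_ccont (dv x)].
have phi1 : phi 1 = fun x => f (c + r%:C * cis x).
  by apply/funext => x; rewrite /phi /H /v mul1r addrC subrK.
rewrite -phi1.
have shrink (e : R) : 0 < e < 1 ->
    cauchy_transform r (phi 1) w = cauchy_transform r (phi e) w.
  move=> /andP[e0 e1].
  pose q z := f z / (z - a).
  have tC0 (t : R) : 0 < t -> t%:C != 0 :> R[i].
    by move=> t0; rewrite (_ : 0 = 0%:C)// (inj_eq (@complexI _)) gt_eqF.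
  have qE (t x : R) : 0 < t -> q (H t x) * (t%:C * v' x) =
      'i * (phi t x / (1 - w / (r%:C * cis x))).
    move=> /tC0 t0; rewrite [RHS]mulrCA -(vker x) /phi /q.
    have -> : H t x - a = t%:C * v x by rewrite /H addrAC subrr add0r.
    by field; rewrite t0 v0.
  have pE (t : R) : 0 < t <= 1 ->
      path_integral q (H t) (fun x => t%:C * v' x) 0 (2 * pi) =
      'i * cauchy_transform r (phi t) w.
    move=> /andP[t0 t1]; rewrite /cauchy_transform -cintegralZ//; last first.
      have [M hM] : exists M, circle_bounded (phi t) M by apply: hphi; rewrite ltW.
      exact: (cauchy_kernel_cintegrable r0 ar hM).
    by apply: eq_cintegral => x _; exact: qE.
  have := @goursat R H (fun _ x => v x) (fun t x => t%:C * v' x) q e (1 - e) 0 (2 * pi) (2 * r).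
  have -> : e + (1 - e) = 1 by ring.
  rewrite add0r; cbv beta zeta.
  have -> : (fun t : R => H t (2 * pi)) = (fun t => H t 0).
    by apply/funext => t; rewrite /H /v cis_2pi cis0.
  have -> : v (2 * pi) = v 0 by rewrite /v cis_2pi cis0.
  rewrite subrK !pE ?ltr01 ?lexx ?e0 ?(ltW e1)//.
  move=> G; apply: (mulfI i_neq0); apply/eqP; rewrite -subr_eq0; apply/eqP; apply: G.
  - lra.
  - exact: pi2_ge0.
  - move=> t x _; split; last exact: ccont_cst.
    have := rdrvD (rdrv_cst a t) (rdrvM (rdrv_id t) (rdrv_cst (v x) t)).
    by apply: rdrv_eq; rewrite add0r mul1r mulr0 addr0.
  - move=> t x _; split.
      by have := rdrvD (rdrv_cst a x) (rdrvZ t%:C (dv x)); apply: rdrv_eq; rewrite add0r.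
    by apply: ccontM; [exact: ccont_cst|exact: cv'].
  - move=> t x /andP[/andP[t1 t2] _]; split; first exact: nv.
    by rewrite normcM nv' normc_real ger0_norm; nra.
  - move=> t x /andP[/andP[t1 t2] _].
    have t0 : 0 < t by lra.
    apply: cderivableM; first by apply: df; apply: Hdisc; apply/andP; split; lra.
    apply: cderivableV; first by rewrite /H addrAC subrr add0r mulf_neq0// tC0.
    by apply: cderivableB; [exact: cderivable_id|exact: cderivable_cst].
apply/eqP; rewrite -subr_eq0 -normc_eq0; apply: contraT.
rewrite neq_lt ltNge normc_ge0 /=; set eta := normc _ => eta0.
pose K := (1 - normc w / r)^-1 * (2 * pi).
have K0 : 0 <= K.
  by rewrite mulr_ge0// invr_ge0 subr_ge0 ler_pdivrMr// mul1r ltW.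
have [d d0 hd] := cderivable_continuous (df a (ltW ar)) (divr_gt0 eta0 (ltr_pwDl ltr01 K0)).
pose e := Num.min (1 / 2) (d / (4 * r)).
have e0 : 0 < e by rewrite lt_min !divr_gt0// mulr_gt0.
have e1 : e < 1 by rewrite gt_min; apply/orP; left; lra.
have ed : e * (2 * r) < d.
  apply: (@le_lt_trans _ _ (d / (4 * r) * (2 * r))).
    by rewrite ler_wpM2r ?ge_min ?lexx ?orbT// mulr_ge0// ltW.
  have -> : d / (4 * r) * (2 * r) = d / 2 by field; rewrite gt_eqF.
  lra.
have [M hM] : exists M, circle_bounded (phi e) M by apply: hphi; rewrite !ltW.
have hB : circle_bounded (fun x => phi e x - f a) (eta / (1 + K)).
  split.
    apply: mfunCD; first by case: hM.
    exact: mfunC_cst.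
  move=> x _; apply/ltW/hd.
  rewrite /H addrAC subrr add0r normcM normc_real gtr0_norm//.
  by apply: le_lt_trans ed; rewrite ler_wpM2l// ltW.
have := normc_cauchy_transform r0 ar hB.
have -> : cauchy_transform r (fun x => phi e x - f a) w =
    cauchy_transform r (phi 1) w - (2 * pi)%:C * f a.
  rewrite (shrink e); last by rewrite e0.
  by apply: (@cauchy_transform_subc _ r r0 _ M); [exact: ar|exact: hM].
rewrite -/eta -/w -[X in _ <= X]mulrA -/K leNgt => /negP h; suff : eta / (1 + K) * K < eta by move=> /h.
have K1 : 0 < 1 + K by lra.
by rewrite mulrAC ltr_pdivrMr// ltr_pM2l//; lra.
Qed.

End CauchyFormula.

Section CauchyConsequences.
Context {R : realType}.
Notation mu := (@lebesgue_measure R).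
Implicit Types (f g u : R[i] -> R[i]) (w z a c : R[i]).

Let pi2_gt0 : 0 < 2 * pi :> R. Proof. by rewrite mulr_gt0// pi_gt0. Qed.

Let pi2C_neq0 : (2 * pi)%:C != 0 :> R[i].
Proof. by rewrite (_ : 0 = 0%:C)// (inj_eq (@complexI _)) gt_eqF. Qed.

Let circle_cont f c (r : R) : 0 < r ->
  (forall z, normc (z - c) <= r -> cderivable f z) ->
  exists M, circle_bounded (fun x => f (c + r%:C * cis x)) M.
Proof.
move=> r0 df; apply: circle_bounded_cont => x _; apply: ccont_hol.
  apply: df; rewrite addrAC subrr add0r normcM normc_cis mulr1 normc_real.
  by rewrite gtr0_norm.
apply: ccontD; first exact: ccont_cst.
by apply: ccontM; [exact: ccont_cst|exact: ccont_cis].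
Qed.

Let cderivable_ct (r : R) phi M z c : 0 < r -> circle_bounded phi M ->
  normc (z - c) < r -> cderivable (fun z => cauchy_transform r phi (z - c)) z.
Proof.
move=> r0 hp zr; apply: (@cderivable_comp _ (fun z => z - c)).
  by apply: cderivableB; [exact: cderivable_id|exact: cderivable_cst].
exact: cderivable_cauchy_transform hp.
Qed.

(** A zero of a holomorphic function has a finite order, unless the function
    vanishes around it: this is read off the first nonzero moment of f on a
    circle. *)
Lemma hol_zero_dichotomy f c (d : R) : 0 < d ->
  (forall z, normc (z - c) < d -> cderivable f z) ->
  (exists2 r : R, 0 < r & forall z, normc (z - c) < r -> f z = 0) \/
  exists k u (r : R), 0 < r /\ forall z, normc (z - c) < r ->
    [/\ cderivable u z, u z != 0 & f z = (z - c) ^+ k * u z].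
Proof.
move=> d0 df; pose r := d / 2.
have r0 : 0 < r by rewrite divr_gt0.
have df' z : normc (z - c) <= r -> cderivable f z.
  by move=> h; apply: df; rewrite (le_lt_trans h)// /r; lra.
have [M hM] := circle_cont r0 df'.
set phi := (fun x => _) in hM.
have fE z : normc (z - c) < r ->
    f z = ((2 * pi)%:C)^-1 * cauchy_transform r phi (z - c).
  by move=> zr; rewrite /phi (cauchy_formula r0 df' zr) mulKf.
pose mom k := cintegral `[0, 2 * pi] (fun x => phi x * (r%:C * cis x)^-1 ^+ k).
have [h0|] := pselect (forall k, mom k = 0).
  left; exists r => // z zr; rewrite fE//.
  by rewrite (cauchy_transform_eq0 r0 zr hM) ?mulr0.
move=> /existsNP[k0 /eqP hk0].
have [k hk kmin] : exists2 k, mom k != 0 & forall j, (j < k)%N -> mom j = 0.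
  have ex : exists k, mom k != 0 by exists k0.
  exists (ex_minn ex); first by case: ex_minnP.
  case: ex_minnP => k _ hmin j jk; apply/eqP; apply: contraTT jk => /hmin.
  by rewrite -leqNgt.
right; pose phik x := phi x * (r%:C * cis x)^-1 ^+ k.
have hMk : circle_bounded phik (M * r^-1 ^+ k).
  apply: circle_boundedM hM => x _.
    have rho0 y : r%:C * cis y != 0.
      by rewrite mulf_neq0 ?cis_neq0// (_ : 0 = 0%:C)// (inj_eq (@complexI _)) gt_eqF.
    apply: (@ccont_hol _ (fun z => z^-1 ^+ k)).
      apply: cderivableX; apply: cderivableV => //; exact: cderivable_id.
    by apply: ccontM; [exact: ccont_cst|exact: ccont_cis].
  by rewrite normcX normcV normcM normc_cis mulr1 normc_real gtr0_norm.
pose u z := ((2 * pi)%:C)^-1 * cauchy_transform r phik (z - c).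
have du z : normc (z - c) < r -> cderivable u z.
  move=> zr; apply: cderivableM; first exact: cderivable_cst.
  exact: (cderivable_ct r0 hMk zr).
have uc : u c != 0.
  by rewrite /u subrr cauchy_transform0 mulf_neq0 ?invr_eq0.
have c0 : normc (c - c) < r by rewrite subrr normc0.
have nuc : 0 < normc (u c) by rewrite normc_gt0.
have [d1 d10 hd1] := cderivable_continuous (du c c0) nuc.
exists k, u, (Num.min r d1); rewrite lt_min r0; split=> // z.
rewrite lt_min => /andP[zr zd]; split; first exact: du.
- rewrite -normc_gt0; have := hd1 z zd; have := normc_triB (u c) (u z).
  by rewrite normc_distC; lra.
- rewrite fE// (cauchy_transform_iter r0 zr hM (n := k))//.
  by rewrite /u mulrCA.
Qed.

(** The Cauchy integrals of the f_ n converge boundedly to that of f, which is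
    therefore its own Cauchy integral and differentiable *)
Lemma hol_limit (f_ : nat -> R[i] -> R[i]) f c (d M : R) : 0 < d ->
  (forall n z, normc (z - c) < d -> cderivable (f_ n) z) ->
  (forall n z, normc (z - c) < d -> normc (f_ n z) <= M) ->
  (forall z, normc (z - c) < d ->
    ((fun n => f_ n z) : nat -> R[i]^o) @ \oo --> (f z : R[i]^o)) ->
  cderivable f c.
Proof.
move=> d0 df fM ff; pose r := d / 2.
have r0 : 0 < r by rewrite divr_gt0.
have rd z : normc (z - c) <= r -> normc (z - c) < d.
  by move=> h; rewrite (le_lt_trans h)// /r; lra.
have onC x : normc (c + r%:C * cis x - c) < d.
  by apply: rd; rewrite addrAC subrr add0r normcM normc_cis mulr1 normc_real gtr0_norm.
pose phi_ n x := f_ n (c + r%:C * cis x); pose phi x := f (c + r%:C * cis x).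
have hM n : circle_bounded (phi_ n) M.
  have [M' [h _]] := circle_cont r0 (fun z h => df n z (rd z h)).
  by split => // x _; exact: fM.
have hphi : circle_bounded phi M.
  have [h _] := @cintegral_dominated _ `[0, 2 * pi] phi_ phi (fun=> M)
    (measurable_itv _) (fun n => (hM n).1) (fun x _ => ff _ (onC x))
    (integrable_itv_cst _ _ _) (fun n x _ => fM n _ (onC x)).
  split; first exact: cintegrable_mfun.
  move=> x _; have /cvgCP hx := ff _ (onC x).
  apply/ler_addgt0Pr => e e0; have [N _ /(_ N (leqnn N)) /= h1] := hx e e0.
  have h2 := fM N _ (onC x); have := normc_triB (phi x) (phi_ N x).
  by rewrite normc_distC; rewrite -/(phi x) -/(phi_ N x) in h1 h2; lra.
have fE z : normc (z - c) < r -> f z = ((2 * pi)%:C)^-1 * cauchy_transform r phi (z - c).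
  move=> zr; have zd : normc (z - c) < d by apply: rd; exact: ltW.
  have C1 : ((fun n => (2 * pi)%:C * f_ n z) : nat -> R[i]^o) @ \oo -->
      ((2 * pi)%:C * f z : R[i]^o).
    by apply: cvgMr; exact: ff.
  have C2 : ((fun n => (2 * pi)%:C * f_ n z) : nat -> R[i]^o) @ \oo -->
      (cauchy_transform r phi (z - c) : R[i]^o).
    rewrite (_ : (fun n => _) = (fun n => cauchy_transform r (phi_ n) (z - c))); last first.
      apply/funext => n; rewrite (cauchy_formula r0 _ zr)// => w /rd; exact: df.
    have K0 x : normc (1 - (z - c) / (r%:C * cis x))^-1 <= (1 - normc (z - c) / r)^-1.
      have h1 : 0 < 1 - normc (z - c) / r by rewrite subr_gt0 ltr_pdivrMr// mul1r.
      have := normc_triB 1 ((z - c) / (r%:C * cis x)).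
      rewrite normc1 normcM !normcV normcM normc_cis mulr1 normc_real gtr0_norm// => h2.
      by rewrite lef_pV2 ?posrE//; exact: lt_le_trans h1 h2.
    apply: (@cintegral_dominated _ `[0, 2 * pi] _ _
      (fun=> M * (1 - normc (z - c) / r)^-1) (measurable_itv _) _ _
      (integrable_itv_cst _ _ _) _).2.
    - by move=> n; apply: cintegrable_mfun; exact: (cauchy_kernel_cintegrable r0 zr (hM n)).
    - by move=> x _; apply: cvgMl; exact: ff.
    - by move=> n x _; rewrite normcM ler_pM ?normc_ge0//; exact: fM.
  have := cvg_unique (@norm_hausdorff _ R[i]^o) C1 C2 => <-.
  by rewrite mulKf.
apply: (cderivable_ext r0 (fun z zr => esym (fE z zr))).
apply: cderivableM; first exact: cderivable_cst.
by apply: (cderivable_ct r0 hphi); rewrite subrr normc0.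
Qed.

(** By hol_zero_dichotomy the points around which f vanishes form an open set
    with open complement in D; a segment from z0 to w cannot leave it. *)
Lemma hol_identity (D : R[i] -> Prop) f z0 :
  (forall z, D z -> exists2 d : R, 0 < d & forall w, normc (w - z) < d -> D w) ->
  (forall z w (t : R), D z -> D w -> 0 <= t <= 1 -> D (z + t%:C * (w - z))) ->
  (forall z, D z -> cderivable f z) -> D z0 ->
  (exists2 d : R, 0 < d & forall w, normc (w - z0) < d -> f w = 0) ->
  forall w, D w -> f w = 0.
Proof.
move=> oD cD df Dz0 fz0 w Dw.
pose Z z := exists2 d : R, 0 < d & forall w, normc (w - z) < d -> f w = 0.
have Zopen z : Z z -> exists2 d : R, 0 < d & forall w, normc (w - z) < d -> Z w.
  move=> [d d0 hd]; exists (d / 2); first by rewrite divr_gt0.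
  move=> v vd; exists (d / 2); first by rewrite divr_gt0.
  move=> x xd; apply: hd; rewrite (_ : x - z = (x - v) + (v - z)); last by ring.
  by rewrite (le_lt_trans (normcD _ _))//; lra.
have Zclosed z : D z -> Z z \/ exists2 d : R, 0 < d & forall w, normc (w - z) < d -> ~ Z w.
  move=> Dz; have [d d0 hd] := oD z Dz.
  have [|[k [u [r [r0 hr]]]]] := hol_zero_dichotomy d0 (fun z h => df z (hd z h)).
    by move=> h; left.
  right; exists r => // v vr [d1 d10 hd1].
  have nz x : x != z -> normc (x - z) < r -> f x != 0.
    by move=> xz /hr[_ ux ->]; rewrite mulf_neq0// expf_neq0// subr_eq0.
  have [vz|vz] := eqVneq v z; last first.
    by have := nz v vz vr; rewrite hd1 ?eqxx// subrr normc0.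
  pose e := Num.min d1 r / 2.
  have e0 : 0 < e by rewrite divr_gt0// lt_min d10.
  have en : normc (z + e%:C - z) = e by rewrite addrAC subrr add0r normc_real gtr0_norm.
  have emin : e < Num.min d1 r.
    by rewrite /e ltr_pdivrMr// mulr2n mulrDr mulr1 ltrDl lt_min d10.
  move: emin; rewrite lt_min => /andP[e1 e2].
  have := nz (z + e%:C); rewrite en hd1 ?eqxx; last by rewrite vz en.
  have ze : z + e%:C != z by rewrite -subr_eq0 -normc_gt0 en.
  by move=> /(_ ze e2).
pose p (t : R) := z0 + t%:C * (w - z0).
have pB t s : normc (p t - p s) = `|t - s| * normc (w - z0).
  by rewrite -normc_real -normcM; congr normc; rewrite /p rmorphB; ring.
have K0 : 0 < normc (w - z0) + 1 by have := normc_ge0 (w - z0); lra.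
pose T : set R := [set t | 0 <= t <= 1 /\ forall s, 0 <= s <= t -> Z (p s)].
have T0 : T 0.
  split; first by rewrite lexx ler01.
  move=> s /andP[s_ge0 s_le0]; have -> : s = 0 by apply/eqP; rewrite eq_le s_le0.
  by rewrite /p mul0r addr0.
have hs : has_sup T by split; [exists 0|exists 1 => t [/andP[]]].
pose ts := sup T.
have ts0 : 0 <= ts by apply: sup_upper_bound.
have ts1 : ts <= 1 by apply: sup_le_ub; [exists 0|move=> t [/andP[]]].
have Dts : D (p ts) by apply: cD => //; rewrite ts0.
have close (d : R) : 0 < d -> exists2 t, T t & t <= ts /\ `|t - ts| * normc (w - z0) < d.
  move=> d0; have e0 : 0 < d / (normc (w - z0) + 1) by rewrite divr_gt0.
  have [t Tt ht] := sup_adherent e0 hs; exists t => //.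
  have tts : t <= ts by apply: sup_upper_bound.
  split => //; rewrite distrC ger0_norm ?subr_ge0//.
  have : ts - t < d / (normc (w - z0) + 1) by move: ht; rewrite -/ts; lra.
  by rewrite ltr_pdivlMr//; have := normc_ge0 (w - z0); nra.
have [Zts|[d d0 hd]] := Zclosed _ Dts; last first.
  have [t [ht Tt] [_ tts]] := close d d0.
  have [] := hd (p t); first by rewrite pB.
  by apply: Tt; move: ht => /andP[-> _]; rewrite lexx.
have [d d0 hd] := Zopen _ Zts.
have Zle s : 0 <= s <= ts -> Z (p s).
  move=> /andP[s0 sts]; have [t [ht Tt] [tts h]] := close d d0.
  have [st|ts'] := leP s t; first by apply: Tt; rewrite s0.
  apply: hd; rewrite pB; apply: le_lt_trans h; rewrite ler_wpM2r ?normc_ge0//.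
  by rewrite !(distrC _ ts) !ger0_norm; lra.
have ts1' : ts = 1.
  apply/eqP; rewrite eq_le ts1 /= leNgt; apply/negP => tslt.
  pose t := Num.min 1 (ts + d / (2 * (normc (w - z0) + 1))).
  have dd : 0 < d / (2 * (normc (w - z0) + 1)) by rewrite divr_gt0// mulr_gt0.
  have tt : ts < t by rewrite lt_min tslt ltrDl.
  have : T t.
    split; first by rewrite ge_min lexx andbT (le_trans ts0 (ltW tt)).
    move=> s /andP[s0 st]; have [sts|tss] := leP s ts; first by apply: Zle; rewrite s0.
    apply: hd; rewrite pB ger0_norm ?subr_ge0 ?ltW//.
    have : s - ts <= d / (2 * (normc (w - z0) + 1)).
      by move: st; rewrite le_min => /andP[_]; lra.
    by rewrite ler_pdivlMr ?mulr_gt0//; have := normc_ge0 (w - z0); nra.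
  by move=> /(sup_upper_bound hs); rewrite -/ts leNgt tt.
have [d1 d10 hd1] : Z (p 1) by rewrite -ts1'.
have pw : p 1 = w by rewrite /p mul1r addrC subrK.
by apply: hd1; rewrite pw subrr normc0.
Qed.

End CauchyConsequences.

(** * Meromorphic functions *)

Section Meromorphic.
Context {R : realType}.
Implicit Types (f g : R[i] -> R[i]) (w z c : R[i]).

Lemma holomorphic_atP f z : holomorphic_at f z <->
  exists2 d : R, 0 < d & forall w, normc (w - z) < d -> cderivable f w.
Proof.
rewrite /holomorphic_at nearC.
by split => -[d d0 hd]; exists d => // w /hd /cderivableP.
Qed.

Lemma meromorphic_atP f z : meromorphic_at f z <->
  exists k g (d : R), 0 < d /\ forall w, normc (w - z) < d ->
    cderivable g w /\ (w != z -> (w - z) ^+ k * f w = g w).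
Proof.
split.
  move=> [k [g [/holomorphic_atP[d d0 hd] /dnearC[d' d'0 hd']]]].
  exists k, g, (Num.min d d'); rewrite lt_min d0; split => // w.
  by rewrite lt_min => /andP[h1 h2]; split; [exact: hd|move=> wz; exact: hd'].
move=> [k [g [d [d0 hd]]]]; exists k, g; split.
  by apply/holomorphic_atP; exists d => // w /hd[].
by apply/dnearC; exists d => // w wz /hd[_]; apply.
Qed.

Lemma meromorphic_hol f z (d : R) : 0 < d ->
  (forall w, normc (w - z) < d -> cderivable f w) -> meromorphic_at f z.
Proof.
move=> d0 hd; apply/meromorphic_atP; exists 0%N, f, d; split => // w /hd h.
by split => //; rewrite expr0 mul1r.
Qed.

Lemma meromorphic_entire f z : (forall w, cderivable f w) -> meromorphic_at f z.
Proof. by move=> h; apply: (meromorphic_hol ltr01). Qed.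

Lemma meromorphic_ext f g z (d : R) : 0 < d ->
  (forall w, normc (w - z) < d -> w != z -> f w = g w) ->
  meromorphic_at f z -> meromorphic_at g z.
Proof.
move=> d0 fg /meromorphic_atP[k [h [d' [d'0 hd']]]]; apply/meromorphic_atP.
exists k, h, (Num.min d d'); rewrite lt_min d0; split => // w.
rewrite lt_min => /andP[h1 /hd'[h2 h3]]; split => // wz.
by rewrite -fg// h3.
Qed.

Let cderivable_pow z k w : cderivable (fun w => (w - z) ^+ k) w.
Proof.
apply: cderivableX.
by apply: cderivableB; [exact: cderivable_id|exact: cderivable_cst].
Qed.

Lemma meromorphicD f g z : meromorphic_at f z -> meromorphic_at g z ->
  meromorphic_at (fun w => f w + g w) z.
Proof.
move=> /meromorphic_atP[k [h [d [d0 hd]]]] /meromorphic_atP[k' [h' [d' [d'0 hd']]]].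
apply/meromorphic_atP.
exists (k + k')%N, (fun w => (w - z) ^+ k' * h w + (w - z) ^+ k * h' w), (Num.min d d').
rewrite lt_min d0; split => // w; rewrite lt_min => /andP[/hd[h1 h2] /hd'[h1' h2']].
split; first by apply: cderivableD; apply: cderivableM.
by move=> wz; rewrite -h2// -h2'// exprD; ring.
Qed.

Lemma meromorphicM f g z : meromorphic_at f z -> meromorphic_at g z ->
  meromorphic_at (fun w => f w * g w) z.
Proof.
move=> /meromorphic_atP[k [h [d [d0 hd]]]] /meromorphic_atP[k' [h' [d' [d'0 hd']]]].
apply/meromorphic_atP; exists (k + k')%N, (fun w => h w * h' w), (Num.min d d').
rewrite lt_min d0; split => // w; rewrite lt_min => /andP[/hd[h1 h2] /hd'[h1' h2']].
split; first exact: cderivableM.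
by move=> wz; rewrite -h2// -h2'// exprD; ring.
Qed.

(** The zeros of the regular factor have finite order; where it vanishes
    identically, so does the inverse, as 0^-1 = 0 *)
Lemma meromorphicV f z : meromorphic_at f z -> meromorphic_at (fun w => (f w)^-1) z.
Proof.
move=> /meromorphic_atP[k [h [d [d0 hd]]]].
have [[r r0 hr]|[j [u [r [r0 hr]]]]] := hol_zero_dichotomy d0 (fun w hw => (hd w hw).1).
  apply: (@meromorphic_ext (fun=> 0) _ _ (Num.min d r)).
  - by rewrite lt_min d0.
  - move=> w; rewrite lt_min => /andP[/hd[_ h2] /hr h3] wz.
    have := h2 wz; rewrite h3 => /eqP; rewrite mulf_eq0 expf_eq0 subr_eq0 (negbTE wz).
    by rewrite andbF /= => /eqP ->; rewrite invr0.
  - by apply: meromorphic_entire => w; exact: cderivable_cst.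
apply/meromorphic_atP; exists j, (fun w => (w - z) ^+ k / u w), (Num.min d r).
rewrite lt_min d0; split => // w; rewrite lt_min => /andP[/hd[_ h2] /hr[h3 h4 h5]].
split; first by apply: cderivableM => //; exact: cderivableV.
move=> wz; have wz0 : w - z != 0 by rewrite subr_eq0.
have wk i : (w - z) ^+ i != 0 by rewrite expf_neq0.
have -> : f w = (w - z) ^+ j * u w / (w - z) ^+ k by rewrite -h5 -(h2 wz) mulrC mulKf.
by field; rewrite h4 !wk.
Qed.

Lemma meromorphic_cst c z : meromorphic_at (fun=> c) z.
Proof. by apply: meromorphic_entire => w; exact: cderivable_cst. Qed.

Lemma meromorphicB f g z : meromorphic_at f z -> meromorphic_at g z ->
  meromorphic_at (fun w => f w - g w) z.
Proof.
move=> hf hg; apply: meromorphicD => //.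
under eq_fun do rewrite -mulN1r.
by apply: meromorphicM => //; exact: meromorphic_cst.
Qed.

Lemma meromorphic_sum (I : Type) (r : seq I) (P : pred I) (F : I -> R[i] -> R[i]) z :
  (forall i, P i -> meromorphic_at (F i) z) ->
  meromorphic_at (fun w => \sum_(i <- r | P i) F i w) z.
Proof.
move=> h; elim: r => [|i r IH].
  by under eq_fun do rewrite big_nil; exact: meromorphic_cst.
under eq_fun do rewrite big_cons.
by case: (boolP (P i)) => [/h Pi|_]; [exact: meromorphicD|exact: IH].
Qed.

Lemma meromorphic_prod (I : Type) (r : seq I) (P : pred I) (F : I -> R[i] -> R[i]) z :
  (forall i, P i -> meromorphic_at (F i) z) ->
  meromorphic_at (fun w => \prod_(i <- r | P i) F i w) z.
Proof.
move=> h; elim: r => [|i r IH].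
  by under eq_fun do rewrite big_nil; exact: meromorphic_cst.
under eq_fun do rewrite big_cons.
by case: (boolP (P i)) => [/h Pi|_]; [exact: meromorphicM|exact: IH].
Qed.

End Meromorphic.

(** * The Gamma function *)

Section Domination.
Context {R : realType}.
Notation mu := (@lebesgue_measure R).
Implicit Types (u t x y : R).

Lemma integrableD_real (D : set R) (f g : R -> R) : measurable D ->
  mu.-integrable D (EFin \o f) -> mu.-integrable D (EFin \o g) ->
  mu.-integrable D (EFin \o (fun x => f x + g x)).
Proof.
move=> mD hf hg; rewrite (_ : EFin \o _ = (EFin \o f) \+ (EFin \o g))%E.
  exact: integrableD.
by apply/funext.
Qed.

Lemma integrableZ_real (D : set R) (c : R) (f : R -> R) : measurable D ->
  mu.-integrable D (EFin \o f) -> mu.-integrable D (EFin \o (fun x => c * f x)).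
Proof.
move=> mD hf; rewrite (_ : EFin \o _ = fun x => c%:E * (EFin \o f) x)%E.
  exact: integrableZl.
by apply/funext => x; rewrite /= EFinM.
Qed.

(** A single integrable majorant for all the integrands over the line *)
Definition lorentz u : R := (1 + u ^+ 2)^-1.

Lemma lorentz_gt0 u : 0 < lorentz u.
Proof. by rewrite invr_gt0 ltr_pwDl// sqr_ge0. Qed.

Lemma continuous_lorentz : continuous lorentz.
Proof. exact: (@continuous_oneDsqrV R). Qed.

Lemma integrable_lorentz (D : set R) : measurable D ->
  mu.-integrable D (EFin \o lorentz).
Proof.
move=> mD; apply: (@integrableS _ _ _ mu setT D) => //.
apply/integrableP; split.
  by apply/measurable_EFinP; apply: continuous_measurable_fun; exact: continuous_lorentz.
under eq_integral => x _ do rewrite /= ger0_norm ?ltW ?lorentz_gt0//.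
rewrite ge0_symfun_integralT//=.
- rewrite [X in (_ * X)%E](_ : _ = (pi / 2)%:E)%E; last first.
    rewrite -integral0y_oneDsqr (_ : [set x | _] = `[0, +oo[%classic)//.
    by apply/seteqP; split => x /=; rewrite in_itv/= andbT.
  by rewrite -EFinM ltry.
- by move=> x; rewrite ltW// lorentz_gt0.
- exact: continuous_lorentz.
- by move=> x; rewrite /lorentz /= sqrrN.
Qed.

(** The square of 1 + t / 2 <= expR (t / 2) *)
Lemma expR_quadratic t : 0 <= t -> 1 + t ^+ 2 / 4 <= expR t.
Proof.
move=> t0; have -> : expR t = expR (t / 2) ^+ 2.
  by rewrite expr2 -expRD -splitr.
have := expR_ge1Dx (t / 2); move: (expR _) => E h; nra.
Qed.

Lemma expRN_le_lorentz (d : R) : 0 < d ->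
  exists2 C, 0 < C & forall u, expR (- (d * `|u|)) <= C * lorentz u.
Proof.
move=> d0; pose c := Num.min 1 (d ^+ 2 / 4).
have c0 : 0 < c by rewrite lt_min ltr01 divr_gt0// exprn_gt0.
exists c^-1; first by rewrite invr_gt0.
move=> u; rewrite expRN /lorentz -invfM lef_pV2 ?posrE ?expR_gt0//; last first.
  by rewrite mulr_gt0// ltr_pwDl// sqr_ge0.
have := expR_quadratic (mulr_ge0 (ltW d0) (normr_ge0 u)); apply: le_trans.
rewrite mulrDr mulr1 lerD//; first by rewrite ge_min lexx.
rewrite exprMn real_normK ?num_real// mulrAC ler_wpM2r ?sqr_ge0//.
by rewrite ge_min lexx orbT.
Qed.

Lemma sqr_le_expR (d : R) u : 0 < d -> u ^+ 2 <= 4 / d ^+ 2 * expR (d * `|u|).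
Proof.
move=> d0; have := expR_quadratic (mulr_ge0 (ltW d0) (normr_ge0 u)).
rewrite exprMn real_normK ?num_real// [X in _ -> _ <= X]mulrAC.
rewrite ler_pdivlMr ?exprn_gt0//; lra.
Qed.

Lemma norm_le_expR (d : R) u : 0 < d -> `|u| <= d^-1 * expR (d * `|u|).
Proof.
move=> d0; rewrite mulrC ler_pdivlMr//.
have := expR_ge1Dx (d * `|u|); lra.
Qed.

(** Monotone convergence *)
Lemma integrable_exhaust (E : nat -> set R) (f : R -> R[i]) (B : R) :
  nondecreasing_seq E -> (forall n, measurable (E n)) ->
  mfunC (\bigcup_n E n) f ->
  (forall n, mu.-integrable (E n) (EFin \o (fun x : R => normc (f x)))) ->
  (forall n, (\int[mu]_(x in E n) normc (f x))%R <= B) ->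
  cintegrable (\bigcup_n E n) f.
Proof.
move=> ndE mE mf ig gB; set D := \bigcup_n E n.
have mD : measurable D by exact: bigcup_measurable.
pose g x := normc (f x).
have ige : mu.-integrable D (EFin \o g).
  apply/integrableP; split; first by apply/measurable_EFinP; exact: mfunC_normc.
  under eq_integral => x _ do rewrite /= ger0_norm ?normc_ge0//.
  have H : (\int[mu]_(x in E n) (EFin \o g) x)%E @[n --> \oo] -->
      (\int[mu]_(x in D) (EFin \o g) x)%E.
    apply: ge0_nondecreasing_set_cvg_integral => // [n|n x _].
      exact: measurable_int (ig n).
    by rewrite lee_fin normc_ge0.
  have : (\int[mu]_(x in D) (EFin \o g) x <= B%:E)%E.
    rewrite -(cvg_lim _ H)//; apply: lime_le; first by apply/cvg_ex; eexists; exact: H.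
    apply: nearW => n; have := gB n; rewrite -lee_fin /Rintegral fineK//.
    apply: integrable_fin_num.
      exact: mE.
    exact: ig.
  by move=> /le_lt_trans; apply; rewrite ltry.
exact: (cintegrable_le mD mf ige).
Qed.

Lemma cvg_cintegral_exhaustT (f : R -> R[i]) (a b : nat -> R) :
  cintegrable setT f -> (forall x : R, \forall n \near \oo, a n <= x <= b n) ->
  ((fun n => cintegral `[a n, b n] f) : nat -> R[i]^o) @ \oo --> (cintegral setT f : R[i]^o).
Proof.
move=> hf hab; apply: cvg_cintegral_exhaust => // x _.
by apply: filterS (hab x) => n; rewrite /= in_itv.
Qed.

Lemma near_natl (x : R) : \forall n \near \oo, x <= n%:R.
Proof.
exists (Num.truncn x).+1 => // n /= xn; apply: ltW.
by rewrite (lt_le_trans (truncnS_gt x))// ler_nat.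
Qed.

Lemma near_natNn (x : R) : \forall n \near \oo, - n%:R <= x <= n%:R.
Proof.
apply: filterS2 (near_natl x) (near_natl (- x)) => n h1 h2.
by rewrite h1 lerNl h2.
Qed.

(** Laplace transforms are holomorphic: the error of the first order expansion
    of cexp in s is quadratic, and the powers of u are absorbed by slightly
    changing the exponent *)
Lemma cderivable_laplace (k : R -> R) (a b : R) (s : R[i]) :
  measurable_fun setT k -> (forall u, 0 <= k u) ->
  mu.-integrable setT (EFin \o (fun u => expR (a * u) * k u)) ->
  mu.-integrable setT (EFin \o (fun u => expR (b * u) * k u)) ->
  a < Re s < b ->
  cderivable (fun s => cintegral setT (fun u => cexp (s * u%:C) * (k u)%:C)) s.
Proof.
move=> mk k0 ia ib /andP[as_ sb].
pose d := Num.min (Re s - a) (b - Re s) / 2.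
have d0 : 0 < d by rewrite divr_gt0// lt_min !subr_gt0 as_.
have [d1 d2] : a <= Re s - 2 * d /\ Re s + 2 * d <= b.
  have h : 2 * d = Num.min (Re s - a) (b - Re s) by rewrite /d mulrC divfK.
  have h1 : Num.min (Re s - a) (b - Re s) <= Re s - a by rewrite ge_min lexx.
  have h2 : Num.min (Re s - a) (b - Re s) <= b - Re s by rewrite ge_min lexx orbT.
  by split; lra.
pose G u := expR (a * u) * k u + expR (b * u) * k u.
have iG : mu.-integrable setT (EFin \o G).
  exact: integrableD_real.
have G0 u : 0 <= G u by rewrite addr_ge0// mulr_ge0// expR_ge0.
have iGZ (c : R) : mu.-integrable setT (EFin \o (fun u => c * G u)).
  exact: integrableZ_real.
have expG u : expR (Re s * u) * expR (2 * d * `|u|) * k u <= G u.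
  rewrite -expRD /G -mulrDl ler_wpM2r//.
  have [u0|u0] := leP 0 u.
    rewrite ger0_norm//; apply: (@le_trans _ _ (expR (b * u))).
      by rewrite ler_expR; nra.
    by rewrite lerDr expR_ge0.
  rewrite ltr0_norm//; apply: (@le_trans _ _ (expR (a * u))).
    by rewrite ler_expR; nra.
  by rewrite lerDl expR_ge0.
have mcont w : mfunC setT (fun u => cexp (w * u%:C)).
  apply: mfunC_cont => // u.
  rewrite (_ : (fun u => _) = (fun u : R => cexp (u%:C * w))).
    exact: rdrv_ccont (rdrv_cexp_line w u).
  by apply/funext => x; rewrite mulrC.
have mkC : mfunC setT (fun u => (k u)%:C) by split => //=; exact: measurable_cst.
have mid : mfunC setT (fun u : R => u%:C) by split => //=; exact: measurable_cst.
have mF w : mfunC setT (fun u => cexp (w * u%:C) * (k u)%:C) by exact: mfunCM.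
have i0 w : normc (w - s) <= d -> cintegrable setT (fun u => cexp (w * u%:C) * (k u)%:C).
  move=> wd; apply: (cintegrable_le _ (mF w) iG) => // u _.
  rewrite normcM normc_cexp ReMC normc_real ger0_norm//.
  apply: le_trans (expG u); rewrite ler_wpM2r// -expRD ler_expR.
  have h := le_trans (Re_le_normc _) wd; rewrite ReB in h.
  have h2 : (Re w - Re s) * u <= d * `|u|.
    by rewrite (le_trans (ler_norm _))// normrM ler_wpM2r.
  have := normr_ge0 u; nra.
have dV : 0 <= d^-1 by rewrite invr_ge0 ltW.
have i1 : cintegrable setT (fun u => u%:C * (cexp (s * u%:C) * (k u)%:C)).
  apply: (cintegrable_le _ (mfunCM mid (mF s)) (iGZ d^-1)) => // u _.
  rewrite !normcM normc_cexp ReMC !normc_real (ger0_norm (k0 u)).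
  have := norm_le_expR u d0; have := expG u.
  rewrite mulrA; set E := expR (Re s * u).
  move=> h1 h2; apply: (@le_trans _ _ (d^-1 * (E * expR (2 * d * `|u|) * k u))); last first.
    exact: ler_wpM2l.
  rewrite mulrA ler_wpM2r// mulrCA mulrC ler_wpM2l ?expR_ge0//.
  apply: (le_trans h2); rewrite ler_wpM2l// ler_expR.
  have := normr_ge0 u; nra.
exists (cintegral setT (fun u => u%:C * (cexp (s * u%:C) * (k u)%:C))) => e e0.
pose C := \int[mu]_x (4 * (4 / d ^+ 2) * G x).
have C0 : 0 <= C.
  by apply: Rintegral_ge0 => x _; rewrite !mulr_ge0// ?invr_ge0 ?exprn_ge0 ?ltW.
exists (Num.min d (e / (C + 1))).
  by rewrite lt_min d0 divr_gt0//; lra.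
move=> w; rewrite lt_min => /andP[/ltW wd we].
set h := w - s.
have iw := i0 w wd.
have is_ : cintegrable setT (fun u => cexp (s * u%:C) * (k u)%:C).
  by apply: i0; rewrite subrr normc0 ltW.
have i1h := cintegrableZ h measurableT i1.
have i2 : cintegrable setT (fun u => cexp (w * u%:C) * (k u)%:C - cexp (s * u%:C) * (k u)%:C).
  by apply: cintegrableD => //; exact: cintegrableN.
rewrite -cintegralB// [_ * h]mulrC -cintegralZ// -cintegralB//.
set F := (fun u => _ - h * _).
have iF : cintegrable setT F by apply: cintegrableD => //; exact: cintegrableN.
have := normc_cintegral_le measurableT (cintegrable_mfun iF)
   (iGZ (normc h ^+ 2 * (4 * (4 / d ^+ 2)))).
move=> /(_ _)/le_trans; apply.
  move=> u _; have -> : F u = cexp (s * u%:C) * (cexp (h * u%:C) - 1 - h * u%:C) * (k u)%:C.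
    rewrite /F (_ : w = s + h); last by rewrite /h addrC subrK.
    by rewrite mulrDl cexpD; ring.
  rewrite !normcM normc_cexp ReMC normc_real ger0_norm//.
  apply: (@le_trans _ _ (expR (Re s * u) * (4 * normc h ^+ 2 * u ^+ 2 * expR (d * `|u|)) * k u)).
    rewrite ler_wpM2r// ler_wpM2l ?expR_ge0//.
    rewrite (le_trans (normc_cexpB1B _))// normcM normc_real exprMn real_normK ?num_real//.
    rewrite [4 * (normc h ^+ 2 * u ^+ 2)]mulrA ler_wpM2l ?ler_expR ?ler_wpM2r//.
    by rewrite -mulrA mulr_ge0// mulr_ge0// sqr_ge0.
  apply: (@le_trans _ _ (expR (Re s * u) *
     (4 * normc h ^+ 2 * (4 / d ^+ 2 * expR (d * `|u|)) * expR (d * `|u|)) * k u)).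
    rewrite ler_wpM2r// ler_wpM2l ?expR_ge0// ler_wpM2r ?expR_ge0//.
    rewrite ler_wpM2l ?sqr_le_expR//.
    by rewrite mulr_ge0// sqr_ge0.
  have e2 : expR (2 * d * `|u|) = expR (d * `|u|) * expR (d * `|u|).
    by rewrite -expRD; congr expR; ring.
  have := expG u; rewrite e2 => /(ler_wpM2l _) H.
  have := H (normc h ^+ 2 * (4 * (4 / d ^+ 2))); move=> {}H.
  apply: le_trans (H _); last first.
    by rewrite mulr_ge0 ?sqr_ge0// mulr_ge0// divr_ge0// sqr_ge0.
  by rewrite le_eqVlt; apply/orP; left; apply/eqP; ring.
have -> : (\int[mu]_x (normc h ^+ 2 * (4 * (4 / d ^+ 2)) * G x))%R = normc h ^+ 2 * C.
  rewrite /C -RintegralZl//; first by apply: eq_Rintegral => x _; rewrite !mulrA.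
rewrite expr2 -mulrA mulrC ler_wpM2r ?normc_ge0//.
move: we; rewrite ltr_pdivlMr; last by lra.
by have := normc_ge0 h; nra.
Qed.

End Domination.

Section GammaFunction.
Context {R : realType}.
Notation mu := (@lebesgue_measure R).
Implicit Types (u t x y : R) (s w z : R[i]).

(** In the variable u = ln t, Euler's integral is a bilateral Laplace transform,
    holomorphic by cderivable_laplace *)
Definition gamma_kernel u : R := expR (- expR u).
Definition gamma_log s u : R[i] := cexp (s * u%:C) * (gamma_kernel u)%:C.

Lemma gamma_kernel_ge0 u : 0 <= gamma_kernel u. Proof. exact: expR_ge0. Qed.

Lemma continuous_expR_comp (f : R -> R) x : {for x, continuous f} ->
  {for x, continuous (fun y => expR (f y))}.
Proof. by move=> h; apply: continuous_comp h _; exact: continuous_expR. Qed.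

Lemma continuous_gamma_kernel : continuous gamma_kernel.
Proof.
move=> x; apply: (@continuous_expR_comp (fun u => - expR u)); apply: continuousN.
exact: continuous_expR.
Qed.

Lemma ccont_cexp_mul w u : ccont (fun u : R => cexp (w * u%:C)) u.
Proof.
rewrite (_ : (fun u => _) = (fun u : R => cexp (u%:C * w))).
  exact: rdrv_ccont (rdrv_cexp_line w u).
by apply/funext => x; rewrite mulrC.
Qed.

Lemma rdrv_cexp_mul w u : rdrv (fun u : R => cexp (w * u%:C)) u (w * cexp (w * u%:C)).
Proof.
rewrite (_ : (fun u => _) = (fun u : R => cexp (u%:C * w))).
  by rewrite [X in cexp X]mulrC; exact: rdrv_cexp_line.
by apply/funext => x; rewrite mulrC.
Qed.

Lemma ccont_gamma_log s u : ccont (gamma_log s) u.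
Proof.
apply: ccontM; first exact: ccont_cexp_mul.
by apply: ccont_real; exact: continuous_gamma_kernel.
Qed.

Lemma normc_gamma_log s u : normc (gamma_log s u) = expR (Re s * u) * gamma_kernel u.
Proof. by rewrite normcM normc_cexp ReMC normc_real ger0_norm// gamma_kernel_ge0. Qed.

(** For u < 0 the factor expR (a u) decays by itself; for u >= 0 the double
    exponential outweighs it *)
Lemma gamma_kernel_bound (a : R) : 0 < a ->
  exists2 C, 0 < C & forall u, expR (a * u) * gamma_kernel u <= C * lorentz u.
Proof.
move=> a0; pose d := Num.min a 1.
have d0 : 0 < d by rewrite lt_min a0 ltr01.
have da : d <= a by rewrite ge_min lexx.
have d1 : d <= 1 by rewrite ge_min lexx orbT.
have [C C0 hC] := expRN_le_lorentz d0.
exists (expR ((a + 1) ^+ 2) * C); first by rewrite mulr_gt0// expR_gt0.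
move=> u; rewrite -mulrA; apply: le_trans (ler_wpM2l (expR_ge0 _) (hC u)).
rewrite /gamma_kernel -!expRD ler_expR.
have [u0|u0] := leP 0 u.
  rewrite ger0_norm//; have := expR_quadratic u0.
  move: (expR u) => E h.
  have : (u / 2 - (a + 1)) ^+ 2 >= 0 by exact: sqr_ge0.
  nra.
rewrite ltr0_norm//; have := expR_ge0 u; have := sqr_ge0 (a + 1); nra.
Qed.

Lemma integrable_gamma_kernel (a : R) : 0 < a ->
  mu.-integrable setT (EFin \o (fun u => expR (a * u) * gamma_kernel u)).
Proof.
move=> a0; have [C C0 hC] := gamma_kernel_bound a0.
have : cintegrable setT (gamma_log a%:C).
  apply: (@cintegrable_le _ _ _ (fun u => C * lorentz u)) => //.
  - by apply: mfunC_cont => // x; exact: ccont_gamma_log.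
  - apply: integrableZ_real => //; exact: integrable_lorentz.
  - by move=> u _; rewrite normc_gamma_log.
move=> /cintegrable_normc; rewrite (_ : (fun x => _) = (fun u => expR (a * u) * gamma_kernel u)).
  exact.
by apply/funext => u; rewrite normc_gamma_log.
Qed.

Lemma cintegrable_gamma_log s : 0 < Re s -> cintegrable setT (gamma_log s).
Proof.
move=> s0; apply: (cintegrable_le _ _ (integrable_gamma_kernel s0)) => //.
  by apply: mfunC_cont => // x; exact: ccont_gamma_log.
by move=> u _; rewrite normc_gamma_log.
Qed.

Lemma mfunC_cexp (D : set R) (f : R -> R[i]) : mfunC D f -> mfunC D (fun x => cexp (f x)).
Proof.
move=> [f1 f2]; split => /=; apply: measurable_funM.
- by apply: (@measurableT_comp _ _ _ _ _ _ expR) => //; exact: measurable_expR.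
- apply: (@measurableT_comp _ _ _ _ _ _ (@cos R)) => //.
  by apply: continuous_measurable_fun; exact: continuous_cos.
- by apply: (@measurableT_comp _ _ _ _ _ _ expR) => //; exact: measurable_expR.
- apply: (@measurableT_comp _ _ _ _ _ _ (@sin R)) => //.
  by apply: continuous_measurable_fun; exact: continuous_sin.
Qed.

Let gf s t : R[i] := cpow t (s - 1) * (expR (- t))%:C.

Lemma rdrv_cpow s t : 0 < t -> rdrv (fun t => cpow t s) t (s * (t^-1)%:C * cpow t s).
Proof.
move=> t0; apply: rdrv_cexp.
exact: rdrvZ (rdrv_real (is_derive1_ln t0)).
Qed.

Let ccont_gf s t : 0 < t -> ccont (gf s) t.
Proof.
move=> t0; apply: ccontM; first exact: rdrv_ccont (rdrv_cpow _ t0).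
by apply: ccont_real; apply: (@continuous_expR_comp -%R); exact: opp_continuous.
Qed.

Let mfunC_gf s (D : set R) : measurable D -> mfunC D (gf s).
Proof.
move=> mD; have h : mfunC setT (gf s).
  apply: mfunCM.
    apply: mfunC_cexp; apply: mfunCM; first exact: mfunC_cst.
    split => /=; [exact: measurable_ln|exact: measurable_cst].
  apply: mfunC_cont => // x; apply: ccont_real; apply: (@continuous_expR_comp -%R).
  exact: opp_continuous.
by split; apply: measurable_funTS; [case: h|case: h].
Qed.

Let gf_subst s (n : nat) : cintegral `[expR (- n%:R), expR n%:R] (gf s) =
  cintegral `[- n%:R, n%:R] (gamma_log s).
Proof.
have nn : (- n%:R : R) <= n%:R by rewrite (@le_trans _ _ 0)// oppr_le0.
have eN : expR (- n%:R) <= expR n%:R :> R by rewrite ler_expR.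
rewrite (@cintegral_subst _ _ expR expR 0 _ _ nn (fun x => @ccont_gf s x)
  (fun x _ => expR_gt0 x) (fun x _ => is_derive_expR x)
  (fun x _ => @continuous_expR R x) eN).
apply: eq_cintegral => u _; rewrite /gf /gamma_log /gamma_kernel.
rewrite /cpow expRK mulrAC -cexp_real; congr (_ * _).
by rewrite -cexpD mulrBl mul1r subrK.
Qed.

Let E (n : nat) : set R := `[expR (- n%:R), expR n%:R]%classic.

Let bigcup_E : \bigcup_n E n = `]0, +oo[%classic.
Proof.
apply/seteqP; split => x.
  by move=> [n _]; rewrite /E /= !in_itv /= andbT => /andP[h _]; apply: lt_le_trans h; exact: expR_gt0.
rewrite /= in_itv /= andbT => x0.
have [N _ /(_ N (leqnn N)) /andP[h1 h2]] := near_natNn (ln x).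
by exists N => //; rewrite /E /= in_itv /= -(@lnK _ x)// !ler_expR h1.
Qed.

Let ndE : nondecreasing_seq E.
Proof.
apply/nondecreasing_seqP => n; rewrite subsetEset => x; rewrite /E /= !in_itv /=.
move=> /andP[h1 h2]; apply/andP; split.
  by apply: le_trans h1; rewrite ler_expR lerN2 ler_nat.
by apply: (le_trans h2); rewrite ler_expR ler_nat.
Qed.

Let integrable_gf s : 0 < Re s -> cintegrable `]0, +oo[ (gf s).
Proof.
move=> s0; rewrite -bigcup_E.
have iE w n : cintegrable (E n) (gf w).
  by apply: ccont_cintegrable => x /andP[h _]; apply: ccont_gf; apply: lt_le_trans h; exact: expR_gt0.
apply: (@integrable_exhaust _ _ _ (\int[mu]_u (expR (Re s * u) * gamma_kernel u))) => //.
- by move=> n; exact: measurable_itv.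
- by apply: mfunC_gf; rewrite bigcup_E; exact: measurable_itv.
- by move=> n; apply: cintegrable_normc => //; exact: measurable_itv.
move=> n; rewrite -lecR -cintegral_real.
rewrite (_ : cintegral _ _ = cintegral (E n) (gf (Re s)%:C)); last first.
  apply: eq_cintegral => t; rewrite /E /= in_itv /= => /andP[h _].
  have t0 : 0 < t by apply: lt_le_trans h; exact: expR_gt0.
  rewrite /gf normcM normc_cpow normc_real ger0_norm ?expR_ge0// rmorphM; congr (_ * _).
  have -> : (Re s)%:C - 1 = (Re (s - 1))%:C by rewrite ReB Re1 rmorphB.
  by rewrite /cpow -rmorphM cexp_real.
rewrite gf_subst (_ : cintegral _ _ = cintegral `[- n%:R, n%:R]
   (fun u => (expR (Re s * u) * gamma_kernel u)%:C)); last first.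
  by apply: eq_cintegral => u _; rewrite /gamma_log -rmorphM cexp_real rmorphM.
rewrite cintegral_real lecR /Rintegral fine_le//.
- apply: integrable_fin_num; first exact: measurable_itv.
  by apply: integrableS (integrable_gamma_kernel s0).
- by apply: integrable_fin_num; [exact: measurableT|exact: integrable_gamma_kernel].
- apply: ge0_subset_integral => //.
    have := integrable_gamma_kernel s0; exact: measurable_int.
  by move=> u _; rewrite lee_fin mulr_ge0 ?expR_ge0// gamma_kernel_ge0.
Qed.

Lemma gamma_integralE s : 0 < Re s -> gamma_integral s = cintegral setT (gamma_log s).
Proof.
move=> s0.
have C1 : ((fun n => cintegral (E n) (gf s)) : nat -> R[i]^o) @ \oo --> (gamma_integral s : R[i]^o).
  apply: cvg_cintegral_exhaust => //.
  - by move=> n; exact: measurable_itv.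
  - move=> n x hx; suff : (\bigcup_n E n) x by rewrite bigcup_E.
    by exists n.
  - exact: integrable_gf.
  - move=> x; rewrite -bigcup_E => -[N _ hN]; exists N => // n /= Nn.
    by have := ndE Nn; rewrite subsetEset; apply.
have C2 : ((fun n => cintegral (E n) (gf s)) : nat -> R[i]^o) @ \oo -->
    (cintegral setT (gamma_log s) : R[i]^o).
  rewrite (_ : (fun n => _) = (fun n : nat => cintegral `[- n%:R, n%:R] (gamma_log s))).
    apply: cvg_cintegral_exhaustT; first exact: cintegrable_gamma_log.
    by move=> x; exact: near_natNn.
  by apply/funext => n; exact: gf_subst.
exact: (cvg_unique (@norm_hausdorff _ R[i]^o) C1 C2).
Qed.

Lemma cderivable_gamma_integral s : 0 < Re s -> cderivable (@gamma_integral R) s.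
Proof.
move=> s0; apply: (@cderivable_ext _ (fun s => cintegral setT (gamma_log s)) _ _ (Re s)).
- exact: s0.
- move=> w h; rewrite gamma_integralE//.
  by have := le_lt_trans (Re_le_normc _) h; rewrite ReB ltr_norml => /andP[]; lra.
apply: (@cderivable_laplace _ gamma_kernel (Re s / 2) (Re s + 1)).
- by apply: continuous_measurable_fun; exact: continuous_gamma_kernel.
- exact: gamma_kernel_ge0.
- by apply: integrable_gamma_kernel; rewrite divr_gt0.
- by apply: integrable_gamma_kernel; rewrite addr_gt0.
- by apply/andP; split; lra.
Qed.

Let cvg_gamma_log0 s (e : nat -> R) : 0 < Re s -> (forall n, `|e n| = n%:R) ->
  ((fun n => gamma_log s (e n)) : nat -> R[i]^o) @ \oo --> (0 : R[i]^o).
Proof.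
move=> s0 he; have [C C0 hC] := gamma_kernel_bound s0.
apply/cvgCP => d d0; apply: filterS (near_natl (C / d)) => n hn.
rewrite subr0 normc_gamma_log (le_lt_trans (hC _))//.
rewrite /lorentz -real_normK ?num_real// he ltr_pdivrMr; last first.
  by rewrite ltr_pwDl// sqr_ge0.
move: hn; rewrite ler_pdivrMr// => hn.
have : 0 <= (n%:R - 1 / 2) ^+ 2 :> R by exact: sqr_ge0.
move: (n%:R : R) hn => N; nra.
Qed.

(** Integration by parts *)
Lemma gamma_integralS s : 0 < Re s -> gamma_integral (s + 1) = s * gamma_integral s.
Proof.
move=> s0; have s10 : 0 < Re (s + 1) by rewrite ReD Re1 addr_gt0.
rewrite !gamma_integralE//.
pose D u := s * gamma_log s u - gamma_log (s + 1) u.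
have drv u : rdrv (gamma_log s) u (D u).
  have hk : is_derive u 1 gamma_kernel (gamma_kernel u * - expR u).
    have h1 : is_derive u 1 (fun u : R => - expR u) (- expR u).
      exact: (is_deriveN (is_derive_expR u)).
    exact: (@is_derive1_comp R expR (fun u => - expR u) u _ _ (is_derive_expR _) h1).
  have := rdrvM (rdrv_cexp_mul s u) (rdrv_real hk); apply: rdrv_eq.
  rewrite /D /gamma_log mulrDl mul1r cexpD cexp_real rmorphM rmorphN; ring.
have iD : cintegrable setT D.
  apply: cintegrableD => //; first by apply: cintegrableZ => //; exact: cintegrable_gamma_log.
  by apply: cintegrableN => //; exact: cintegrable_gamma_log.
have C1 := @cvg_cintegral_exhaustT _ D (fun n => - n%:R) (fun n => n%:R) iD (@near_natNn R).
have C2 : ((fun n : nat => cintegral `[- n%:R, n%:R] D) : nat -> R[i]^o) @ \oo --> (0 - 0 : R[i]^o).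
  rewrite (_ : (fun n => _) = (fun n : nat => gamma_log s n%:R - gamma_log s (- n%:R))).
    have h1 := @cvg_gamma_log0 s (fun n => n%:R) s0 (fun n => ger0_norm (ler0n _ n)).
    have h2 := @cvg_gamma_log0 s (fun n => - n%:R) s0
      (fun n => etrans (normrN _) (ger0_norm (ler0n _ n))).
    exact: (cvgB h1 h2).
  apply/funext => n; apply: cintegral_FTC2 => //.
    by rewrite (@le_trans _ _ 0)// oppr_le0.
  move=> x _; apply: ccontD.
    by apply: ccontM; [exact: ccont_cst|exact: ccont_gamma_log].
  by apply: ccontN; exact: ccont_gamma_log.
have := cvg_unique (@norm_hausdorff _ R[i]^o) C1 C2; rewrite subrr.
rewrite /D cintegralB//; [|by apply: cintegrableZ => //; exact: cintegrable_gamma_log|exact: cintegrable_gamma_log].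
rewrite cintegralZ//; last exact: cintegrable_gamma_log.
by move=> H; apply/esym/eqP; rewrite -subr_eq0; apply/eqP; exact: H.
Qed.

Lemma GammaE s n : 0 < Re s + n%:R ->
  Gamma s = gamma_integral (s + n%:R) / \prod_(k < n) (s + k%:R).
Proof.
have Ren (w : R[i]) k : Re (w + k%:R) = Re w + k%:R by rewrite ReD natC ReC.
have step k : 0 < Re s + k%:R -> gamma_integral (s + k.+1%:R) / \prod_(j < k.+1) (s + j%:R) =
    gamma_integral (s + k%:R) / \prod_(j < k) (s + j%:R).
  move=> sk; rewrite big_ord_recr /= -natr1 addrA gamma_integralS ?Ren// invfM.
  have sk0 : s + k%:R != 0.
    apply/eqP => h; have : Re (s + k%:R) = 0 by rewrite h.
    by rewrite Ren => h2; move: sk; rewrite h2 ltxx.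
  by rewrite [X in _ * X]mulrC mulrACA divff// mul1r.
have stepn k j : 0 < Re s + k%:R ->
    gamma_integral (s + (j + k)%:R) / \prod_(i < j + k) (s + i%:R) =
    gamma_integral (s + k%:R) / \prod_(i < k) (s + i%:R).
  move=> sk; elim: j => [//|j IH]; rewrite addSn step ?IH//.
  by rewrite natrD addrCA ltr_wpDl.
move=> sn; rewrite /Gamma; set n0 := (_.+1)%N.
have sn0 : 0 < Re s + n0%:R.
  have h : `|Re s| < n0%:R := truncnS_gt _.
  by have := ler_norm (- Re s); rewrite normrN; lra.
by rewrite -(stepn n0 n sn0) -(stepn n n0 sn) addnC.
Qed.

Lemma Gamma_gamma_integral s : 0 < Re s -> Gamma s = gamma_integral s.
Proof. by move=> s0; rewrite (@GammaE s 0) ?addr0// big_ord0 divr1. Qed.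

(** Near s the number of factors in the definition of Gamma can be frozen, since
    GammaE holds with any sufficiently large one *)
Lemma meromorphic_Gamma s : meromorphic_at (@Gamma R) s.
Proof.
pose n := (Num.truncn `|Re s|).+2.
have sn w : normc (w - s) < 1 -> 0 < Re w + n%:R.
  move=> h; have h1 : `|Re s| < (Num.truncn `|Re s|).+1%:R := truncnS_gt _.
  have h2 := le_lt_trans (Re_le_normc _) h; rewrite ReB ltr_norml in h2.
  move: h2 => /andP[h2 _]; rewrite /n -natr1.
  by have := ler_norm (- Re s); rewrite normrN; lra.
apply: (@meromorphic_ext _ (fun w => gamma_integral (w + n%:R) / \prod_(k < n) (w + k%:R)) _ _ 1) => //.
  by move=> w /sn h _; rewrite (GammaE h).
apply: meromorphicM.
  apply: (meromorphic_hol ltr01) => w /sn h.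
  apply: (@cderivable_comp _ (fun w => w + n%:R)).
    by apply: cderivableD; [exact: cderivable_id|exact: cderivable_cst].
  by apply: cderivable_gamma_integral; rewrite ReD natC ReC.
apply: meromorphicV; apply: meromorphic_prod => k _; apply: meromorphic_entire => w.
by apply: cderivableD; [exact: cderivable_id|exact: cderivable_cst].
Qed.

End GammaFunction.

(** * The analytic continuation of the zeta function *)

Section ComplexSequences.
Context {R : realType}.
Implicit Types (u v : nat -> R[i]) (l m : R[i]).

Definition ccvg u l := (u : nat -> R[i]^o) @ \oo --> (l : R[i]^o).

Lemma ccvgP u l : ccvg u l <->
  forall e : R, 0 < e -> exists N, forall n, (N <= n)%N -> normc (u n - l) < e.
Proof.
rewrite /ccvg cvgCP; split => h e e0.
  by have [N _ hN] := h e e0; exists N.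
by have [N hN] := h e e0; exists N.
Qed.

Lemma ccvg_uniq u l m : ccvg u l -> ccvg u m -> l = m.
Proof. exact: (cvg_unique (@norm_hausdorff _ R[i]^o)). Qed.

Lemma ccvg_cst l : ccvg (fun=> l) l.
Proof. exact: cvg_cst. Qed.

Lemma ccvg_ext u v l : ccvg u l -> (forall n, u n = v n) -> ccvg v l.
Proof. by move=> h /funext <-. Qed.

Lemma ccvgD u v l m : ccvg u l -> ccvg v m -> ccvg (fun n => u n + v n) (l + m).
Proof. by move=> h1 h2; exact: (cvgD h1 h2). Qed.

Lemma ccvgB u v l m : ccvg u l -> ccvg v m -> ccvg (fun n => u n - v n) (l - m).
Proof. by move=> h1 h2; exact: (cvgB h1 h2). Qed.

Lemma ccvgZ u l c : ccvg u l -> ccvg (fun n => c * u n) (c * l).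
Proof. by move=> h1; exact: (@cvgMr R[i] _ _ _ _ _ _ h1). Qed.

Lemma ccvg_sum (I : Type) (r : seq I) (F : I -> nat -> R[i]) (L : I -> R[i]) :
  (forall i, ccvg (F i) (L i)) ->
  ccvg (fun n => \sum_(i <- r) F i n) (\sum_(i <- r) L i).
Proof.
move=> h; elim: r => [|i r IH].
  rewrite big_nil; apply: (@ccvg_ext (fun=> 0)); first exact: ccvg_cst.
  by move=> n; rewrite big_nil.
rewrite big_cons; apply: (@ccvg_ext (fun n => F i n + \sum_(i <- r) F i n)).
  exact: (ccvgD (h i) IH).
by move=> n; rewrite big_cons.
Qed.

Lemma ccvg_normc_le u l (M : R) : ccvg u l -> (forall n, normc (u n) <= M) -> normc l <= M.
Proof.
move=> /ccvgP h uM; apply/ler_addgt0Pr => e e0.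
have [N /(_ N (leqnn N)) h1] := h e e0.
have := normc_triB l (u N); rewrite normc_distC; have := uM N; lra.
Qed.

Lemma ccvg_abs_series (a : nat -> R[i]) (b : nat -> R) (B : R) :
  (forall n, normc (a n) <= b n) -> (forall n, \sum_(k < n) b k <= B) ->
  exists l, ccvg (fun n => \sum_(k < n) a k) l.
Proof.
move=> ab bB.
have b0 n : 0 <= b n by exact: le_trans (normc_ge0 _) (ab n).
have cb : cvgn (series b).
  apply: nondecreasing_is_cvgn.
    by apply/nondecreasing_seqP => n; rewrite /series /= big_nat_recr//= lerDl.
  by exists B => _ [n _ <-]; rewrite /series /= big_mkord.
have aux (p : R[i] -> R) : (forall z, `|p z| <= normc z) ->
    cvgn (series (fun n => p (a n))).
  move=> pn; apply: normed_cvg.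
  apply: (series_le_cvg _ b0 _ cb) => n /=; first exact: normr_ge0.
  exact: le_trans (pn _) (ab n).
have /cvg_ex[l1 h1] := aux _ (@Re_le_normc R).
have /cvg_ex[l2 h2] := aux _ (@Im_le_normc R).
exists (l1 +i* l2); apply/cvgC_ReIm; split => /=.
  by under eq_fun do rewrite Re_sum -(big_mkord xpredT (fun k => Re (a k))).
by under eq_fun do rewrite Im_sum -(big_mkord xpredT (fun k => Im (a k))).
Qed.

(** Convergence of the Riemann series, by comparison with the telescoping series
    of k ^ (1 - a) *)
Lemma riemann_bounded (a : R) : 1 < a ->
  exists B, forall n, \sum_(k < n) expR (- (a * ln k.+1%:R)) <= B.
Proof.
move=> a1; pose f (x : R) := expR ((1 - a) * ln x).
have drv (x : R) : 0 < x -> is_derive x 1 f ((1 - a) * expR (- (a * ln x))).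
  move=> x0; have h1 : is_derive x 1 (fun x => (1 - a) * ln x) ((1 - a) * x^-1).
    exact: (is_deriveZ (1 - a) (is_derive1_ln x0)).
  have := @is_derive1_comp R expR (fun x => (1 - a) * ln x) x _ _ (is_derive_expR _) h1.
  move/is_derive_eq; apply.
  rewrite mulrDl mul1r expRD lnK// mulNr.
  by field; rewrite gt_eqF.
have step k : (a - 1) * expR (- (a * ln k.+2%:R)) <= f k.+1%:R - f k.+2%:R.
  have k12 : k.+1%:R <= k.+2%:R :> R by rewrite ler_nat.
  have pos (x : R) : k.+1%:R <= x -> 0 < x by apply: lt_le_trans; rewrite ltr0n.
  have [| |c cab EQ] := @MVT_segment R (fun x => - f x)
    (fun x => - ((1 - a) * expR (- (a * ln x)))) k.+1%:R k.+2%:R k12.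
  - by move=> x; rewrite in_itv /= => /andP[/ltW /pos /drv h _]; exact: (is_deriveN h).
  - apply: continuous_itv_within => x /andP[/pos /drv [h _] _].
    by apply: differentiable_continuous; apply/derivable1_diffP; exact: derivableN.
  have -> : f k.+1%:R - f k.+2%:R = - f k.+2%:R - - f k.+1%:R by ring.
  have k1 : k.+2%:R - k.+1%:R = 1 :> R by rewrite -natrB// subSnn.
  rewrite EQ k1 mulr1.
  rewrite [X in _ <= X](_ : _ = (a - 1) * expR (- (a * ln c))); last by ring.
  apply: ler_wpM2l; first by rewrite subr_ge0 ltW.
  move: cab; rewrite in_itv /= => /andP[/pos c0 h2].
  rewrite ler_expR lerN2 ler_wpM2l ?ler_ln ?posrE ?ltr0n//.
  by rewrite ltW// (lt_trans ltr01).
have tel n : (a - 1) * \sum_(k < n.+1) expR (- (a * ln k.+1%:R)) <= a - f n.+1%:R.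
  elim: n => [|n IH].
    by rewrite big_ord_recl big_ord0 addr0 /f ln1 !mulr0 oppr0 expR0; lra.
  by rewrite big_ord_recr mulrDr; have := step n; lra.
exists (a / (a - 1)) => -[|n].
  by rewrite big_ord0 divr_ge0 ?subr_ge0 ?ltW// (lt_trans ltr01).
rewrite ler_pdivlMr ?subr_gt0// mulrC (le_trans (tel n))// gerBl.
exact: expR_ge0.
Qed.

End ComplexSequences.

(** Taylor expansion of (1 + x) ^ al *)
Section BinomialSeries.
Context {R : realType}.
Implicit Types (al : R[i]) (x : R).

Definition cbin al j : R[i] := \prod_(i < j) (al - i%:R) / j`!%:R.

Definition binrem K x al : R[i] :=
  cpow (1 + x) al - \sum_(j < K) cbin al j * x%:C ^+ j.

Let factC_neq0 j : j`!%:R != 0 :> R[i].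
Proof. by rewrite pnatr_eq0 -lt0n fact_gt0. Qed.

Lemma cbin0 al : cbin al 0 = 1.
Proof. by rewrite /cbin big_ord0 fact0 divr1. Qed.

Lemma cbinS al j : cbin al j.+1 * j.+1%:R = al * cbin (al - 1) j.
Proof.
rewrite /cbin big_ord_recl subr0 factS natrM.
have -> : \prod_(i < j) (al - (bump 0 i)%:R) = \prod_(i < j) (al - 1 - i%:R).
  by apply: eq_bigr => i _; rewrite /bump add1n -natr1; ring.
by field; rewrite factC_neq0 nat1r pnatr_eq0.
Qed.

Lemma rdrv_exprn x n : rdrv (fun x : R => x%:C ^+ n.+1) x (n.+1%:R * x%:C ^+ n).
Proof.
elim: n => [|n IH]; first by under eq_fun do rewrite expr1; rewrite expr0 mulr1; exact: rdrv_id.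
under eq_fun do rewrite exprS.
have := rdrvM (rdrv_id x) IH; apply: rdrv_eq.
by rewrite -[n.+2%:R]natr1 exprS; ring.
Qed.

Lemma rdrv_sum (I : Type) (r : seq I) (F : I -> R -> R[i]) (L : I -> R[i]) x :
  (forall i, rdrv (F i) x (L i)) ->
  rdrv (fun x => \sum_(i <- r) F i x) x (\sum_(i <- r) L i).
Proof.
move=> h; elim: r => [|i r IH].
  by under eq_fun do rewrite big_nil; rewrite big_nil; exact: rdrv_cst.
by under eq_fun do rewrite big_cons; rewrite big_cons; exact: rdrvD.
Qed.

Lemma rdrv_binrem K x al : 0 <= x ->
  rdrv (fun x => binrem K.+1 x al) x (al * binrem K x (al - 1)).
Proof.
move=> x0; have x1 : 0 < 1 + x by rewrite ltr_pwDl.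
rewrite /binrem mulrBr; apply: rdrvB.
  have h : is_derive x 1 (fun x : R => 1 + x) 1.
    rewrite [X in is_derive _ _ X](_ : _ = shift 1); first exact: is_derive_shift.
    by apply/funext => y /=; rewrite addrC.
  have := rdrv_comp (rdrv_cpow al x1) h; apply: rdrv_eq.
  have n0 : (1 + x)%:C != 0 :> R[i].
    by rewrite (_ : 0 = 0%:C)// (inj_eq (@complexI _)) gt_eqF.
  by rewrite cpowD cpowN cpow_1// mulr1 fmorphV; ring.
under eq_fun do rewrite big_ord_recl.
rewrite -[X in rdrv _ _ X]add0r; apply: rdrvD.
  by under eq_fun do rewrite expr0; exact: rdrv_cst.
rewrite mulr_sumr; apply: (@rdrv_sum _ _ (fun (j : 'I_K) x => cbin al (lift ord0 j) * x%:C ^+ (lift ord0 j))).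
move=> j; rewrite lift0.
apply: rdrv_eq (rdrvZ (cbin al j.+1) (rdrv_exprn x j)).
by rewrite mulrA cbinS -mulrA.
Qed.

(** The derivative of the K-th remainder of (1 + x) ^ al is al times the
    (K - 1)-th remainder of (1 + x) ^ (al - 1); the bound in x ^ K follows by
    integrating K times *)
Lemma binrem_bound K (A : R) : 0 <= A -> exists2 M, 0 <= M &
  forall x al, 0 <= x <= 1 -> normc al <= A -> normc (binrem K x al) <= M * x ^+ K.
Proof.
elim: K A => [|K IH] A A0.
  exists (expR A); first exact: expR_ge0.
  move=> x al /andP[x0 x1] alA; rewrite expr0 mulr1 /binrem big_ord0 subr0.
  rewrite normc_cpow ler_expR.
  have l0 : 0 <= ln (1 + x) by rewrite ln_ge0// lerDl.
  have l1 : ln (1 + x) <= 1.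
    have : ln (1 + x) <= x by apply: le_ln1Dx; lra.
    lra.
  have := le_trans (ler_norm _) (le_trans (Re_le_normc al) alA).
  nra.
have [M M0 hM] := IH (A + 1) (addr_ge0 A0 ler01).
exists (2 * (A * M)); first by rewrite !mulr_ge0.
move=> x al /andP[x0 x1] alA.
have b0 : binrem K.+1 0 al = 0.
  rewrite /binrem addr0 cpow1 big_ord_recl cbin0 expr0 mulr1 big1 ?addr0 ?subrr// => i _.
  by rewrite lift0 exprS mul0r mulr0.
have := @mean_value_ineq _ (fun x => binrem K.+1 x al) (fun x => al * binrem K x (al - 1))
  0 x (A * (M * x ^+ K)) x0.
rewrite b0 !subr0 => h; apply: (le_trans (h _ _)).
- by move=> t /andP[t0 _]; exact: rdrv_binrem.
- move=> t /andP[t0 tx]; rewrite normcM ler_pM ?normc_ge0//.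
  apply: (le_trans (hM t _ _ _)).
  + by rewrite t0 (le_trans tx).
  + by rewrite (le_trans (normcB _ _))// normc1 lerD2r.
  + by rewrite ler_wpM2l// lerXn2r// ?nnegrE// (le_trans t0).
- by rewrite exprSr le_eqVlt; apply/orP; left; apply/eqP; ring.
Qed.

End BinomialSeries.

Section Zeta.
Context {R : realType}.
Implicit Types (s w z : R[i]).

Definition climit (u : nat -> R[i]) : R[i] := lim ((u : nat -> R[i]^o) @ \oo).

Lemma ccvg_climit u l : ccvg u l -> ccvg u (climit u).
Proof.
move=> h; have -> : climit u = l by exact: (cvg_lim (@norm_hausdorff _ R[i]^o) h).
exact: h.
Qed.

Definition dirichlet_partial s n : R[i] := \sum_(k < n) cpow k.+1%:R (- s).
Definition dirichlet s : R[i] := climit (dirichlet_partial s).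

Let normc_term s k : normc (cpow k.+1%:R (- s)) = expR (- (Re s * ln k.+1%:R)).
Proof. by rewrite normc_cpow ReN mulNr. Qed.

Let ln_ge0' k : 0 <= ln (k.+1%:R : R). Proof. by rewrite ln_ge0// ler1n. Qed.

Lemma ccvg_dirichlet s : 1 < Re s -> ccvg (dirichlet_partial s) (dirichlet s).
Proof.
move=> s1; have [B hB] := riemann_bounded s1.
have tb n : normc (cpow n.+1%:R (- s)) <= expR (- (Re s * ln n.+1%:R)).
  by rewrite normc_term.
have [l hl] := ccvg_abs_series tb hB.
exact: ccvg_climit hl.
Qed.

Let half_plane (a : R) s : a < Re s -> exists2 d : R, 0 < d &
  forall w, normc (w - s) < d -> a + d < Re w.
Proof.
move=> h; exists ((Re s - a) / 2); first by rewrite divr_gt0// subr_gt0.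
move=> w hw; have := le_lt_trans (Re_le_normc _) hw; rewrite ReB ltr_norml.
by move=> /andP[h1 h2]; lra.
Qed.

(** By hol_limit: near s a Riemann series bounds all the partial sums *)
Lemma cderivable_dirichlet s : 1 < Re s -> cderivable dirichlet s.
Proof.
move=> s1; have [d d0 hd] := half_plane s1.
have d1 : 1 < 1 + d by rewrite ltrDl.
have [B hB] := riemann_bounded d1.
apply: (@hol_limit _ (fun n s => dirichlet_partial s n) _ _ d B) => //.
- move=> n z _; apply: cderivable_sum => k _; apply: cderivable_cpow.
  by apply: cderivableN; exact: cderivable_id.
- move=> n z zd; rewrite (le_trans (normc_sum _ _ _))// (le_trans _ (hB n))//.
  apply: ler_sum => k _; rewrite normc_term ler_expR lerN2 ler_wpM2r//.
  by rewrite ltW// hd.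
- by move=> z zd; apply: ccvg_dirichlet; have := hd z zd; lra.
Qed.

Let rem_term K s n : R[i] := cpow n.+1%:R (1 - s) * binrem K (n.+1%:R)^-1 (1 - s).
Let rem K s : R[i] := climit (fun n => \sum_(k < n) rem_term K s k).

Let invn01 n : 0 <= (n.+1%:R : R)^-1 <= 1.
Proof. by rewrite invr_ge0 ler0n /= invf_le1 ?ltr0n// ler1n. Qed.

Let exprV_ln (n K : nat) : (n.+1%:R : R)^-1 ^+ K = expR (- (K%:R * ln n.+1%:R)).
Proof.
by rewrite expRN expRM_natl lnK ?posrE ?ltr0n// exprVn.
Qed.

Let rem_bound K (A a : R) : 0 <= A -> 2 - K%:R < a -> exists B, exists2 b : nat -> R,
  (forall n, \sum_(k < n) b k <= B) &
  forall s n, normc (1 - s) <= A -> a <= Re s -> normc (rem_term K s n) <= b n.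
Proof.
move=> A0 aK; have [M M0 hM] := binrem_bound K A0.
have h1 : 1 < a - 1 + K%:R by lra.
have [B hB] := riemann_bounded h1.
exists (M * B), (fun n => M * expR (- ((a - 1 + K%:R) * ln n.+1%:R))).
  by move=> n; rewrite -mulr_sumr ler_wpM2l.
move=> s n sA sa; rewrite normcM normc_cpow ReB Re1.
apply: (@le_trans _ _ (expR ((1 - a) * ln n.+1%:R) * (M * (n.+1%:R)^-1 ^+ K))).
  rewrite ler_pM ?expR_ge0 ?normc_ge0//; last exact: hM.
  by rewrite ler_expR ler_wpM2r// lerB.
rewrite mulrCA exprV_ln -expRD ler_wpM2l// ler_expR; lra.
Qed.

Let ccvg_rem K s : 2 - K%:R < Re s -> ccvg (fun n => \sum_(k < n) rem_term K s k) (rem K s).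
Proof.
move=> sK; have [B [b hB hb]] := @rem_bound K (normc (1 - s)) _ (normc_ge0 _) sK.
have [l hl] := ccvg_abs_series (fun n => hb s n (lexx _) (lexx _)) hB.
exact: ccvg_climit hl.
Qed.

Let cderivable_cbin j s : cderivable (fun s => cbin (1 - s) j) s.
Proof.
apply: cderivableM; last exact: cderivable_cst.
apply: cderivable_prod => i _; apply: cderivableB; last exact: cderivable_cst.
by apply: cderivableB; [exact: cderivable_cst|exact: cderivable_id].
Qed.

Let cderivable_rem K s : 2 - K%:R < Re s -> cderivable (rem K) s.
Proof.
move=> sK; have [d d0 hd] := half_plane sK.
have ad : 2 - K%:R < 2 - K%:R + d by rewrite ltrDl.
have [B [b hB hb]] := @rem_bound K (normc (1 - s) + d) _ (addr_ge0 (normc_ge0 _) (ltW d0)) ad.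
apply: (@hol_limit _ (fun n s => \sum_(k < n) rem_term K s k) _ _ d B) => //.
- move=> n z _; apply: cderivable_sum => k _.
  have d1 : cderivable (fun s => 1 - s) z.
    by apply: cderivableB; [exact: cderivable_cst|exact: cderivable_id].
  apply: cderivableM; first exact: cderivable_cpow.
  apply: cderivableB; first exact: cderivable_cpow.
  by apply: cderivable_sum => j _; apply: cderivableM => //; exact: cderivable_cst.
- move=> n z zd; rewrite (le_trans (normc_sum _ _ _))// (le_trans _ (hB n))//.
  apply: ler_sum => k _; apply: hb; last by rewrite ltW// hd.
  rewrite (_ : 1 - z = (1 - s) + (s - z)); last by ring.
  by rewrite (le_trans (normcD _ _))// lerD2l normc_distC ltW.
- by move=> z zd; apply: ccvg_rem; have := hd z zd; lra.
Qed.

Let ccvg_cpow0 s : 1 < Re s -> ccvg (fun n => cpow n.+1%:R (1 - s)) 0.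
Proof.
move=> s1; apply/ccvgP => e e0.
pose c := Re s - 1; have c0 : 0 < c by rewrite subr_gt0.
exists (Num.truncn (expR (- ln e / c))).+1 => n hn.
rewrite subr0 normc_cpow ReB Re1 -[e]lnK// ltr_expR.
have h : expR (- ln e / c) < n.+1%:R.
  by rewrite (lt_le_trans (truncnS_gt _))// ler_nat ltnW.
have h2 : - ln e / c < ln n.+1%:R by rewrite -ltr_expR lnK ?posrE ?ltr0n.
by move: h2; rewrite ltr_pdivrMr// /c; lra.
Qed.

(** The sum over n of n ^ (1 - s) - (n + 1) ^ (1 - s) = 1, where (n + 1) ^ (1 - s) is
    expanded in powers of 1 / n, expresses zeta(s) in terms of the zeta(s + i + 1) *)
Let zeta_recursion k s : 1 < Re s ->
  1 = (s - 1) * dirichlet s - \sum_(i < k) cbin (1 - s) i.+2 * dirichlet (s + i.+1%:R)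
      - rem k.+2 s.
Proof.
move=> s1.
have C1 : ccvg (fun n => 1 - cpow n.+1%:R (1 - s)) (1 - 0).
  by apply: ccvgB; [exact: ccvg_cst|exact: ccvg_cpow0].
have sj j : 1 < Re (s + j%:R).
  by rewrite ReD natC ReC; have := ler0n R j; lra.
have C2 : ccvg (fun n => (s - 1) * dirichlet_partial s n -
     \sum_(i < k) cbin (1 - s) i.+2 * dirichlet_partial (s + i.+1%:R) n -
     \sum_(j < n) rem_term k.+2 s j) ((s - 1) * dirichlet s -
     \sum_(i < k) cbin (1 - s) i.+2 * dirichlet (s + i.+1%:R) - rem k.+2 s).
  apply: ccvgB; last by apply: ccvg_rem; rewrite -!natr1; have := ler0n R k; lra.
  apply: ccvgB; first by apply: ccvgZ; exact: ccvg_dirichlet.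
  apply: (@ccvg_sum _ _ _ (fun i : 'I_k => fun n => cbin (1 - s) i.+2 * dirichlet_partial (s + i.+1%:R) n)).
  by move=> i; apply: ccvgZ; exact: ccvg_dirichlet.
rewrite -[LHS]subr0; apply: (ccvg_uniq C1); apply: (ccvg_ext C2) => n.
rewrite (_ : \sum_(i < k) _ = \sum_(j < n) \sum_(i < k)
    cbin (1 - s) i.+2 * cpow j.+1%:R (- (s + i.+1%:R))); last first.
  by rewrite exchange_big; apply: eq_bigr => i _; rewrite mulr_sumr.
rewrite /dirichlet_partial mulr_sumr -!sumrB.
transitivity (\sum_(j < n) (cpow j.+1%:R (1 - s) - cpow j.+2%:R (1 - s)) : R[i]); last first.
  elim: n => [|n IH]; first by rewrite big_ord0 cpow1 subrr.
  by rewrite big_ord_recr IH /=; ring.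
apply: eq_bigr => j _.
have j0 : 0 < j.+1%:R :> R by rewrite ltr0n.
have jC0 : (j.+1%:R : R)%:C != 0 :> R[i].
  by rewrite (_ : 0 = 0%:C)// (inj_eq (@complexI _)) gt_eqF.
have -> : cpow j.+2%:R (1 - s) = cpow j.+1%:R (1 - s) * cpow (1 + j.+1%:R^-1) (1 - s).
  rewrite -cpowMl//.
  have E2 : j.+1%:R * (1 + j.+1%:R^-1) = j.+2%:R :> R.
    by rewrite mulrDr mulr1 divff ?gt_eqF// natr1.
  by rewrite E2.
rewrite /rem_term.
have -> : binrem k.+2 j.+1%:R^-1 (1 - s) = cpow (1 + j.+1%:R^-1) (1 - s) -
    (1 + (1 - s) * (j.+1%:R^-1)%:C +
     \sum_(i < k) cbin (1 - s) i.+2 * (j.+1%:R^-1)%:C ^+ i.+2).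
  rewrite /binrem 2!big_ord_recl addrA; congr (_ - (_ + _ + _)).
    have -> : cbin (1 - s) (@ord0 k.+1) = 1 by exact: cbin0.
    by rewrite mul1r.
  have -> : cbin (1 - s) (lift ord0 (@ord0 k)) = 1 - s.
    by rewrite lift0 /cbin big_ord1 subr0 factS fact0 muln1 divr1.
  by rewrite lift0 expr1.
have cE (i : nat) : cpow j.+1%:R (- (s + i%:R)) = cpow j.+1%:R (1 - s) * (j.+1%:R^-1)%:C ^+ i.+1.
  have -> : - (s + i%:R) = (1 - s) - i.+1%:R by rewrite -natr1; ring.
  rewrite cpowD cpowN /cpow cexpMn cexp_real lnK//.
  by rewrite fmorphV exprVn.
have -> : cpow j.+1%:R (- s) = cpow j.+1%:R (1 - s) * (j.+1%:R^-1)%:C ^+ 1.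
  by rewrite -(cE 0%N) addr0.
under eq_bigr => i _ do rewrite cE mulrCA.
rewrite -mulr_sumr expr1.
by ring.
Qed.

Let cbin_lastE i s : cbin (1 - s) i.+2 =
  - (\prod_(l < i.+1) (1 - s - l%:R) / i.+2`!%:R) * (s + i%:R).
Proof.
rewrite /cbin big_ord_recr /= -[i.+1%:R]natr1; ring.
Qed.

(** The recursion continues (s - 1) zeta(s) by one unit to the left: it involves
    the values further to the right and a remainder converging there *)
Let zeta_half_plane (k : nat) : exists h : R[i] -> R[i],
  (forall s, 1 - k%:R < Re s -> cderivable h s) /\
  (forall s, 1 < Re s -> h s = (s - 1) * dirichlet s).
Proof.
elim: k => [|k [h [dh hE]]].
  exists (fun s => (s - 1) * dirichlet s); split => // s; rewrite subr0 => s1.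
  apply: cderivableM; last exact: cderivable_dirichlet.
  by apply: cderivableB; [exact: cderivable_id|exact: cderivable_cst].
pose P i s : R[i] := \prod_(l < i.+1) (1 - s - l%:R) / i.+2`!%:R.
have dP i s : cderivable (P i) s.
  apply: cderivableM; last exact: cderivable_cst.
  apply: cderivable_prod => l _; apply: cderivableB; last exact: cderivable_cst.
  by apply: cderivableB; [exact: cderivable_cst|exact: cderivable_id].
exists (fun s => 1 - \sum_(i < k) P i s * h (s + i.+1%:R) + rem k.+2 s); split.
  move=> s; rewrite -natr1 => sk; apply: cderivableD; last first.
    by apply: cderivable_rem; rewrite -!natr1; lra.
  apply: cderivableB; first exact: cderivable_cst.
  apply: cderivable_sum => i _; apply: cderivableM => //.
  apply: (@cderivable_comp _ (fun s => s + i.+1%:R)).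
    by apply: cderivableD; [exact: cderivable_id|exact: cderivable_cst].
  apply: dh; rewrite ReD natC ReC -natr1; have := ler0n R i; lra.
move=> s s1; rewrite {1}(zeta_recursion k s1).
have -> : \sum_(i < k) cbin (1 - s) i.+2 * dirichlet (s + i.+1%:R) =
    - \sum_(i < k) P i s * h (s + i.+1%:R).
  rewrite -sumrN; apply: eq_bigr => i _; rewrite hE.
    by rewrite cbin_lastE -/(P i s) -natr1; ring.
  by rewrite ReD natC ReC; have := ler0n R i.+1; lra.
by ring.
Qed.

Let identity_half_plane (p : R[i] -> R) (c : R) (f : R[i] -> R[i]) z0 :
  (forall z w (t : R), p (z + t%:C * (w - z)) = p z + t * (p w - p z)) ->
  (forall z w, `|p z - p w| <= normc (z - w)) ->
  (forall z, c < p z -> cderivable f z) -> c < p z0 ->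
  (exists2 d : R, 0 < d & forall w, normc (w - z0) < d -> f w = 0) ->
  forall w, c < p w -> f w = 0.
Proof.
move=> pa pl df hz hd; apply: (hol_identity _ _ df hz hd).
- move=> z hc; exists (p z - c); first by rewrite subr_gt0.
  move=> w hw; have := le_lt_trans (pl w z) hw; rewrite ltr_norml => /andP[]; lra.
- move=> z w t hz' hw /andP[t0 t1]; rewrite pa.
  by have [h|h] := leP (p z) (p w); nra.
Qed.

Let identity_Re (c : R) (f : R[i] -> R[i]) z0 :
  (forall z, c < Re z -> cderivable f z) -> c < Re z0 ->
  (exists2 d : R, 0 < d & forall w, normc (w - z0) < d -> f w = 0) ->
  forall w, c < Re w -> f w = 0.
Proof.
apply: identity_half_plane => [z w t|z w]; first by rewrite ReD ReCM ReB.
by rewrite -ReB Re_le_normc.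
Qed.

Let ball_half_plane (a : R) s : a < Re s ->
  exists2 d : R, 0 < d & forall w, normc (w - s) < d -> a < Re w.
Proof. by move=> /half_plane[d d0 hd]; exists d => // w /hd; lra. Qed.

(** The continuations to the half planes agree by the identity theorem *)
Lemma zeta_entire : exists h : R[i] -> R[i], (forall s, cderivable h s) /\
  (forall s, 1 < Re s -> h s = (s - 1) * dirichlet s).
Proof.
have [H HP] := choice zeta_half_plane.
have agree k k' s : (k <= k')%N -> 1 - k%:R < Re s -> H k s = H k' s.
  move=> kk' sk; apply/eqP; rewrite -subr_eq0; apply/eqP.
  have R2 : Re (2 : R[i]) = 2 by rewrite natC ReC.
  apply: (@identity_Re (1 - k%:R) (fun s => H k s - H k' s) 2) => //.
  - move=> z zk; apply: cderivableB; first by apply: (HP k).1.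
    by apply: (HP k').1; have : k%:R <= k'%:R :> R by [rewrite ler_nat]; lra.
  - by rewrite R2; have := ler0n R k; lra.
  - have [|d d0 hd] := @ball_half_plane 1 2; first by rewrite R2 ltr1n.
    by exists d => // w /hd w1; rewrite (HP k).2// (HP k').2// subrr.
pose n s := (Num.truncn `|Re s|).+2.
have hn s : 1 - (n s)%:R < Re s.
  have h : `|Re s| < (Num.truncn `|Re s|).+1%:R := truncnS_gt _.
  by rewrite /n -[_.+2%:R]natr1; have := ler_norm (- Re s); rewrite normrN; lra.
have nE k s : 1 - k%:R < Re s -> H (n s) s = H k s.
  by move=> sk; have [h|/ltnW h] := leqP k (n s); [rewrite -(agree k)|rewrite (agree (n s) k)].
exists (fun s => H (n s) s); split => s; last by exact: (HP _).2.
have [d d0 hd] := ball_half_plane (hn s).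
apply: (@cderivable_ext _ (H (n s)) _ _ d d0); last exact: (HP _).1.
by move=> w /hd /nE.
Qed.

Lemma is_zeta_exists : exists f : R[i] -> R[i], is_zeta f.
Proof.
have [h [dh hE]] := zeta_entire; exists (fun s => h s / (s - 1)); split.
  move=> s s1; have n0 : 0 < normc (s - 1) by rewrite normc_gt0 subr_eq0.
  apply/holomorphic_atP; exists (normc (s - 1)) => // w ws.
  apply: cderivableM => //; apply: cderivableV.
    rewrite -normc_gt0; have := normc_triB (s - 1) (w - 1).
    have -> : s - 1 - (w - 1) = s - w by ring.
    by rewrite normc_distC; lra.
  by apply: cderivableB; [exact: cderivable_id|exact: cderivable_cst].
move=> s s1; rewrite hE// mulrAC divff ?mul1r; last first.
  by apply/eqP => /eqP; rewrite subr_eq0 => /eqP h1; rewrite h1 Re1 ltxx in s1.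
have := ccvg_dirichlet s1; rewrite /ccvg.
rewrite (_ : (dirichlet_partial s : nat -> R[i]^o) = series (fun n => cpow n.+1%:R (- s)))//.
by apply/funext => n; rewrite /series /= big_mkord.
Qed.

Lemma zetaP : is_zeta (@zeta R).
Proof. by have [f hf] := is_zeta_exists; exact: (xgetPex _ (ex_intro _ f hf)). Qed.

Lemma zetaE s : 1 < Re s -> zeta s = dirichlet s.
Proof.
move=> s1; apply: (ccvg_uniq _ (ccvg_dirichlet s1)).
have [_ H] := zetaP.
apply: (ccvg_ext (H s s1 : ccvg (series (fun n => cpow n.+1%:R (- s) : R[i]^o)) (zeta s))) => n.
by rewrite /series /= big_mkord.
Qed.

Lemma meromorphic_zeta s : meromorphic_at (@zeta R) s.
Proof.
have [hz _] := zetaP.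
have dz w : w != 1 -> cderivable (@zeta R) w.
  by move=> /hz /holomorphic_atP[d d0 hd]; apply: hd; rewrite subrr normc0.
have [s1|s1] := eqVneq s 1; last first.
  by have [d d0 hd] := (holomorphic_atP _ _).1 (hz s s1); exact: (meromorphic_hol d0).
have [h [dh hE]] := zeta_entire.
pose f w := (w - 1) * zeta w - h w.
have df w : w != 1 -> cderivable f w.
  move=> w1; apply: cderivableB => //; apply: cderivableM; last exact: dz.
  by apply: cderivableB; [exact: cderivable_id|exact: cderivable_cst].
have f0 w : 1 < Re w -> f w = 0 by move=> w1; rewrite /f hE// zetaE// subrr.
have f_im (e : R) : `|e| = 1 -> forall w, 0 < e * Im w -> f w = 0.
  move=> e1; have e0 : e != 0 by rewrite -normr_eq0 e1 oner_eq0.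
  have e2 : e * e = 1.
    by have := real_normK (num_real e); rewrite e1 expr1n expr2.
  apply: (@identity_half_plane (fun w => e * Im w) 0 f (2 +i* e)) => /=.
  - by move=> z w t; rewrite ImD ImCM ImB; ring.
  - by move=> z w; rewrite -mulrBr -ImB normrM e1 mul1r Im_le_normc.
  - by move=> z hz1; apply: df; apply/eqP => z1; move: hz1; rewrite z1 Im1 mulr0 ltxx.
  - by rewrite e2.
  - have [|d d0 hd] := @ball_half_plane 1 (2 +i* e); first by rewrite /= ltr1n.
    by exists d => // w /hd /f0.
have fE w : w != 1 -> f w = 0.
  move=> w1; have [/f0//|wle] := ltP 1 (Re w).
  have [wi|wi] := eqVneq (Im w) 0; last first.
    apply: (@f_im (Num.sg (Im w))); first by rewrite normr_sg wi.
    by rewrite -normrEsg normr_gt0.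
  have w1' : 0 - 1 < - Re w.
    rewrite sub0r ltrN2 lt_neqAle wle andbT; apply: contra w1 => /eqP h1.
    by apply/eqP; apply: eqC.
  rewrite sub0r in w1'.
  apply: (@identity_half_plane (fun w => - Re w) (- 1) f (0 +i* 2)) => //=.
  - by move=> z z' t; rewrite ReD ReCM ReB; ring.
  - by move=> z z'; rewrite -opprD normrN -ReB Re_le_normc.
  - by move=> z hz1; apply: df; apply/eqP => z1; move: hz1; rewrite z1 Re1 ltxx.
  - by rewrite oppr0 oppr_lt0.
  - exists 1 => // z hz1; apply: (@f_im 1); first by rewrite normr1.
    have := le_lt_trans (Im_le_normc _) hz1; rewrite ImB /= ltr_norml => /andP[].
    lra.
apply: (@meromorphic_ext _ (fun w => h w / (w - 1)) _ _ 1 ltr01).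
  move=> w _; rewrite s1 => w1; have /eqP := fE w w1; rewrite subr_eq0 => /eqP <-.
  by rewrite mulrAC divff ?mul1r// subr_eq0.
apply: meromorphicM; first exact: meromorphic_entire.
apply: meromorphicV; apply: meromorphic_entire => w.
by apply: cderivableB; [exact: cderivable_id|exact: cderivable_cst].
Qed.

Lemma meromorphic_zeta2 s : meromorphic_at (fun w => @zeta R (2 * w)) s.
Proof.
have /meromorphic_atP[k [g [d [d0 hd]]]] := meromorphic_zeta (2 * s).
apply/meromorphic_atP; exists k, (fun w => g (2 * w) / 2 ^+ k), (d / 2).
split; first exact: divr_gt0.
have E w : 2 * w - 2 * s = 2 * (w - s) by ring.
move=> w hw; have [|h1 h2] := hd (2 * w).
  by rewrite E normcM normc_nat; lra.
split.
  apply: cderivableM; last exact: cderivable_cst.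
  apply: (@cderivable_comp _ (fun w => 2 * w)) => //.
  by apply: cderivableM; [exact: cderivable_cst|exact: cderivable_id].
move=> ws; rewrite -h2; last by rewrite -subr_eq0 E mulf_neq0 ?subr_eq0// pnatr_eq0.
by rewrite E exprMn; field; rewrite expf_neq0// pnatr_eq0.
Qed.

End Zeta.

(** * Fourier transforms *)

Section AffineChange.
Context {R : realType}.
Notation mu := (@lebesgue_measure R).
Implicit Types (f : R -> R[i]).

Let is_derive_affine (c d x : R) : is_derive x 1 (fun x => c * x + d) c.
Proof.
have h := is_deriveD (is_deriveZ c (is_derive_id x 1)) (is_derive_cst d x 1).
apply: (is_derive_eq h); first by rewrite addr0 [LHS]mulr1.
Qed.

Let near_affine (c d x : R) : 0 < c ->
  \forall n \near \oo, c * (- n%:R) + d <= x <= c * n%:R + d.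
Proof.
move=> c0; apply: filterS (near_natNn ((x - d) / c)) => n.
by rewrite ler_pdivlMr// ler_pdivrMr// => /andP[h1 h2]; apply/andP; split; lra.
Qed.

(** The substitution on the compact intervals exhausting the line; the integrals
    of the absolute value stay bounded, which gives integrability *)
Lemma cintegral_affine f (c d : R) : 0 < c -> (forall x, ccont f x) ->
  cintegrable setT f ->
  cintegrable setT (fun x => f (c * x + d)) /\
  c%:C * cintegral setT (fun x => f (c * x + d)) = cintegral setT f.
Proof.
move=> c0 cf hf.
pose p (x : R) := c * x + d.
have cp x : {for x, continuous p}.
  by apply: differentiable_continuous; apply/derivable1_diffP; case: (is_derive_affine c d x).
have cg x : ccont (fun x => f (p x)) x by apply: ccont_comp.
have subst (h : R -> R[i]) (n : nat) : (forall x, ccont h x) ->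
    cintegral `[p (- n%:R), p n%:R] h = cintegral `[- n%:R, n%:R] (fun x => h (p x) * c%:C).
  move=> ch; have nn : (- n%:R : R) <= n%:R by rewrite (@le_trans _ _ 0)// oppr_le0.
  have pp : p (- n%:R) <= p n%:R by rewrite /p lerD2r ler_pM2l.
  apply: (@cintegral_subst _ h p (fun=> c) (p (- n%:R) - 1) _ _ nn (fun x _ => ch x)) => //.
  - move=> x /andP[h1 _]; rewrite /p; have := ler_wpM2l (ltW c0) h1; lra.
  - by move=> x _; exact: is_derive_affine.
  - by move=> x _; exact: cst_continuous.
have cn x : ccont (fun x => (normc (f x))%:C) x.
  have /ccontP hfx := cf x; apply/ccontP => e /hfx[d' d'0 hd]; exists d' => // y /hd.
  rewrite -rmorphB normc_real => h; apply: le_lt_trans h.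
  rewrite ler_norml; have := normc_triB (f y) (f x); have := normc_triB (f x) (f y).
  by rewrite (normc_distC (f x)) => h1 h2; apply/andP; split; lra.
have bE : \bigcup_n `[- n%:R, n%:R]%classic = [set: R].
  apply/seteqP; split => // x _.
  have [N _ /(_ N (leqnn N)) h] := near_natNn x.
  by exists N => //=; rewrite in_itv.
have ig : cintegrable setT (fun x => f (p x)).
  rewrite -bE; apply: (@integrable_exhaust _ _ _ (c^-1 * \int[mu]_x normc (f x))).
  - apply/nondecreasing_seqP => n; rewrite subsetEset => x; rewrite /= !in_itv /=.
    move=> /andP[h1 h2]; apply/andP; split; [apply: le_trans h1|apply: (le_trans h2)].
      by rewrite lerN2 ler_nat.
    by rewrite ler_nat.
  - by move=> n; exact: measurable_itv.
  - by rewrite bE; exact: mfunC_cont.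
  - move=> n; apply: cintegrable_normc; first exact: measurable_itv.
    exact: ccont_cintegrable.
  move=> n; rewrite ler_pdivlMl// -lecR.
  have -> (I : R) : (c * I)%:C = c%:C * I%:C :> R[i] by rewrite rmorphM.
  rewrite -cintegral_real -cintegralZ//; last first.
    by apply: ccont_cintegrable => x _; apply: (@ccont_comp _ (fun x => (normc (f x))%:C)).
  under eq_cintegral => x _ do rewrite mulrC.
  rewrite -(subst (fun x => (normc (f x))%:C) n cn) cintegral_real lecR /Rintegral fine_le//.
  - apply: integrable_fin_num; first exact: measurable_itv.
    by apply: cintegrable_normc; [exact: measurable_itv|exact: ccont_cintegrable].
  - by apply: integrable_fin_num; [exact: measurableT|exact: cintegrable_normc].
  - apply: ge0_subset_integral => //.
      by have /measurable_int := cintegrable_normc measurableT hf.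
    by move=> x _; rewrite lee_fin normc_ge0.
split => //; rewrite -cintegralZ//.
have C1 := @cvg_cintegral_exhaustT _ f _ _ hf (fun x => @near_affine c d x c0).
have C2 := @cvg_cintegral_exhaustT _ (fun x => c%:C * f (p x)) _ _
  (cintegrableZ c%:C measurableT ig) (@near_natNn R).
apply: (ccvg_uniq C2); apply: (ccvg_ext C1) => n.
by rewrite (subst f n cf); apply: eq_cintegral => x _; rewrite mulrC.
Qed.

Lemma cintegral_shift f (d : R) : (forall x, ccont f x) -> cintegrable setT f ->
  cintegral setT (fun x => f (x + d)) = cintegral setT f.
Proof.
move=> cf hf; have [_ <-] := @cintegral_affine f 1 d ltr01 cf hf.
by rewrite mul1r; apply: eq_cintegral => x _; rewrite mul1r.
Qed.

End AffineChange.

Section GaussianTransform.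
Context {R : realType}.
Notation mu := (@lebesgue_measure R).
Variables (a : R) (a_gt0 : 0 < a).

Let k (x : R) := expR (- (a * x ^+ 2)).

Let continuous_k : continuous k.
Proof.
move=> x; apply: (@continuous_expR_comp _ (fun x => - (a * x ^+ 2))).
apply: continuousN; apply: continuousM; first exact: cst_continuous.
exact: exprn_continuous.
Qed.

(** Completing the square in |x| *)
Lemma gaussian_bound (b : R) : exists C, forall x, expR (b * x) * expR (- (a * x ^+ 2)) <= C * lorentz x.
Proof.
have [C C0 hC] := @expRN_le_lorentz R 1 ltr01.
exists (expR ((`|b| + 1) ^+ 2 / (4 * a)) * C) => x.
rewrite -mulrA; apply: le_trans (ler_wpM2l (expR_ge0 _) (hC x)).
rewrite /k -!expRD ler_expR mul1r -lerBrDr.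
have h : b * x <= `|b| * `|x| by rewrite -normrM ler_norm.
rewrite -[x ^+ 2]real_normK ?num_real//.
have a4 : 0 < 4 * a by rewrite mulr_gt0.
have -> : b * x <= (`|b| + 1) ^+ 2 / (4 * a) - `|x| - - (a * `|x| ^+ 2) =
    (b * x + `|x| - a * `|x| ^+ 2 <= (`|b| + 1) ^+ 2 / (4 * a)).
  by apply/idP/idP => ?; lra.
rewrite ler_pdivlMr//.
have : 0 <= (2 * a * `|x| - (`|b| + 1)) ^+ 2 by exact: sqr_ge0.
by move: (`|x|) (`|b|) h => X B h; nra.
Qed.

Let integrable_k (b : R) : mu.-integrable setT (EFin \o (fun x => expR (b * x) * k x)).
Proof.
have [C hC] := gaussian_bound b.
apply: (@le_integrable _ _ _ mu setT measurableT _ (EFin \o (fun x => C * lorentz x))).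
- apply/measurable_EFinP; apply: continuous_measurable_fun => x.
  apply: (@continuousM R R (fun x => expR (b * x)) k); last exact: continuous_k.
  apply: (@continuous_expR_comp _ (fun x => b * x)).
  by apply: continuousM; [exact: cst_continuous|].
- move=> x _; rewrite /= lee_fin ger0_norm ?mulr_ge0 ?expR_ge0//.
  by rewrite (le_trans (hC x))// ler_norm.
- by apply: integrableZ_real => //; exact: integrable_lorentz.
Qed.

Let L (w : R[i]) := cintegral setT (fun x => cexp (w * x%:C) * (k x)%:C).

Let cderivable_L w : cderivable L w.
Proof.
apply: (@cderivable_laplace _ k (Re w - 1) (Re w + 1)) => //.
- exact: continuous_measurable_fun continuous_k.
- by move=> x; exact: expR_ge0.
- by apply/andP; split; lra.
Qed.

Let gauss_integral : cintegral setT (fun x => (expR (- x ^+ 2))%:C) = (Num.sqrt pi)%:C :> R[i].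
Proof. by rewrite cintegral_real /Rintegral integralT_gauss. Qed.

(** For a real parameter b, completing the square makes the Laplace transform a
    translated Gaussian integral *)
Let L_real (b : R) : L b%:C = (Num.sqrt (pi / a))%:C * cexp (b%:C ^+ 2 / (4 * a)%:C).
Proof.
have sa : 0 < Num.sqrt a by rewrite sqrtr_gt0.
have saC : (Num.sqrt a)%:C != 0 :> R[i].
  by rewrite (_ : 0 = 0%:C)// (inj_eq (@complexI _)) gt_eqF.
pose g (x : R) : R[i] := (expR (- x ^+ 2))%:C.
have cg x : ccont g x.
  apply: ccont_real; apply: (@continuous_expR_comp _ (fun x => - x ^+ 2)).
  by apply: continuousN; exact: exprn_continuous.
have ig : cintegrable setT g by split => /=; [exact: integrableT_gauss|exact: integrable0].
have [ih h] := cintegral_affine (- (b / (2 * Num.sqrt a))) sa cg ig.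
have -> : (Num.sqrt (pi / a))%:C = (Num.sqrt a)%:C^-1 * cintegral setT g.
  by rewrite /g gauss_integral sqrtrM ?pi_ge0// sqrtrV ?ltW// rmorphM fmorphV mulrC.
rewrite -h (mulKf saC) mulrC -(cintegralZ _ measurableT ih).
apply: eq_cintegral => x _; rewrite /k /g -rmorphM -rmorphXn -fmorphV -rmorphM !cexp_real -!rmorphM.
congr (_%:C); rewrite -!expRD; congr expR.
have sa2 : Num.sqrt a ^+ 2 = a by rewrite sqr_sqrtr// ltW.
rewrite -[in LHS]sa2 -[in X in _ = _ / (4 * X) + _]sa2.
by field; rewrite gt_eqF.
Qed.

(** Both sides are entire and agree on the real line, whose points accumulate at 0 *)
Let LE w : L w = (Num.sqrt (pi / a))%:C * cexp (w ^+ 2 / (4 * a)%:C).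
Proof.
pose f w := L w - (Num.sqrt (pi / a))%:C * cexp (w ^+ 2 / (4 * a)%:C).
have df w' : cderivable f w'.
  apply: cderivableB => //; apply: cderivableM; first exact: cderivable_cst.
  apply: (@cderivable_comp _ (fun w => w ^+ 2 / (4 * a)%:C)); last exact: cderivable_cexp.
  apply: cderivableM; last exact: cderivable_cst.
  by apply: cderivableX; exact: cderivable_id.
suff : f w = 0 by move=> /eqP; rewrite subr_eq0 => /eqP.
apply: (@hol_identity _ (fun=> True) f 0) => //; first by exists 1.
have [//|[j [u [r [r0 hr]]]]] := @hol_zero_dichotomy _ f 0 1 ltr01 (fun z _ => df z).
have rC : (r / 2)%:C != 0 :> R[i].
  by rewrite (_ : 0 = 0%:C)// (inj_eq (@complexI _)) gt_eqF// divr_gt0.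
have [] := hr (r / 2)%:C; first by rewrite subr0 normc_real gtr0_norm; lra.
move=> _ u0; rewrite /f L_real subrr subr0 => /esym/eqP.
by rewrite mulf_eq0 expf_eq0 (negbTE rC) andbF (negbTE u0).
Qed.

Lemma gaussian_fourier (xi : R) :
  cintegral setT (fun x => cis (- (2 * pi * xi * x)) * (expR (- (a * x ^+ 2)))%:C) =
  (Num.sqrt (pi / a) * expR (- (pi ^+ 2 * xi ^+ 2 / a)))%:C.
Proof.
rewrite [RHS]rmorphM -[X in _ = _ * X]cexp_real.
have -> : (- (pi ^+ 2 * xi ^+ 2 / a))%:C = (0 +i* (- (2 * pi * xi))) ^+ 2 / (4 * a)%:C :> R[i].
  rewrite (expr2 (0 +i* _)); have -> : (0 +i* (- (2 * pi * xi))) * (0 +i* (- (2 * pi * xi))) =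
      (- (4 * pi ^+ 2 * xi ^+ 2))%:C :> R[i].
    by apply: eqC; rewrite ?ReM ?ImM /=; ring.
  by rewrite -fmorphV -rmorphM; congr (_%:C); field; rewrite gt_eqF.
rewrite -LE; apply: eq_cintegral => x _; congr (cexp _ * _).
by apply: eqC; rewrite ?ReMC ?ImMC /=; ring.
Qed.

End GaussianTransform.

Section GammaScaling.
Context {R : realType}.

(** Euler's integral for Gamma(s) A ^ (- s), in the variable ln t *)
Lemma gamma_scaling (A : R) (s : R[i]) : 0 < A -> 0 < Re s ->
  cintegrable setT (fun u => cexp (s * u%:C) * (expR (- (A * expR u)))%:C) /\
  cintegral setT (fun u => cexp (s * u%:C) * (expR (- (A * expR u)))%:C) =
  Gamma s * cpow A (- s).
Proof.
move=> A0 s0; have ig0 := cintegrable_gamma_log s0.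
have cg := @ccont_gamma_log _ s.
have E : (fun u => cexp (s * u%:C) * (expR (- (A * expR u)))%:C) =
    fun u => cpow A (- s) * gamma_log s (u + ln A).
  apply/funext => u; rewrite /gamma_log /gamma_kernel expRD lnK//.
  rewrite [expR u * A]mulrC rmorphD mulrDr cexpD cpowN /cpow.
  have := cexp_neq0 (s * (ln A)%:C); move: (cexp (s * (ln A)%:C)) => E E0.
  by field.
have [] := cintegral_affine (ln A) ltr01 cg ig0.
under eq_fun do rewrite mul1r.
move=> ig _; rewrite E; split; first exact: cintegrableZ.
rewrite (cintegralZ _ measurableT ig) (cintegral_shift (ln A) cg ig0).
by rewrite (Gamma_gamma_integral s0) (gamma_integralE s0) mulrC.
Qed.

End GammaScaling.

(** * The Fourier transform of a power of a quadratic form *)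

Section Exchange.
Context {R : realType}.
Notation mu := (@lebesgue_measure R).
Notation R2 := (measurableTypeR R * measurableTypeR R)%type.

Let Rintegral_exchange (G : R -> R -> R) (h : R -> R) :
  measurable_fun setT (fun z : R2 => G z.1 z.2) ->
  (forall x, mu.-integrable setT (EFin \o G x)) ->
  (forall u, mu.-integrable setT (EFin \o G^~ u)) ->
  mu.-integrable setT (EFin \o h) ->
  (forall x, \int[mu]_u `|G x u| <= h x) ->
  \int[mu]_x \int[mu]_u G x u = \int[mu]_u \int[mu]_x G x u.
Proof.
move=> mG i1 i2 ih hG.
have i1n x : mu.-integrable setT (EFin \o (fun u => `|G x u|)).
  by rewrite (_ : _ \o _ = abse \o (EFin \o G x))//; exact: integrable_abse.
have mE : measurable_fun setT (fun z : R2 => (G z.1 z.2)%:E) by exact/measurable_EFinP.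
have iG : (mu \x mu)%E.-integrable setT (fun z : R2 => (G z.1 z.2)%:E).
  apply/integrable12ltyP => //.
  have /integrableP[mh] := ih; apply: le_lt_trans.
  apply: ge0_le_integral => //.
  - by move=> x _; exact: integral_ge0.
  - apply: (measurable_fun_fubini_tonelli_F (fun z : R2 => `|(G z.1 z.2)%:E|%E)) => //.
    exact: measurableT_comp.
  - exact: measurableT_comp.
  move=> x _; rewrite -[leLHS]fineK.
    by rewrite lee_fin; apply: le_trans (hG x) (ler_norm _).
  by apply: (@integrable_fin_num _ _ _ mu setT _ (EFin \o (fun u => `|G x u|))).
have H := @Fubini _ _ _ _ _ mu mu _ iG.
rewrite /Rintegral; congr fine.
under eq_integral => x _.
  rewrite fineK; last first.
    by apply: (@integrable_fin_num _ _ _ mu setT _ (EFin \o G x)) => //; exact: i1.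
  over.
under [RHS]eq_integral => x _.
  rewrite fineK; last first.
    by apply: (@integrable_fin_num _ _ _ mu setT _ (EFin \o G^~ x)) => //; exact: i2.
  over.
exact: H.
Qed.

(** Fubini's theorem.  The iterated integrals are integrals of finite functions
    because all the sections are integrable, not just almost all of them. *)
Lemma cintegral_exchange (F : R -> R -> R[i]) (h : R -> R) :
  measurable_fun setT (fun z : R2 => Re (F z.1 z.2)) ->
  measurable_fun setT (fun z : R2 => Im (F z.1 z.2)) ->
  (forall x, cintegrable setT (F x)) -> (forall u, cintegrable setT (F^~ u)) ->
  mu.-integrable setT (EFin \o h) ->
  (forall x, \int[mu]_u normc (F x u) <= h x) ->
  cintegral setT (fun x => cintegral setT (F x)) =
  cintegral setT (fun u => cintegral setT (F^~ u)).
Proof.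
move=> mRe mIm i1 i2 ih hF.
have le (p : R[i] -> R) x : (forall z, `|p z| <= normc z) ->
    mu.-integrable setT (EFin \o (fun u => p (F x u))) ->
    \int[mu]_u `|p (F x u)| <= h x.
  move=> hp ip; apply: le_trans (hF x); apply: le_Rintegral => //.
  - by rewrite (_ : _ \o _ = abse \o (EFin \o (fun u => p (F x u))))//; exact: integrable_abse.
  - exact: cintegrable_normc.
apply: eqC => /=; apply: (@Rintegral_exchange _ h) => // x.
- by have [] := i1 x.
- by have [] := i2 x.
- by apply: (le (@Re R)); [exact: Re_le_normc|have [] := i1 x].
- by have [] := i1 x.
- by have [] := i2 x.
- by apply: (le (@Im R)); [exact: Im_le_normc|have [] := i1 x].
Qed.

End Exchange.

(** * The Bessel function K *)

Section Bessel.
Context {R : realType}.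
Notation mu := (@lebesgue_measure R).
Implicit Types (t u Y b : R) (nu : R[i]).

Lemma cintegral_reflect (f : R -> R[i]) b : 0 <= b -> (forall x, ccont f x) ->
  cintegral `[- b, 0] f = cintegral `[0, b] (fun x => f (- x)).
Proof.
move=> b0 cf.
have [F hF] := @primitive_exists _ f (- b - 1) (fun x _ => cf x).
have nb : - b <= 0 by rewrite oppr_le0.
rewrite (@cintegral_FTC2 _ F f _ _ nb); last 2 first.
- by move=> x /andP[h _]; apply: hF; lra.
- by move=> x _; exact: cf.
have dN (x : R) : is_derive x 1 (-%R : R -> R) (- 1).
  exact: (is_deriveN (is_derive_id x 1)).
rewrite (@cintegral_FTC2 _ (fun x => - F (- x)) _ _ _ b0).
- by rewrite oppr0 opprK addrC.
- move=> x /andP[_ h].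
  have /(rdrv_comp)/(_ (dN x)) /rdrvN : rdrv F (- x) (f (- x)) by apply: hF; lra.
  by apply: rdrv_eq; rewrite rmorphN mulrN1 opprK.
- move=> x _; apply: ccont_comp; first exact: cf.
  exact: opp_continuous.
Qed.

Definition cosh t := (expR t + expR (- t)) / 2.
Definition bessel_kernel Y t := expR (- (Y * cosh t)).

Lemma coshN t : cosh (- t) = cosh t.
Proof. by rewrite /cosh opprK addrC. Qed.

Lemma cosh_norm t : cosh `|t| = cosh t.
Proof. by have [?|?] := ger0P t; rewrite ?coshN. Qed.

Lemma lt_cosh t u : 0 <= t -> t < u -> cosh t < cosh u.
Proof.
move=> t0 tu; rewrite /cosh ltr_pM2r ?invr_gt0//.
have -> : expR u + expR (- u) = expR t + expR (- t) +
    (expR u - expR t) * (1 - expR (- t) * expR (- u)).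
  have h1 : expR t * expR (- t) = 1 by rewrite -expRD subrr expR0.
  have h2 : expR u * expR (- u) = 1 by rewrite -expRD subrr expR0.
  transitivity (expR u + expR (- u) + (expR t * expR (- t) - 1) * expR (- u)
     - (expR u * expR (- u) - 1) * expR (- t)); last by ring.
  by rewrite h1 h2 subrr !mul0r addr0 subr0.
rewrite ltrDl mulr_gt0// subr_gt0 ?ltr_expR//.
by rewrite -expRD -expR0 ltr_expR; lra.
Qed.

Lemma cosh_quadratic t : t ^+ 2 / 8 <= cosh t.
Proof.
rewrite -cosh_norm -[t ^+ 2]real_normK ?num_real//.
have := expR_quadratic (normr_ge0 t); have := expR_ge0 (- `|t|).
by rewrite /cosh; lra.
Qed.

Let continuous_cosh : continuous cosh.
Proof.
move=> x; apply: (@continuousM R R (fun t => expR t + expR (- t))); last exact: cst_continuous.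
apply: continuousD; first exact: continuous_expR.
apply: continuous_expR_comp; exact: opp_continuous.
Qed.

Lemma ccont_bessel_kernel Y t : ccont (fun t => (bessel_kernel Y t)%:C) t.
Proof.
apply: ccont_real; apply: (@continuous_expR_comp _ (fun t => - (Y * cosh t))).
apply: continuousN; apply: continuousM; first exact: cst_continuous.
exact: continuous_cosh.
Qed.

Definition bessel_integrand nu Y t := cexp (nu * t%:C) * (bessel_kernel Y t)%:C.

Lemma ccont_bessel_integrand nu Y t : ccont (bessel_integrand nu Y) t.
Proof. by apply: ccontM; [exact: ccont_cexp_mul|exact: ccont_bessel_kernel]. Qed.

Lemma cintegrable_bessel nu Y : 0 < Y -> cintegrable setT (bessel_integrand nu Y).
Proof.
move=> Y0; have Y8 : 0 < Y / 8 by rewrite divr_gt0.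
have [C hC] := gaussian_bound Y8 (Re nu).
apply: (@cintegrable_le _ _ _ (fun t => C * lorentz t)) => //.
- by apply: mfunC_cont => // t; exact: ccont_bessel_integrand.
- by apply: integrableZ_real => //; exact: integrable_lorentz.
move=> t _; rewrite normcM normc_cexp ReMC normc_real ger0_norm ?expR_ge0//.
apply: le_trans (hC t); rewrite ler_wpM2l ?expR_ge0// ler_expR lerN2.
by have := ler_wpM2l (ltW Y0) (cosh_quadratic t); lra.
Qed.

(** K is half the integral over the whole line, in which the two exponentials of
    the definition become one *)
Lemma cintegral_bessel nu Y : 0 < Y ->
  cintegral setT (bessel_integrand nu Y) = 2 * besselK nu Y.
Proof.
move=> Y0; have i1 := cintegrable_bessel nu Y0; have i2 := cintegrable_bessel (- nu) Y0.
pose f : R -> R[i] := bessel_integrand nu Y.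
pose g : R -> R[i] := fun t => f t + f (- t).
have cf t : ccont f t by exact: ccont_bessel_integrand.
have cfN t : ccont (fun t => f (- t)) t.
  by apply: ccont_comp; [exact: cf|exact: opp_continuous].
have fN t : f (- t) = bessel_integrand (- nu) Y t.
  by rewrite /f /bessel_integrand /bessel_kernel coshN rmorphN mulrN mulNr.
have ig : cintegrable setT g.
  have -> : g = fun t => f t + bessel_integrand (- nu) Y t.
    by apply/funext => t; rewrite /g fN.
  exact: cintegrableD measurableT i1 i2.
have mH : measurable (`[0, +oo[%classic : set R) by exact: measurable_itv.
have igH : cintegrable `[0, +oo[ g by exact: cintegrableS ig.
have two0 : (2 : R[i]) != 0 by rewrite pnatr_eq0.
have -> : 2 * besselK nu Y = cintegral `[0, +oo[ g.
  rewrite -[RHS](mulVKf two0) -(cintegralZ _ mH igH); congr (_ * _).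
  apply: eq_cintegral => t _; rewrite /g fN /f /bessel_integrand /bessel_kernel /cosh mulNr.
  by field.
apply: (ccvg_uniq (cvg_cintegral_exhaustT i1 (@near_natNn R))).
have C2 : ccvg (fun n => cintegral `[0, n%:R] g) (cintegral `[0, +oo[ g).
  apply: cvg_cintegral_exhaust => //.
  - by move=> n x /=; rewrite !in_itv /= andbT => /andP[].
  - move=> x /=; rewrite in_itv /= andbT => x0.
    by apply: filterS (near_natl x) => n xn; rewrite /= in_itv /= x0.
apply: (ccvg_ext C2) => n; have n0 : 0 <= n%:R :> R by [].
rewrite (@cintegral_split _ f (- n%:R) 0 n%:R) ?oppr_le0//.
have mI : measurable (`[0, n%:R]%classic : set R) by exact: measurable_itv.
have if1 : cintegrable `[0, n%:R] f by apply: ccont_cintegrable => x _; exact: cf.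
have if2 : cintegrable `[0, n%:R] (fun t => f (- t)).
  by apply: ccont_cintegrable => x _; exact: cfN.
rewrite (cintegral_reflect n0 cf) addrC.
exact: (cintegralD mI if1 if2).
Qed.

(** As Y grows the mass of the kernel concentrates at 0, where the exponential
    factor is close to 1.  The kernel is compared with its value at Y = 1 for
    |t| > d and bounded below for |t| <= d / 2. *)
Lemma besselK_neq0 nu : exists2 Y, 0 < Y & besselK nu Y != 0.
Proof.
have [d d0 hd] : exists2 d : R, 0 < d & forall t, `|t| <= d -> normc (cexp (nu * t%:C) - 1) <= 4^-1.
  have /ccontP/(_ 4^-1) [|d d0 hd] := ccont_cexp_mul nu 0; first by rewrite invr_gt0.
  exists (d / 2) => [|t td]; first by rewrite divr_gt0.
  apply: ltW; have := hd t; rewrite mulr0 cexp0; apply; rewrite subr0.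
  by apply: le_lt_trans td _; rewrite ltr_pdivrMr//; lra.
pose d' := d / 2; have d'0 : 0 < d' by rewrite divr_gt0.
have d'd : d' < d by rewrite /d'; lra.
pose h t := normc ((cexp (nu * t%:C) - 1) * (bessel_kernel 1 t)%:C).
have i1 : cintegrable setT (fun t => (cexp (nu * t%:C) - 1) * (bessel_kernel 1 t)%:C).
  have h1 := cintegrable_bessel nu (@ltr01 R); have h2 := cintegrable_bessel 0 (@ltr01 R).
  rewrite (_ : (fun t => _) = (fun t => bessel_integrand nu 1 t + - bessel_integrand 0 1 t)).
    by apply: cintegrableD => //; exact: cintegrableN.
  by apply/funext => t; rewrite mulrBl /bessel_integrand mul0r cexp0.
have ih : mu.-integrable setT (EFin \o h) by exact: cintegrable_normc.
pose C := \int[mu]_t h t.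
pose eta := cosh d - cosh d'.
have eta0 : 0 < eta by rewrite subr_gt0 lt_cosh// ltW.
have C0 : 0 <= C by apply: Rintegral_ge0 => t _; exact: normc_ge0.
(* so that d' (1 + Q) eta exceeds C exp(cosh d) *)
pose Q := C * expR (cosh d) / (d' * eta).
have Q0 : 0 <= Q by rewrite /Q divr_ge0 ?mulr_ge0 ?expR_ge0// ltW.
exists (1 + Q) => [|]; first by lra.
set Y := 1 + Q; have Y0 : 0 < Y by rewrite /Y; lra.
apply/negP => /eqP K0.
have := cintegral_bessel nu Y0; rewrite K0 mulr0 => I0.
have iw := cintegrable_bessel 0 Y0.
pose w := bessel_kernel Y.
have wE : bessel_integrand 0 Y = fun t => (w t)%:C.
  by apply/funext => t; rewrite /bessel_integrand mul0r cexp0 mul1r.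
have iwr : mu.-integrable setT (EFin \o w) by rewrite wE in iw; case: iw.
have w0 t : 0 <= w t by exact: expR_ge0.
pose W := \int[mu]_t w t.
pose E := expR (- (Q * cosh d)).
have Wle : W <= 4^-1 * W + E * C.
  have -> : 4^-1 * W + E * C = \int[mu]_t (4^-1 * w t + E * h t).
    rewrite RintegralD//; [|exact: integrableZ_real..].
    by rewrite !RintegralZl.
  have -> : W = normc (cintegral setT (fun t => bessel_integrand nu Y t - bessel_integrand 0 Y t)).
    rewrite cintegralB//; last exact: cintegrable_bessel.
    by rewrite I0 sub0r wE cintegral_real normcN normc_real ger0_norm// Rintegral_ge0.
  apply: normc_cintegral_le => //.
  - apply: mfunC_cont => // t; apply: ccontD; first exact: ccont_bessel_integrand.
    by apply: ccontN; exact: ccont_bessel_integrand.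
  - by apply: integrableD_real => //; exact: integrableZ_real.
  move=> t _; rewrite wE /bessel_integrand -/w -[X in _ - X]mul1r -mulrBl normcM normc_real ger0_norm//.
  have [td|dt] := leP `|t| d.
    apply: ler_wpDr; first by rewrite mulr_ge0 ?expR_ge0 ?normc_ge0.
    by rewrite ler_wpM2r// hd.
  apply: ler_wpDl; first by rewrite mulr_ge0// invr_ge0.
  rewrite /h normcM normc_real ger0_norm ?expR_ge0// mulrCA ler_wpM2l ?normc_ge0//.
  rewrite /w /bessel_kernel /E -expRD ler_expR /Y mulrDl opprD addrC lerD2r lerN2.
  by rewrite ler_wpM2l// -[cosh t]cosh_norm ltW// lt_cosh// ltW.
have Wge : 2 * d' * expR (- (Y * cosh d')) <= W.
  have -> : 2 * d' * expR (- (Y * cosh d')) =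
      \int[mu]_(t in `[- d', d']) (expR (- (Y * cosh d'))).
    by rewrite Rintegral_itv_cst; [ring|lra].
  apply: (@le_trans _ _ (\int[mu]_(t in `[- d', d']) w t)).
    apply: le_Rintegral => //.
    - exact: integrable_itv_cst.
    - exact: integrableS iwr.
    - move=> t /=; rewrite in_itv /= => td; rewrite ler_expR lerN2.
      apply: ler_wpM2l; first exact: ltW.
      rewrite -[cosh t]cosh_norm.
      have : `|t| <= d' by rewrite ler_norml.
      by case: (ltgtP `|t| d') => // [/(lt_cosh (normr_ge0 t))/ltW|->].
  rewrite /W /Rintegral fine_le//.
  - by apply: integrable_fin_num => //; exact: integrableS iwr.
  - exact: integrable_fin_num.
  - apply: ge0_subset_integral => //; first by have /measurable_int := iwr.
    by move=> t _; rewrite lee_fin.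
have : d' * (Y * eta) * expR (- (Y * cosh d')) <= d' * Q * eta * expR (- (Y * cosh d')).
  have -> : d' * Q * eta = C * expR (cosh d).
    by rewrite /Q; field; rewrite !gt_eqF.
  set X := expR (- (Y * cosh d')); have X0 : 0 < X by exact: expR_gt0.
  have EX : E * expR (Y * eta) = expR (cosh d) * X.
    by rewrite /E /X -!expRD; congr expR; rewrite /Y /eta; ring.
  have dX : d' * X <= E * C.
    have := mulr_gt0 d'0 X0; have : 0 <= E * C by rewrite mulr_ge0 ?expR_ge0.
    by move: Wge Wle; rewrite -/X -mulrA; lra.
  have -> : C * expR (cosh d) * X = E * C * expR (Y * eta).
    by rewrite -mulrA -EX; ring.
  apply: (@le_trans _ _ (d' * X * expR (Y * eta))).
    rewrite mulrAC ler_wpM2l// ?mulr_ge0// ?ltW//.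
    by have := expR_ge1Dx (Y * eta); lra.
  by rewrite ler_wpM2r ?expR_ge0.
rewrite ler_pM2r ?expR_gt0// mulrA ler_pM2r// ler_pM2l//.
by rewrite /Y; lra.
Qed.

End Bessel.

Section FourierBessel.
Context {R : realType}.
Notation mu := (@lebesgue_measure R).
Variables (s : R[i]) (y : R) (s_gt1 : 1 < Re s) (y_gt0 : 0 < y).

Let A_gt0 (x : R) : 0 < x ^+ 2 + y ^+ 2.
Proof. by rewrite ltr_wpDl ?sqr_ge0// exprn_gt0. Qed.

Lemma quadratic_power_bound : exists2 C, 0 < C &
  forall x, normc (cpow (x ^+ 2 + y ^+ 2) (- s)) <= C * lorentz x.
Proof.
pose c := Num.min 1 (y ^+ 2); have c0 : 0 < c by rewrite lt_min ltr01 exprn_gt0.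
exists (expR (- (Re s * ln c))) => [|x]; first exact: expR_gt0.
have x1 : 1 <= 1 + x ^+ 2 by rewrite lerDl sqr_ge0.
have x0 : 0 < 1 + x ^+ 2 by rewrite (lt_le_trans ltr01).
have -> : lorentz x = expR (- ln (1 + x ^+ 2)) by rewrite expRN lnK.
rewrite normc_cpow raddfN mulNr -expRD ler_expR -opprD lerN2.
have l1 : ln (c * (1 + x ^+ 2)) <= ln (x ^+ 2 + y ^+ 2).
  rewrite ler_ln ?posrE ?mulr_gt0//.
  have c1 : c <= 1 by rewrite ge_min lexx.
  have cy : c <= y ^+ 2 by rewrite ge_min lexx orbT.
  by have := sqr_ge0 x; nra.
have l2 : 0 <= ln (1 + x ^+ 2) by exact: ln_ge0.
rewrite lnM ?posrE// in l1.
have := ler_wpM2l (ltW (lt_trans ltr01 s_gt1)) l1.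
have := ler_wpM2r l2 (ltW s_gt1).
by rewrite mul1r mulrDr; lra.
Qed.

Let continuous_quadratic x : {for x, continuous (fun x : R => x ^+ 2 + y ^+ 2)}.
Proof. by apply: continuousD; [exact: exprn_continuous|exact: cst_continuous]. Qed.

Lemma ccont_quadratic_power x : ccont (fun x => cpow (x ^+ 2 + y ^+ 2) (- s)) x.
Proof.
apply: (@ccont_comp _ (fun t => cpow t (- s)) (fun x => x ^+ 2 + y ^+ 2)).
  exact: rdrv_ccont (rdrv_cpow _ (A_gt0 x)).
exact: continuous_quadratic.
Qed.

Variables (xi : R) (xi_gt0 : 0 < xi).

Let ccont_freq x : ccont (fun x => cis (- (2 * pi * xi * x))) x.
Proof.
apply: ccont_comp; first exact: ccont_cis.
by apply: continuousN; apply: continuousM; first exact: cst_continuous.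
Qed.

Let F (x u : R) : R[i] :=
  (cexp (s * u%:C) * (expR (- ((x ^+ 2 + y ^+ 2) * expR u)))%:C) * cis (- (2 * pi * xi * x)).

Let s_gt0 : 0 < Re s. Proof. exact: lt_trans s_gt1. Qed.

Let iF1 x : cintegrable setT (F x).
Proof.
have [h _] := gamma_scaling (A_gt0 x) s_gt0.
rewrite /F; under eq_fun do rewrite mulrC.
exact: cintegrableZ.
Qed.

Let G (u : R) : R[i] := cexp (s * u%:C) * (expR (- (y ^+ 2 * expR u)))%:C.

Let FE x u : F x u = G u * (cis (- (2 * pi * xi * x)) * (expR (- (expR u * x ^+ 2)))%:C).
Proof.
rewrite /F /G mulrDl opprD expRD rmorphM [expR u * _]mulrC; ring.
Qed.

Let igauss u :
  cintegrable setT (fun x => cis (- (2 * pi * xi * x)) * (expR (- (expR u * x ^+ 2)))%:C).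
Proof.
have [C hC] := gaussian_bound (expR_gt0 u) 0.
apply: (@cintegrable_le _ _ _ (fun x => C * lorentz x)) => //.
- apply: mfunC_cont => // x; apply: ccontM; first exact: ccont_freq.
  apply: ccont_real; apply: (@continuous_expR_comp _ (fun x => - (expR u * x ^+ 2))).
  apply: continuousN; apply: continuousM; first exact: cst_continuous.
  exact: exprn_continuous.
- by apply: integrableZ_real => //; exact: integrable_lorentz.
move=> x _; rewrite normcM normc_cis mul1r normc_real ger0_norm ?expR_ge0//.
by have := hC x; rewrite mul0r expR0 mul1r.
Qed.

Let FuE u : F^~ u =
  fun x => G u * (cis (- (2 * pi * xi * x)) * (expR (- (expR u * x ^+ 2)))%:C).
Proof. by apply/funext => x; exact: FE. Qed.

Let iF2 u : cintegrable setT (F^~ u).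
Proof. by rewrite FuE; exact: cintegrableZ (igauss u). Qed.

Let measurable_F (p : R[i] -> R) : (p = @Re R) \/ (p = @Im R) ->
  measurable_fun setT (fun z : measurableTypeR R * measurableTypeR R => p (F z.1 z.2)).
Proof.
have [mA1 mA2] : mfunC setT (fun u : R => cexp (s * u%:C)).
  by apply: mfunC_cont => // u; exact: ccont_cexp_mul.
have [mB1 mB2] : mfunC setT (fun x : R => cis (- (2 * pi * xi * x))).
  by apply: mfunC_cont => // x; exact: ccont_freq.
have m1 (g : R -> R) : measurable_fun setT g ->
    measurable_fun setT (fun z : measurableTypeR R * measurableTypeR R => g z.1).
  by move=> mg; apply: (@measurableT_comp _ _ _ _ _ _ g).
have m2 (g : R -> R) : measurable_fun setT g ->
    measurable_fun setT (fun z : measurableTypeR R * measurableTypeR R => g z.2).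
  by move=> mg; apply: (@measurableT_comp _ _ _ _ _ _ g).
have mE : measurable_fun setT (fun z : measurableTypeR R * measurableTypeR R =>
    expR (- ((z.1 ^+ 2 + y ^+ 2) * expR z.2))).
  apply: (@measurableT_comp _ _ _ _ _ _ expR); first exact: measurable_expR.
  apply: (@measurableT_comp _ _ _ _ _ _ (-%R : R -> R)) => //.
  apply: measurable_funM; last by apply: m2; exact: measurable_expR.
  apply: (m1 (fun x : R => x ^+ 2 + y ^+ 2)).
  have cq : continuous (fun x : R => x ^+ 2 + y ^+ 2).
    by move=> x; exact: continuous_quadratic.
  exact: continuous_measurable_fun cq.
have [n1 n2] := (m1 _ mB1, m1 _ mB2); have [n3 n4] := (m2 _ mA1, m2 _ mA2).
case=> ->; rewrite /F.
  under eq_fun do rewrite ReM ReMC ImMC.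
  by apply: measurable_funB; apply: measurable_funM => //; exact: measurable_funM.
under eq_fun do rewrite ImM ReMC ImMC.
by apply: measurable_funD; apply: measurable_funM => //; exact: measurable_funM.
Qed.

Let inner u : cintegral setT (F^~ u) =
  (Num.sqrt pi)%:C * (cpow (pi * xi / y) (s - 2^-1) *
    bessel_integrand (s - 2^-1) (2 * pi * xi * y) (u + - ln (pi * xi / y))).
Proof.
have B0 : 0 < pi * xi / y by rewrite divr_gt0 ?mulr_gt0 ?pi_gt0.
rewrite FuE (cintegralZ _ measurableT (igauss u)).
rewrite gaussian_fourier ?expR_gt0// /G /bessel_integrand /bessel_kernel.
have -> : 2 * pi * xi * y * cosh (u + - ln (pi * xi / y)) =
    y ^+ 2 * expR u + pi ^+ 2 * xi ^+ 2 / expR u.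
  rewrite /cosh opprD opprK !expRD !expRN lnK//.
  have := pi_gt0 R; have := expR_gt0 u; move: (expR u) (pi : R) => E P E0 P0.
  by field; rewrite !gt_eqF.
have -> : Num.sqrt (pi / expR u) = Num.sqrt pi * expR (- (u / 2)).
  rewrite sqrtrM ?pi_ge0// -expRN; congr (_ * _).
  have -> : expR (- u) = expR (- (u / 2)) ^+ 2.
    by rewrite expr2 -expRD; congr expR; lra.
  by rewrite sqrtr_sqr ger0_norm ?expR_ge0.
have -> : cexp ((s - 2^-1) * (u + - ln (pi * xi / y))%:C) =
    cexp (s * u%:C) * (expR (- (u / 2)))%:C / cpow (pi * xi / y) (s - 2^-1).
  rewrite -cexp_real -cpowN /cpow -!cexpD; congr cexp.
  by rewrite !rmorphD !rmorphN rmorphM fmorphV rmorph_nat; ring.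
rewrite opprD expRD !rmorphM.
have := cpow_neq0 (pi * xi / y) (s - 2^-1); move: (cpow _ _) => P P0.
by field.
Qed.

(** The power is written as a Gamma integral of Gaussians; exchanging the
    integrals leaves the bilateral integral of K *)
Lemma fourier_bessel :
  Gamma s * cintegral setT (fun x => cpow (x ^+ 2 + y ^+ 2) (- s) * cis (- (2 * pi * xi * x))) =
  (Num.sqrt pi)%:C * cpow (pi * xi / y) (s - 2^-1) *
    (2 * besselK (s - 2^-1) (2 * pi * xi * y)).
Proof.
pose nu := s - 2^-1; pose Y := 2 * pi * xi * y; pose c := - ln (pi * xi / y).
have Y0 : 0 < Y by rewrite /Y !mulr_gt0 ?pi_gt0.
have [C C0 hC] := quadratic_power_bound.
have ib0 := cintegrable_bessel nu Y0.
have cb := @ccont_bessel_integrand _ nu Y.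
have [] := cintegral_affine c ltr01 cb ib0.
under eq_fun do rewrite mul1r.
move=> ib _; rewrite -/nu -/Y -(cintegral_bessel nu Y0) -(cintegral_shift c cb ib0).
rewrite -(cintegralZ _ measurableT ib).
have -> : cintegral setT (fun u => (Num.sqrt pi)%:C * cpow (pi * xi / y) nu *
    bessel_integrand nu Y (u + c)) = cintegral setT (fun u => cintegral setT (F^~ u)).
  by apply: eq_cintegral => u _; apply: etrans (esym (inner u)); exact: esym (mulrA _ _ _).
rewrite -(@cintegral_exchange _ F (fun x => normc (Gamma (Re s)%:C) * (C * lorentz x))) //.
- have it : cintegrable setT
      (fun x => cpow (x ^+ 2 + y ^+ 2) (- s) * cis (- (2 * pi * xi * x))).
    apply: (@cintegrable_le _ _ _ (fun x => C * lorentz x)) => //.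
    + apply: mfunC_cont => // x; apply: ccontM; last exact: ccont_freq.
      exact: ccont_quadratic_power.
    + by apply: integrableZ_real => //; exact: integrable_lorentz.
    + by move=> x _; rewrite normcM normc_cis mulr1.
  rewrite -(cintegralZ _ measurableT it); apply: eq_cintegral => x _.
  have [h E] := gamma_scaling (A_gt0 x) s_gt0.
  rewrite mulrA -E mulrC -(cintegralZ _ measurableT h).
  by apply: eq_cintegral => u _; rewrite mulrC.
- by apply: measurable_F; left.
- by apply: measurable_F; right.
- by apply: integrableZ_real => //; apply: integrableZ_real => //; exact: integrable_lorentz.
move=> x; apply: le_trans (ler_wpM2l (normc_ge0 _) (hC x)).
have s0' : 0 < Re (Re s)%:C by rewrite ReC.
have [_ E] := gamma_scaling (A_gt0 x) s0'.
rewrite normc_cpow raddfN -[X in - X * _](ReC (Re s)) -raddfN -normc_cpow -normcM -E.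
rewrite (@eq_cintegral _ _ (fun u => (normc (F x u))%:C)); last first.
  move=> u _; rewrite /F !normcM normc_cexp normc_cis mulr1 ReMC normc_real ger0_norm ?expR_ge0//.
  by rewrite -rmorphM cexp_real -rmorphM.
by rewrite cintegral_real normc_real ler_norm.
Qed.

End FourierBessel.

(** * Ramanujan sums and their Dirichlet series *)

Section RamanujanSums.
Context {R : realType}.
Implicit Types (m k q r : nat).

Lemma cisD (x y : R) : cis (x + y) = cis x * cis y.
Proof. by rewrite /cis -cexpD; congr cexp; apply: eqC; rewrite ?ReD ?ImD /= ?addr0. Qed.

Lemma cisMn (x : R) n : cis (n%:R * x) = cis x ^+ n.
Proof.
elim: n => [|n IH]; first by rewrite mul0r cis0 expr0.
by rewrite -natr1 mulrDl mul1r cisD IH exprSr.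
Qed.

Lemma cis_neq1 (x : R) : 0 < x < 2 * pi -> cis x != 1.
Proof.
move=> /andP[x0 xpi]; apply/negP => /eqP /(congr1 (@Re R)) /=.
rewrite expR0 mul1r; have -> : x = (x / 2) *+ 2 by rewrite mulr2n -splitr.
rewrite cos_mulr2n => h.
have : sin (x / 2) ^+ 2 = 0 by rewrite sin2cos2; move: h; rewrite mulr2n; lra.
move/eqP; rewrite expf_eq0 /= gt_eqF// sin_gt0_pi//.
by apply/andP; split; lra.
Qed.

Definition rational_phase m r q : R[i] := cis (2 * pi * (m%:R * r%:R / q%:R)).

Definition ramanujan_sum m q : R[i] := \sum_(r < q | coprime r q) rational_phase m r q.

Let sum_rational_phase m k : (0 < k)%N ->
  \sum_(r < k) rational_phase m r k = if (k %| m)%N then k%:R else 0.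
Proof.
move=> k0; have kR : k%:R != 0 :> R by rewrite pnatr_eq0 -lt0n.
pose z : R[i] := cis (2 * pi * (m%:R / k%:R)).
have zE r : rational_phase m r k = z ^+ r.
  by rewrite /rational_phase /z -cisMn; congr cis; field.
have cis_nat n : cis (n%:R * (2 * pi)) = 1 :> R[i] by rewrite cisMn cis_2pi expr1n.
under eq_bigr => r _ do rewrite zE.
case: ifP => [/dvdnP[c mE]|km].
  have -> : z = 1.
    by rewrite /z -(cis_nat c); congr cis; rewrite mE natrM; field.
  by under eq_bigr do rewrite expr1n; rewrite sumr_const card_ord.
have z1 : z != 1.
  have -> : z = cis (2 * pi * ((m %% k)%:R / k%:R)).
    have E : m%:R / k%:R = (m %/ k)%:R + (m %% k)%:R / k%:R :> R.
      by rewrite {1}(divn_eq m k) natrD natrM; field.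
    rewrite /z E mulrDr cisD.
    by rewrite [2 * pi * _]mulrC cis_nat mul1r.
  apply: cis_neq1; have m0 : (0 < m %% k)%N by rewrite lt0n -/(dvdn k m) km.
  have p0 := pi_gt0 R; apply/andP; split; first by rewrite !mulr_gt0 ?invr_gt0 ?ltr0n.
  by rewrite gtr_pMr ?mulr_gt0// ltr_pdivrMr ?ltr0n// mul1r ltr_nat ltn_pmod.
have zk : z ^+ k = 1.
  by rewrite /z -cisMn -(cis_nat m); congr cis; field.
have := subrX1 z k; rewrite zk subrr => /esym/eqP.
by rewrite mulf_eq0 subr_eq0 (negbTE z1) => /eqP.
Qed.

(** A fraction r / k has a unique reduced form r' / q with q dividing k, so the sum
    is that of all the k-th roots of unity to the power m *)
Lemma ramanujan_sum_divisors m k : (0 < k)%N ->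
  \sum_(1 <= q < k.+1 | (q %| k)%N) ramanujan_sum m q = if (k %| m)%N then k%:R else 0.
Proof.
move=> k0; rewrite -sum_rational_phase//.
have kd r : (k %/ gcdn r k %| k)%N by apply/dvdnP; exists (gcdn r k); rewrite mulnC divnK ?dvdn_gcdr.
pose den (r : 'I_k) : 'I_k.+1 := inord (k %/ gcdn r k).
have denE (r : 'I_k) : den r = (k %/ gcdn r k)%N :> nat by rewrite inordK// ltnS leq_div.
rewrite (partition_big den (fun q : 'I_k.+1 => q %| k)%N) /=; last by move=> r _; rewrite denE.
have -> : \sum_(1 <= q < k.+1 | (q %| k)%N) ramanujan_sum m q =
    \sum_(q < k.+1 | (q %| k)%N) ramanujan_sum m q.
  rewrite -(big_mkord (fun q => q %| k)%N) [RHS]big_mkcond big_ltn//= dvd0n.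
  by rewrite (gtn_eqF k0) add0r -big_mkcond.
apply: eq_bigr => -[q qk1] /= qk.
have q0 : (0 < q)%N by exact: dvdn_gt0 qk.
have c0 : (0 < k %/ q)%N by rewrite divn_gt0// dvdn_leq.
have kE : (k %/ q * q = k)%N by rewrite divnK.
have hr (r : 'I_q) : (k %/ q * r < k)%N by rewrite -[X in (_ < X)%N]kE ltn_pmul2l.
have hr' (r : 'I_k) : (r %/ (k %/ q) < q)%N by rewrite ltn_divLR// mulnC kE.
rewrite (reindex_onto (fun r : 'I_q => Ordinal (hr r)) (fun r : 'I_k => Ordinal (hr' r))) /=.
  apply: eq_big => [r|r _]; last first.
    rewrite /rational_phase; congr cis; congr (_ * _).
    have -> : k%:R = (k %/ q)%:R * q%:R :> R by rewrite -natrM kE.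
    rewrite natrM.
    by field; rewrite !pnatr_eq0 -!lt0n q0 c0.
  have -> : Ordinal (hr' (Ordinal (hr r))) = r by apply: val_inj; rewrite /= mulKn.
  rewrite eqxx andbT -val_eqE /= denE /= -[X in (X %/ _)%N]kE -[X in gcdn _ X]kE -muln_gcdr.
  rewrite divnMl// eq_sym eqn_div ?gcdn_gt0 ?q0 ?orbT ?dvdn_gcdr//.
  rewrite -[X in _ == X]muln1 eqn_pmul2l//.
move=> r; rewrite -val_eqE /= denE /= => /eqP E; apply: val_inj => /=.
rewrite mulnC divnK// -E divnA ?dvdn_gcdr//.
by rewrite mulKn ?dvdn_gcdl.
Qed.

End RamanujanSums.

Section SumsOverMultiples.
Implicit Types (n v p e k : nat).

Lemma sum_multiples (V : nmodType) v n (F : nat -> V) : (0 < v)%N ->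
  \sum_(1 <= k < n.+1 | (v %| k)%N) F k = \sum_(1 <= k < (n %/ v).+1) F (v * k)%N.
Proof.
move=> v0; elim: n => [|n IH]; first by rewrite div0n !big_geq.
rewrite big_mkcond big_nat_recr//= -big_mkcond IH divnS//.
case: (boolP (v %| n.+1)%N) => [vn|_]; last by rewrite add0n addr0.
rewrite add1n [RHS]big_nat_recr//=; congr (_ + F _).
by rewrite -[in LHS](divnK vn) divnS// vn add1n mulnC.
Qed.

(** The k divisible by p are those of the form p k'.  This gives the Euler factor
    at p of zeta and of the divisor sum alike. *)
Lemma sum_coprime_split (V : nmodType) p e n (F : nat -> V) :
  prime p -> coprime p e ->
  \sum_(1 <= k < n.+1 | coprime k e) F k =
  \sum_(1 <= k < n.+1 | coprime k (e * p)) F k +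
  \sum_(1 <= k < (n %/ p).+1 | coprime k e) F (p * k)%N.
Proof.
move=> pp pe; rewrite (bigID (fun k => p %| k)%N) /= addrC; congr (_ + _).
  by apply: eq_bigl => k; rewrite coprimeMr; congr (_ && _); rewrite coprime_sym prime_coprime.
under eq_bigl do rewrite andbC.
rewrite big_mkcondr (sum_multiples _ (fun k => if coprime k e then F k else 0)) ?prime_gt0//.
by rewrite [RHS]big_mkcond; apply: eq_bigr => k _; rewrite coprimeMl pe.
Qed.

End SumsOverMultiples.

Section AbsolutelyConvergentSeries.
Context {R : realType}.
Implicit Types (u : nat -> R[i]) (b : nat -> R) (B : R) (P : pred nat).

Definition csum P u : R[i] := climit (fun n => \sum_(1 <= k < n.+1 | P k) u k).

Lemma ccvg_csum P u b B : (forall k, (0 < k)%N -> normc (u k) <= b k) ->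
  (forall n, \sum_(1 <= k < n.+1) b k <= B) ->
  ccvg (fun n => \sum_(1 <= k < n.+1 | P k) u k) (csum P u).
Proof.
move=> ub bB.
have [| |l hl] := @ccvg_abs_series _ (fun k => if P k.+1 then u k.+1 else 0) (fun k => b k.+1) B.
- move=> k; case: ifP => _; first exact: ub.
  by rewrite normc0; apply: le_trans (ub k.+1 isT); exact: normc_ge0.
- by move=> n; apply: le_trans (bB n); rewrite big_add1 big_mkord.
apply: (@ccvg_climit _ _ l); apply: (ccvg_ext hl) => n.
by rewrite [RHS]big_mkcond big_add1 big_mkord.
Qed.

Lemma normc_csum P u b B : (forall k, (0 < k)%N -> normc (u k) <= b k) ->
  (forall n, \sum_(1 <= k < n.+1) b k <= B) -> forall n,
  normc (\sum_(1 <= k < n.+1 | P k) u k) <= B.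
Proof.
move=> ub bB n; apply: le_trans (bB n); rewrite big_mkcond.
apply: le_trans (normc_sum _ _ _) _.
rewrite !big_nat; apply: ler_sum => k /andP[k0 _].
case: ifP => _; first exact: ub.
by rewrite normc0; apply: le_trans (ub k k0); exact: normc_ge0.
Qed.

Lemma ccvg_divn u l p : (0 < p)%N -> ccvg u l -> ccvg (fun n => u (n %/ p)%N) l.
Proof.
move=> p0 /ccvgP h; apply/ccvgP => e /h[N hN]; exists (N * p)%N => n Nn.
by apply: hN; rewrite leq_divRL.
Qed.

(** The tail of the majorant is small, and the remaining finitely many terms tend
    to 0 *)
Lemma tannery (u : nat -> nat -> R[i]) b B :
  (forall n k, (0 < k)%N -> normc (u n k) <= b k) ->
  (forall n, \sum_(1 <= k < n.+1) b k <= B) ->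
  (forall k, ccvg (fun n => u n k) 0) ->
  ccvg (fun n => \sum_(1 <= k < n.+1) u n k) 0.
Proof.
move=> ub bB hu; pose S n := \sum_(1 <= k < n.+1) b k.
have b0 k : (0 < k)%N -> 0 <= b k.
  by move=> k0; exact: le_trans (normc_ge0 _) (ub 0%N k k0).
have ndS : nondecreasing_seq S.
  by apply/nondecreasing_seqP => n; rewrite /S [leRHS]big_nat_recr//= lerDl b0.
have cS : cvgn S.
  by apply: nondecreasing_is_cvgn => //; exists B => _ [n _ <-]; exact: bB.
apply/ccvgP => e e0; have e2 : 0 < e / 2 by rewrite divr_gt0.
have /cvgrPdist_lt /(_ _ e2)[N _ hN] : S @ \oo --> limn S by [].
have SN : limn S - S N < e / 2 by apply: le_lt_trans (hN N (leqnn N)); exact: ler_norm.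
have hfin : ccvg (fun n => \sum_(1 <= k < N.+1) u n k) 0.
  by have := @ccvg_sum _ _ (index_iota 1 N.+1) (fun k n => u n k) (fun=> 0) hu; rewrite big1.
have [N2 hN2] := (ccvgP _ _).1 hfin _ e2.
exists (maxn N N2) => n; rewrite geq_max => /andP[Nn N2n].
rewrite (@big_cat_nat _ _ _ N.+1) //= subr0.
have h1 := hN2 n N2n; rewrite subr0 in h1.
have h2 : normc (\sum_(N.+1 <= k < n.+1) u n k) <= S n - S N.
  rewrite /S [X in _ <= X - _](@big_cat_nat _ _ _ N.+1) //= addrAC subrr add0r.
  apply: le_trans (normc_sum _ _ _) _.
  by rewrite !big_nat; apply: ler_sum => k /andP[k0 _]; apply: ub; exact: leq_trans k0.
have h3 : S n <= limn S by exact: nondecreasing_cvgn_le.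
have := normcD (\sum_(1 <= k < N.+1) u n k) (\sum_(N.+1 <= k < n.+1) u n k); lra.
Qed.

End AbsolutelyConvergentSeries.

Section RamanujanSeries.
Context {R : realType}.
Variables (w : R[i]) (w_gt2 : 2 < Re w).
Implicit Types (m e v p q k n : nat).

Let t k : R[i] := cpow k%:R (- w).

Let normc_t k : normc (t k) = expR (- (Re w * ln k%:R)).
Proof. by rewrite normc_cpow raddfN mulNr. Qed.

Let tM k q : (0 < k)%N -> (0 < q)%N -> t (k * q) = t k * t q.
Proof. by move=> k0 q0; rewrite /t natrM cpowMl// ltr0n. Qed.

Definition ramanujan_term m q := ramanujan_sum m q * cpow q%:R (- w).
(** Only the moduli divisible by v and prime to e: those of the rows of
    determinant e when v = N / e *)
Definition ramanujan_series m e v :=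
  csum (fun q => (v %| q)%N && coprime q e) (ramanujan_term m).
(** The zeta function without the Euler factors at the primes dividing e *)
Definition coprime_zeta e := csum (fun k => coprime k e) t.

Definition ramanujan_bound q : R := expR (- ((Re w - 1) * ln q%:R)).

Lemma normc_ramanujan_sum m q : normc (ramanujan_sum m q : R[i]) <= q%:R.
Proof.
apply: le_trans (normc_sum _ _ _) _.
under eq_bigr do rewrite normc_cis.
by rewrite sumr_const ler_nat (leq_trans (max_card _))// card_ord.
Qed.

Let normc_term m q : (0 < q)%N -> normc (ramanujan_term m q) <= ramanujan_bound q.
Proof.
move=> q0; rewrite normcM normc_t /ramanujan_bound.
apply: (@le_trans _ _ (q%:R * expR (- (Re w * ln q%:R)))).
  by rewrite ler_wpM2r ?expR_ge0// normc_ramanujan_sum.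
rewrite -{1}[q%:R](@lnK R) ?posrE ?ltr0n// -expRD ler_expR; lra.
Qed.

Lemma ramanujan_bounded : exists B, forall n, \sum_(1 <= q < n.+1) ramanujan_bound q <= B.
Proof.
have w1 : 1 < Re w - 1 by have := w_gt2; lra.
by have [B hB] := riemann_bounded w1; exists B => n; rewrite big_add1 big_mkord.
Qed.

Let t_bound k : (0 < k)%N -> normc (t k) <= ramanujan_bound k.
Proof.
move=> k0; rewrite normc_t ler_expR lerN2 ler_wpM2r; [by []| |have := w_gt2; lra].
by apply: ln_ge0; rewrite ler1n.
Qed.

Lemma ccvg_ramanujan_series m e v :
  ccvg (fun n => \sum_(1 <= q < n.+1 | (v %| q)%N && coprime q e) ramanujan_term m q)
    (ramanujan_series m e v).
Proof. by have [B hB] := ramanujan_bounded; exact: ccvg_csum (@normc_term m) hB. Qed.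

Let Zn e n : R[i] := \sum_(1 <= k < n.+1 | coprime k e) t k.

Let ccvg_Z e : ccvg (Zn e) (coprime_zeta e).
Proof. by have [B hB] := ramanujan_bounded; exact: ccvg_csum t_bound hB. Qed.

Let zetaM p e : prime p -> coprime p e -> coprime_zeta (e * p) = (1 - t p) * coprime_zeta e.
Proof.
move=> pp pe; have p0 := prime_gt0 pp; apply: (ccvg_uniq (@ccvg_Z (e * p))).
rewrite mulrBl mul1r.
have C := ccvgB (@ccvg_Z e) (ccvgZ (c := t p) (ccvg_divn p0 (@ccvg_Z e))).
apply: (ccvg_ext C) => n.
rewrite /Zn (sum_coprime_split _ _ pp pe) -addrA -[RHS]addr0; congr (_ + _).
apply/eqP; rewrite subr_eq0 mulr_sumr; apply/eqP.
rewrite big_nat_cond [RHS]big_nat_cond; apply: eq_bigr => k /andP[/andP[k0 _] _].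
exact: tM.
Qed.

(** The divisor sum of k ^ (1 - w), restricted to the divisors prime to e *)
Let f k : R[i] := k%:R * t k.
Let sig m e : R[i] := \sum_(1 <= k < m.+1 | coprime k e && (k %| m)%N) f k.

Let sig_widen m e n : (0 < m)%N -> (m <= n)%N ->
  \sum_(1 <= k < n.+1 | coprime k e && (k %| m)%N) f k = sig m e.
Proof.
move=> m0 mn; rewrite /sig [RHS](@big_nat_widen _ _ _ 1 m.+1 n.+1)//.
apply: eq_bigl => k; rewrite -andbA; congr (_ && _).
case: (boolP (k %| m)%N) => // /(dvdn_leq m0); lia.
Qed.

(** Grouping the products of q and l by k = q l: the Ramanujan sums add up over the
    divisors of k to k or 0 *)
Let convolution m e n : \sum_(1 <= q < n.+1 | coprime q e) ramanujan_term m q * Zn e (n %/ q) =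
  \sum_(1 <= k < n.+1 | coprime k e && (k %| m)%N) f k.
Proof.
have -> : \sum_(1 <= k < n.+1 | coprime k e && (k %| m)%N) f k =
    \sum_(1 <= k < n.+1 | coprime k e) \sum_(1 <= q < n.+1 | (q %| k)%N) ramanujan_sum m q * t k.
  rewrite big_mkcondr big_nat_cond [RHS]big_nat_cond.
  apply: eq_bigr => k /andP[/andP[k0 kn] _].
  rewrite -mulr_suml; have -> : \sum_(1 <= q < n.+1 | (q %| k)%N) ramanujan_sum m q =
      \sum_(1 <= q < k.+1 | (q %| k)%N) ramanujan_sum m q :> R[i].
    rewrite [RHS](@big_nat_widen _ _ _ 1 k.+1 n.+1)//.
    by apply: eq_bigl => q; case: (boolP (q %| k)%N) => // /(dvdn_leq k0); lia.
  by rewrite ramanujan_sum_divisors//; case: ifP => _; rewrite ?mul0r.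
under [RHS]eq_bigr => k _ do rewrite big_mkcond.
rewrite exchange_big /= [LHS]big_mkcond; rewrite big_nat [RHS]big_nat; apply: eq_bigr => q /andP[q0 _].
rewrite -(@big_mkcondr _ _ _ _ _ _ (fun k => q %| k)%N).
under [RHS]eq_bigl do rewrite andbC.
rewrite big_mkcondr (sum_multiples _ (fun k => if coprime k e then ramanujan_sum m q * t k else 0))//.
under [RHS]eq_bigr do rewrite coprimeMl.
case: (boolP (coprime q e)) => qe; last by rewrite big1.
rewrite /Zn mulr_sumr -big_mkcond /=.
rewrite big_nat_cond [RHS]big_nat_cond; apply: eq_bigr => k /andP[/andP[k0 _] _].
by rewrite /ramanujan_term tM// mulrA.
Qed.

Let seriesZ m e : (0 < m)%N -> ramanujan_series m e 1 * coprime_zeta e = sig m e.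
Proof.
move=> m0; have [B hB] := ramanujan_bounded.
pose a : nat -> R[i] := ramanujan_term m.
(* the error of replacing each partial zeta sum by its limit *)
pose u n q : R[i] := if coprime q e then a q * (Zn e (n %/ q) - coprime_zeta e) else 0.
have cA := @ccvg_ramanujan_series m e 1.
have cu : ccvg (fun n => \sum_(1 <= q < n.+1) u n q) 0.
  have B0 : 0 <= B by apply: le_trans (hB 0%N); rewrite big_geq.
  apply: (@tannery _ _ (fun q => ramanujan_bound q * (B + B)) (B * (B + B))).
  - move=> n q q0; rewrite /u; case: ifP => _; last first.
      by rewrite normc0 mulr_ge0 ?expR_ge0 ?addr_ge0.
    rewrite normcM ler_pM ?normc_ge0//; first exact: normc_term.
    apply: le_trans (normcB _ _) (lerD _ _); first exact: normc_csum t_bound hB _.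
    by apply: ccvg_normc_le (@ccvg_Z e) _ => k; exact: normc_csum t_bound hB _.
  - by move=> n; rewrite -mulr_suml ler_wpM2r// addr_ge0.
  move=> q; rewrite /u; case: (coprime q e); last exact: ccvg_cst.
  have [q0|q0] := posnP q.
    apply: (@ccvg_ext _ (fun=> 0)); first exact: ccvg_cst.
    by move=> n; rewrite /a q0 /ramanujan_term /ramanujan_sum big_ord0 !mul0r.
  have C := ccvgZ (c := a q) (ccvgB (ccvg_divn q0 (@ccvg_Z e)) (@ccvg_cst _ (coprime_zeta e))).
  by rewrite subrr mulr0 in C; exact: C.
have := ccvgD cu (ccvgZ (c := coprime_zeta e) cA); rewrite add0r [_ * coprime_zeta e]mulrC => c1.
apply: (ccvg_uniq c1); apply/ccvgP => d d0; exists m => n mn.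
have -> : \sum_(1 <= q < n.+1) u n q +
    coprime_zeta e * (\sum_(1 <= q < n.+1 | (1 %| q)%N && coprime q e) ramanujan_term m q) = sig m e.
  rewrite -(sig_widen e m0 mn) -convolution mulr_sumr /u -big_mkcond /=.
  rewrite [X in _ + X](eq_bigl (fun q => coprime q e)); last by move=> q; rewrite dvd1n.
  rewrite -big_split /=.
  by apply: eq_bigr => q _; rewrite /a; ring.
by rewrite subrr normc0.
Qed.

Let f1 : f 1 = 1.
Proof. by rewrite /f /t cpow1 mulr1. Qed.

Let coprime_zeta_neq0 e : coprime_zeta e != 0.
Proof.
apply/eqP => z0; have := @seriesZ 1 e isT.
rewrite z0 mulr0 /sig big_mkcond big_nat1 coprime1n dvd1n /= f1 => /eqP.
by rewrite eq_sym oner_eq0.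
Qed.

Let fM k q : (0 < k)%N -> (0 < q)%N -> f (k * q) = f k * f q.
Proof. by move=> k0 q0; rewrite /f tM// natrM; ring. Qed.

(** Induction on the power of p in m: a divisor of m is prime to p, or p times a
    divisor of m / p *)
Let sigM p e m : prime p -> coprime p e -> (0 < m)%N ->
  sig m e = \sum_(j < (logn p m).+1) f p ^+ j * sig m (e * p).
Proof.
move=> pp pe; have p0 := prime_gt0 pp.
elim/ltn_ind: m => m IH m0.
have split : sig m e = sig m (e * p) +
    \sum_(1 <= k < (m %/ p).+1 | coprime k e) if (p * k %| m)%N then f (p * k) else 0.
  rewrite /sig big_mkcondr (sum_coprime_split _ (fun k => if (k %| m)%N then f k else 0) pp pe).
  by rewrite -big_mkcondr.
have [pm|pm] := boolP (p %| m)%N; last first.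
  rewrite split [X in _ + X]big1 ?addr0.
    rewrite lognE pp m0 (negbTE pm) /= big_ord_recl big_ord0 expr0 mul1r addr0 //.
  move=> k _; case: ifP => // /dvdnP[c mE]; case/negP: pm.
  by rewrite mE mulnCA dvdn_mulr.
case/dvdnP: pm => m'; rewrite mulnC => mE.
have m'0 : (0 < m')%N by move: m0; rewrite mE muln_gt0 => /andP[].
have m'm : (m' < m)%N by rewrite mE ltn_Pmull// prime_gt1.
have -> : logn p m = (logn p m').+1 by rewrite mE lognM// logn_prime// eqxx.
rewrite big_ord_recl expr0 mul1r split; congr (_ + _).
have sE : sig m (e * p) = sig m' (e * p).
  rewrite -(sig_widen (e * p) m'0 (ltnW m'm)) /sig; apply: eq_bigl => k.
  rewrite coprimeMr; case: (boolP (coprime k p)) => kp; last by rewrite andbF.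
  by rewrite mE Gauss_dvdr.
transitivity (f p * sig m' e).
  rewrite /sig mulr_sumr mE mulKn// -big_mkcondr big_nat_cond [RHS]big_nat_cond.
  apply: eq_big => [k|k /andP[/andP[k0 _] _]]; last by rewrite fM.
  by rewrite dvdn_pmul2l.
rewrite IH// mulr_sumr sE; apply: eq_bigr => j _.
by rewrite mulrA -exprS.
Qed.

Let normc_f p : (1 < p)%N -> normc (f p) < 1.
Proof.
move=> p1; have p0 : 0 < p%:R :> R by rewrite ltr0n ltnW.
rewrite normcM normc_nat normc_t -{1}[p%:R](@lnK R) ?posrE// -expRD.
have l0 : 0 < ln (p%:R : R) by apply: ln_gt0; rewrite ltr1n.
have w1 : 0 < Re w - 1 by have := w_gt2; lra.
rewrite -[X in _ < X]expR0 ltr_expR; have := mulr_gt0 w1 l0; lra.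
Qed.

Let normc_tp p : (1 < p)%N -> normc (t p) < 1.
Proof.
move=> p1; apply: le_lt_trans (normc_f p1); rewrite normcM normc_nat.
by rewrite ler_peMl ?normc_ge0// ler1n ltnW.
Qed.

Let FpE p m : prime p -> Fp p m w = (1 - t p) * \sum_(j < (logn p m).+1) f p ^+ j.
Proof.
move=> pp; rewrite /Fp /t cpowN; congr (_ * _); apply: eq_bigr => j _.
have -> : f p = cpow p%:R (1 - w).
  by rewrite /f cpowD cpow_1 ?ltr0n ?prime_gt0// natC.
by rewrite -cpowN /cpow -cexpMn; congr cexp; ring.
Qed.

Lemma Fp_neq0 p m : prime p -> Fp p m w != 0.
Proof.
move=> pp; have p1 := prime_gt1 pp; rewrite FpE// mulf_neq0//.
  by rewrite subr_eq0; apply/eqP => h; have := normc_tp p1; rewrite -h normc1 ltxx.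
apply/eqP => h; have := subrX1 (f p) (logn p m).+1; rewrite h mulr0 => /eqP.
rewrite subr_eq0 => /eqP /(congr1 (@normc R)); rewrite normcX normc1 => h1.
by have := exprn_ilt1 (logn p m).+1 (normc_ge0 (f p)) (normc_f p1); rewrite h1 ltxx.
Qed.

(** The Euler factor at p of the quotient of the divisor sum by zeta is F_p *)
Let series_coprimeM m e p : (0 < m)%N -> prime p -> coprime p e ->
  ramanujan_series m (e * p) 1 = ramanujan_series m e 1 * (Fp p m w)^-1.
Proof.
move=> m0 pp pe; apply: (mulIf (Fp_neq0 m pp)); rewrite mulfVK ?Fp_neq0//.
apply: (mulIf (coprime_zeta_neq0 e)); rewrite seriesZ// (sigM pp pe m0) FpE//.
rewrite -mulr_suml -(@seriesZ m (e * p))// zetaM//; ring.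
Qed.

(** The multiples of p are the moduli that are not prime to p *)
Let series_dvdM m e v p : prime p -> coprime p v ->
  ramanujan_series m e (v * p) = ramanujan_series m e v - ramanujan_series m (e * p) v.
Proof.
move=> pp pv; apply: (ccvg_uniq (@ccvg_ramanujan_series m e (v * p))).
have C := ccvgB (@ccvg_ramanujan_series m e v) (@ccvg_ramanujan_series m (e * p) v).
apply: (ccvg_ext C) => n; rewrite (bigID (fun q => p %| q)%N) /=.
have -> : \sum_(1 <= q < n.+1 | (v %| q)%N && coprime q (e * p)) ramanujan_term m q =
    \sum_(1 <= q < n.+1 | ((v %| q)%N && coprime q e) && ~~ (p %| q)%N) ramanujan_term m q.
  by apply: eq_bigl => q; rewrite coprimeMr -andbA [coprime q p]coprime_sym (prime_coprime _ pp).
rewrite addrK; apply: eq_bigl => q.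
by rewrite Gauss_dvd 1?coprime_sym// andbAC.
Qed.

Let coprime_prod p (l : seq nat) : prime p -> all prime l -> p \notin l ->
  coprime p (\prod_(q <- l) q)%N.
Proof.
move=> pp; elim: l => [|q l IH] /=; first by rewrite big_nil coprimen1.
move=> /andP[pq al]; rewrite inE negb_or => /andP[pnq pl].
by rewrite big_cons coprimeMr IH// andbT prime_coprime// dvdn_prime2.
Qed.

Let series_prod m (es vs : seq nat) : (0 < m)%N -> all prime (es ++ vs) -> uniq (es ++ vs) ->
  ramanujan_series m (\prod_(p <- es) p)%N (\prod_(p <- vs) p)%N =
  ramanujan_series m 1 1 * \prod_(p <- es) (Fp p m w)^-1 * \prod_(p <- vs) (1 - (Fp p m w)^-1).
Proof.
move=> m0; elim: vs es => [|p vs IH] es.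
  rewrite cats0 !big_nil mulr1; elim: es => [|p es IHe] /=; first by rewrite !big_nil mulr1.
  move=> /andP[pp pes] /andP[pnes ues]; rewrite !big_cons mulnC series_coprimeM ?coprime_prod//.
  by rewrite IHe//; ring.
have -> : es ++ p :: vs = (es ++ [:: p]) ++ vs by rewrite -catA.
have E : perm_eq ((es ++ [:: p]) ++ vs) (p :: es ++ vs) by rewrite perm_catAC perm_catC.
rewrite (perm_all _ E) (perm_uniq E) => al un.
have /andP[pp pev] : prime p && all prime (es ++ vs) by [].
have /andP[pnev uev] : (p \notin es ++ vs) && uniq (es ++ vs) by [].
have pv : p \notin vs by move: pnev; rewrite mem_cat negb_or => /andP[].
have av : all prime vs by move: pev; rewrite all_cat => /andP[].
have H := IH (p :: es) al un; rewrite !big_cons [(p * _)%N]mulnC in H.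
rewrite !big_cons [(p * _)%N]mulnC series_dvdM ?coprime_prod// H IH//.
ring.
Qed.

Lemma ramanujan_series_zeta m : (0 < m)%N ->
  ramanujan_series m 1 1 * zeta w = sigma (1 - w) m.
Proof.
move=> m0; have w1 : 1 < Re w by have := w_gt2; lra.
have -> : zeta w = coprime_zeta 1.
  rewrite zetaE//; apply: (ccvg_uniq (ccvg_dirichlet w1)).
  apply: (ccvg_ext (@ccvg_Z 1)) => n; rewrite /Zn /dirichlet_partial.
  by under eq_bigl do rewrite coprimen1; rewrite big_add1 big_mkord.
rewrite seriesZ// /sig /sigma.
under eq_bigl do rewrite coprimen1 andTb.
rewrite -big_filter (perm_big (divisors m)) /=; last first.
  apply: uniq_perm; [by rewrite filter_uniq ?iota_uniq|exact: divisors_uniq|].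
  move=> k; rewrite mem_filter mem_index_iota -dvdn_divisors//.
  case: (boolP (k %| m)%N) => // km; rewrite ltnS (dvdn_leq m0 km) andbT.
  exact: dvdn_gt0 km.
apply: eq_big_seq => k; rewrite -dvdn_divisors// => /(dvdn_gt0 m0) k0.
by rewrite /f /t cpowD cpow_1 ?ltr0n// natC.
Qed.

(** For m = 1 the divisor sum is 1 *)
Lemma zeta_neq0 : zeta w != 0.
Proof.
apply/eqP => z0; have := @ramanujan_series_zeta 1 isT.
rewrite z0 mulr0 /sigma => /esym/eqP.
by rewrite (_ : divisors 1 = [:: 1%N])// big_seq1 cpow1 oner_eq0.
Qed.

Let prod_primes N n : squarefree N -> (0 < N)%N -> (n %| N)%N -> (\prod_(p <- primes n) p = n)%N.
Proof.
move=> sfN N0 nN; have n0 : (0 < n)%N by exact: dvdn_gt0 nN.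
rewrite [RHS](prod_prime_decomp n0) big_map; apply: eq_big_seq => -[p k] /=.
move=> /mem_prime_decomp[pp k0 pkn].
have : (k < 2)%N.
  rewrite ltnNge; apply/negP => k2; case/negP: (sfN p pp).
  by apply: dvdn_trans nN; apply: dvdn_trans pkn; exact: dvdn_exp2l.
by case: k k0 {pkn} => [|[|]].
Qed.

(** Squarefreeness makes the primes of v and of N / v a partition of those of N;
    series_prod attaches F_p^-1 to the former and 1 - F_p^-1 to the latter. *)
Lemma ramanujan_series_DN N m s : (0 < N)%N -> squarefree N -> (0 < m)%N -> w = 2 * s ->
  \sum_(v <- divisors N) cpow v%:R (- s) * ramanujan_series m v (N %/ v) =
  ramanujan_series m 1 1 * DN N m s.
Proof.
move=> N0 sfN m0 wE; rewrite /DN mulr_sumr; apply: eq_big_seq => v.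
rewrite -dvdn_divisors// => vN; have v0 : (0 < v)%N by exact: dvdn_gt0 vN.
have uN : (N %/ v %| N)%N by rewrite dvdn_div.
rewrite -[X in ramanujan_series m X _](prod_primes sfN N0 vN).
rewrite -[X in ramanujan_series m _ X](prod_primes sfN N0 uN) series_prod//.
- by rewrite -wE; ring.
- by rewrite all_cat; apply/andP; split; apply/allP => p; rewrite mem_primes => /and3P[].
rewrite cat_uniq !primes_uniq andbT /=; apply/hasPn => p.
rewrite !mem_primes => /and3P[pp _ pu]; apply/negP => /and3P[_ _ pv].
by case/negP: (sfN p pp); rewrite -(divnK vN) expnS expn1 dvdn_mul.
Qed.

End RamanujanSeries.

(** * Unordered sums *)

Section UnorderedSums.
Context {R : realType} {I : choiceType}.
Implicit Types (f : I -> R[i]) (l : R[i]) (A B J : {fset I}).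

Local Existing Instance totally_filter.

Local Notation tcvg f l :=
  ((partial_sum (f : I -> R[i]^o) @ totally) --> (l : R[i]^o)).

Lemma partial_sumE (V : zmodType) (f : I -> V) A : partial_sum f A = \sum_(i <- A) f i.
Proof. by rewrite /partial_sum big_seq_fsetE. Qed.

Lemma totally_cvgP f l : tcvg f l <->
  forall e : R, 0 < e -> exists A, forall B, fsubset A B ->
    normc (\sum_(i <- B) f i - l) < e.
Proof.
rewrite cvgCP; split => h e e0.
  by have [A _ hA] := h e e0; exists A => B /hA; rewrite -partial_sumE.
by have [A hA] := h e e0; exists A => // B /hA /=; rewrite -partial_sumE.
Qed.

Let sum_fsetU (V : zmodType) (f : I -> V) A B : fsubset A B ->
  \sum_(i <- B) f i = \sum_(i <- A) f i + \sum_(i <- (B `\` A)%fset) f i.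
Proof.
move=> /fsubsetP AB; rewrite (big_fsetID _ (mem A)) /=; congr (_ + _).
  by apply: eq_fbigl => i; rewrite !inE andb_idl//; exact: AB.
by apply: eq_fbigl => i; rewrite !inE andbC.
Qed.

Let le_sum_fset (g : I -> R) A B : (forall i, 0 <= g i) -> fsubset A B ->
  \sum_(i <- A) g i <= \sum_(i <- B) g i.
Proof. by move=> g0 AB; rewrite (sum_fsetU _ AB) lerDl sumr_ge0. Qed.

Let sum_seq_fset (V : zmodType) (f : I -> V) (s : seq I) : uniq s ->
  \sum_(i <- seq_fset tt s) f i = \sum_(i <- s) f i.
Proof.
move=> us; apply: perm_big; apply: uniq_perm => // i; exact: seq_fsetE.
Qed.

(** The limit of the absolute sums over the exhausting sets bounds all the absolute
    sums; what a finite set adds to an exhausting set whose absolute sum is close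
    to that limit is small.  The sets are images of lists of parameters. *)
Lemma sum_exhaust (T : eqType) (L : nat -> seq T) (kappa : T -> I) f (M : R) :
  (forall n, uniq (L n)) -> (forall n, {in L n &, injective kappa}) ->
  (forall n, {subset L n <= L n.+1}) ->
  (forall i, f i != 0 -> exists n, exists2 t, t \in L n & kappa t = i) ->
  (forall n, \sum_(t <- L n) normc (f (kappa t)) <= M) ->
  ccvg (fun n => \sum_(t <- L n) f (kappa t)) (summability.sum (f : I -> R[i]^o)).
Proof.
move=> uL iL sL exL bL.
pose S n : {fset I} := seq_fset tt [seq kappa t | t <- L n].
have SE (V : zmodType) (g : I -> V) n : \sum_(i <- S n) g i = \sum_(t <- L n) g (kappa t).
  by rewrite sum_seq_fset ?big_map// map_inj_in_uniq//; exact: iL.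
have sS n : fsubset (S n) (S n.+1).
  apply/fsubsetP => i; rewrite !seq_fsetE => /mapP[t tL ->].
  by apply: map_f; exact: sL.
have sSm m n : (m <= n)%N -> fsubset (S m) (S n).
  move=> /subnK <-; elim: (n - m)%N => [|k IH]; first exact: fsubset_refl.
  exact: fsubset_trans IH (sS _).
pose G n := \sum_(i <- S n) normc (f i).
have GM n : G n <= M by rewrite /G SE.
have diff (V : zmodType) (g : I -> V) n : \sum_(i <- S n.+1) g i - \sum_(i <- S n) g i =
    \sum_(i <- (S n.+1 `\` S n)%fset) g i.
  by rewrite (sum_fsetU g (sS n)) addrC addKr.
have ndG : nondecreasing_seq G.
  apply/nondecreasing_seqP => n; rewrite -subr_ge0 /G diff.
  by apply: sumr_ge0 => i _; exact: normc_ge0.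
have cG : cvgn G by apply: nondecreasing_is_cvgn => //; exists M => _ [n _ <-].
have [l hl] : exists l, ccvg (fun n => \sum_(i <- S n) f i) l.
  have [| |l hl] := @ccvg_abs_series _
    (fun n => \sum_(i <- S n.+1) f i - \sum_(i <- S n) f i) (fun n => G n.+1 - G n) (M - G 0%N).
  - by move=> n; rewrite /G !diff; exact: normc_sum.
  - by move=> n; rewrite -(big_mkord xpredT (fun k => G k.+1 - G k)) telescope_sumr// lerD2r.
  exists (l + \sum_(i <- S 0%N) f i).
  apply: (ccvg_ext (ccvgD hl (@ccvg_cst _ _))) => n.
  rewrite -(big_mkord xpredT (fun k => \sum_(i <- S k.+1) f i - \sum_(i <- S k) f i)).
  by rewrite telescope_sumr// subrK.
have fin (s : seq I) : exists n, forall i, i \in s -> f i != 0 -> i \in S n.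
  elim: s => [|i s [n hn]]; first by exists 0%N.
  have [fi|fi] := eqVneq (f i) 0.
    by exists n => j; rewrite inE => /orP[/eqP -> |/hn//]; rewrite fi eqxx.
  have [k [t tL ti]] := exL i fi; exists (maxn n k) => j; rewrite inE => /orP[/eqP -> _|js fj].
    apply: (fsubsetP (sSm k _ (leq_maxr _ _))); rewrite seq_fsetE -ti; exact: map_f.
  by apply: (fsubsetP (sSm n _ (leq_maxl _ _))); exact: hn.
have GJ (J : {fset I}) : \sum_(i <- J) normc (f i) <= limn G.
  have [n hn] := fin J; apply: le_trans (nondecreasing_cvgn_le ndG cG n).
  rewrite (bigID (fun i => f i == 0)) /= big1 ?add0r; last by move=> i /eqP ->; rewrite normc0.
  rewrite big_fset_condE; apply: le_sum_fset => [i|]; first exact: normc_ge0.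
  by apply/fsubsetP => i; rewrite !inE => /andP[]; exact: hn.
have tl : tcvg f l.
  apply/totally_cvgP => e e0; have e2 : 0 < e / 2 by rewrite divr_gt0.
  have /cvgrPdist_lt /(_ _ e2)[N _ hN] : G @ \oo --> limn G by [].
  have [N' hN'] := (ccvgP _ _).1 hl _ e2.
  pose n := maxn N N'; exists (S n) => J SJ.
  have h1 := hN' n (leq_maxr _ _).
  have h2 : limn G - G n < e / 2 by apply: le_lt_trans (hN n (leq_maxl _ _)); exact: ler_norm.
  have := GJ J; rewrite (sum_fsetU _ SJ) -/(G n) => h3.
  rewrite (sum_fsetU f SJ) addrAC; apply: le_lt_trans (normcD _ _) _.
  have := normc_sum (J `\` S n)%fset xpredT f; lra.
have -> : summability.sum (f : I -> R[i]^o) = l by exact: (cvg_lim (@norm_hausdorff _ R[i]^o) tl).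
by apply: (ccvg_ext hl) => n; exact: SE.
Qed.

(** All the sums over finite sets avoiding a suitable finite set are small; applied
    to the terms whose real (or imaginary) part has a given sign, this bounds
    their absolute sums. *)
Lemma totally_cvg_bounded f l : tcvg f l ->
  exists M : R, forall s : seq I, uniq s -> \sum_(i <- s) normc (f i) <= M.
Proof.
move=> /totally_cvgP/(_ 1 ltr01)[A hA].
have small (s : seq I) : uniq s -> {in s, forall i, i \notin A} -> normc (\sum_(i <- s) f i) <= 2.
  move=> us sA; pose B : {fset I} := seq_fset tt s.
  have BE : \sum_(i <- (A `|` B)%fset) f i = \sum_(i <- A) f i + \sum_(i <- s) f i.
    rewrite (sum_fsetU _ (fsubsetUl A B)); congr (_ + _).
    apply: perm_big; apply: uniq_perm => // i; rewrite !inE seq_fsetE.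
    case: (boolP (i \in s)) => [/sA ->//|_]; first by rewrite orbT.
    by rewrite orbF andNb.
  have h1 := hA (A `|` B)%fset (fsubsetUl _ _); have h2 := hA A (fsubset_refl _).
  have -> : \sum_(i <- s) f i = (\sum_(i <- (A `|` B)%fset) f i - l) - (\sum_(i <- A) f i - l).
    by rewrite BE; ring.
  by apply: le_trans (normcB _ _) _; lra.
have small_real (p : R[i] -> R) (s : seq I) :
    (forall z, `|p z| <= normc z) -> (forall s' : seq I, p (\sum_(i <- s') f i) = \sum_(i <- s') p (f i)) ->
    uniq s -> {in s, forall i, i \notin A} -> \sum_(i <- s) `|p (f i)| <= 4.
  move=> ple pS us sA; rewrite (bigID (fun i => 0 <= p (f i))) /=.
  have sub (P : pred I) : `|\sum_(i <- s | P i) p (f i)| <= 2.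
    rewrite -big_filter -pS; apply: le_trans (ple _) _; apply: small; first exact: filter_uniq.
    by move=> i; rewrite mem_filter => /andP[_ /sA].
  have h1 := sub (fun i => 0 <= p (f i)); have h2 := sub (fun i => ~~ (0 <= p (f i))).
  have -> : \sum_(i <- s | 0 <= p (f i)) `|p (f i)| = \sum_(i <- s | 0 <= p (f i)) p (f i).
    by apply: eq_bigr => i /ger0_norm.
  have -> : \sum_(i <- s | ~~ (0 <= p (f i))) `|p (f i)| = - \sum_(i <- s | ~~ (0 <= p (f i))) p (f i).
    by rewrite -sumrN; apply: eq_bigr => i; rewrite -ltNge => /ltr0_norm.
  by move: h1 h2; rewrite !ler_norml => /andP[_ ?] /andP[? _]; lra.
exists (\sum_(i <- A) normc (f i) + 8) => s us.
rewrite (bigID (mem A)) /=; apply: lerD.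
  rewrite -big_filter -sum_seq_fset ?filter_uniq//.
  apply: le_sum_fset => [i|]; first exact: normc_ge0.
  by apply/fsubsetP => i; rewrite seq_fsetE mem_filter => /andP[].
rewrite -big_filter; set s' := [seq _ <- _ | _].
have us' : uniq s' by exact: filter_uniq.
have sA : {in s', forall i, i \notin A} by move=> i; rewrite mem_filter => /andP[].
have h1 := small_real (@Re R) s' (@Re_le_normc R) (fun s => Re_sum s xpredT f) us' sA.
have h2 := small_real (@Im R) s' (@Im_le_normc R) (fun s => Im_sum s xpredT f) us' sA.
apply: (@le_trans _ _ (\sum_(i <- s') (`|Re (f i)| + `|Im (f i)|))).
  by apply: ler_sum => i _; exact: normc_le_ReIm.
by rewrite big_split /=; lra.
Qed.

Lemma totally_cvg_exhaust f l (L : nat -> seq I) : tcvg f l -> (forall n, uniq (L n)) ->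
  (forall i, exists n0, forall n, (n0 <= n)%N -> i \in L n) ->
  ccvg (fun n => \sum_(i <- L n) f i) l.
Proof.
move=> /totally_cvgP hf uL exL; apply/ccvgP => e /hf[A hA].
have [n0 hn0] : exists n0, forall n, (n0 <= n)%N -> {subset (A : seq I) <= L n}.
  elim: (A : seq I) => [|i s [k hk]]; first by exists 0%N.
  have [j hj] := exL i; exists (maxn j k) => n; rewrite geq_max => /andP[jn kn] x.
  by rewrite inE => /orP[/eqP ->|/(hk n kn)//]; exact: hj.
exists n0 => n /hn0 sA; rewrite -sum_seq_fset//; apply: hA.
by apply/fsubsetP => i; rewrite seq_fsetE; exact: sA.
Qed.

End UnorderedSums.

(** * The cosets of the Eisenstein series *)

Section Matrices.
Context {R : realType}.

Lemma mx2E (a b c d : R) :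
  [/\ mx2 a b c d 0 0 = a, mx2 a b c d 0 1 = b, mx2 a b c d 1 0 = c & mx2 a b c d 1 1 = d].
Proof. by split; rewrite !mxE. Qed.

Lemma mx2_eta (g : 'M[R]_2) : g = mx2 (g 0 0) (g 0 1) (g 1 0) (g 1 1).
Proof.
apply/matrixP => i j; rewrite !mxE.
have ord2 (k : 'I_2) : k = 0 \/ k = 1.
  by case: k => [[|[|//]] kp]; [left|right]; exact: val_inj.
by case: (ord2 i) => ->; case: (ord2 j) => ->.
Qed.

Lemma scale_mx2 (k a b c d : R) : k *: mx2 a b c d = mx2 (k * a) (k * b) (k * c) (k * d).
Proof. by rewrite [LHS]mx2_eta !mxE. Qed.

Lemma mul_mx2 (a b c d a' b' c' d' : R) : mx2 a b c d *m mx2 a' b' c' d' =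
  mx2 (a * a' + b * c') (a * b' + b * d') (c * a' + d * c') (c * b' + d * d').
Proof. by rewrite [LHS]mx2_eta !mxE !big_ord_recl !big_ord0 !mxE /= !addr0. Qed.

Lemma mx2_inj (a b c d a' b' c' d' : R) : mx2 a b c d = mx2 a' b' c' d' ->
  [/\ a = a', b = b', c = c' & d = d'].
Proof.
move=> E; have [h1 h2 h3 h4] := mx2E a b c d; have [k1 k2 k3 k4] := mx2E a' b' c' d'.
by split; [rewrite -h1 E|rewrite -h2 E|rewrite -h3 E|rewrite -h4 E].
Qed.

Lemma Im_mobius (a b c d x y : R) : 0 < y -> a * d - b * c = 1 ->
  Im (mobius (mx2 a b c d) (x +i* y)) = y / ((c * x + d) ^+ 2 + (c * y) ^+ 2).
Proof.
move=> y0 det; rewrite /mobius; have [-> -> -> ->] := mx2E a b c d.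
set num := _ + _; set den := _ + _.
have [nE1 nE2] : Re num = a * x + b /\ Im num = a * y.
  by rewrite /num ReD ImD ReCM ImCM /= addr0.
have [dE1 dE2] : Re den = c * x + d /\ Im den = c * y.
  by rewrite /den ReD ImD ReCM ImCM /= addr0.
have D0 : 0 < (c * x + d) ^+ 2 + (c * y) ^+ 2.
  rewrite lt_neqAle addr_ge0 ?sqr_ge0// andbT eq_sym paddr_eq0 ?sqr_ge0//.
  rewrite !sqrf_eq0 mulf_eq0 (gt_eqF y0) orbF; apply/negP => /andP[/eqP h /eqP c0].
  by move: h det; rewrite c0 mul0r add0r => ->; rewrite !mulr0 subrr => /esym/eqP; rewrite oner_eq0.
have den0 : den != 0.
  apply/eqP => den0; move: dE1 dE2 D0; rewrite den0 /= => <- <-.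
  by rewrite expr0n /= addr0 ltxx.
move: (num / den) (divfK den0 num) => Z E.
have E1 := congr1 (@Re R) E; have E2 := congr1 (@Im R) E.
rewrite ReM nE1 dE1 dE2 in E1; rewrite ImM nE2 dE1 dE2 in E2.
apply: (mulIf (lt0r_neq0 D0)); rewrite divfK ?gt_eqF//.
transitivity ((a * y) * (c * x + d) - (a * x + b) * (c * y)).
  by rewrite -E1 -E2; ring.
by rewrite -[RHS]mulr1 -det; ring.
Qed.

End Matrices.

Section Cosets.
Context {R : realType}.
Variable N : nat.
Implicit Types (g h : 'M[R]_2) (a b d n : int) (e q : nat) (sg : bool).

(** The triple (e, q, d) stands for the rows +/- sqrt e (q, d); the sign is
    normalised by q > 0, or d = 1 if q = 0, which forces e = 1. *)
Definition row := (nat * nat * int)%type.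

Definition is_row (t : row) := [&& (0 < t.1.1)%N && (t.1.1 %| N)%N, (N %/ t.1.1 %| t.1.2)%N,
  coprime (t.1.1 * `|t.2|) t.1.2 & (0 < t.1.2)%N || (t == (1%N, 0%N, 1))].

Definition row_det (t : row) a b := a * (t.1.1%:Z * t.2) - b * t.1.2%:Z = 1.

(** The square root of e, up to sign, carries over to the top row: the determinant
    is a e d - b q *)
Definition row_mx sg (t : row) a b : 'M[R]_2 :=
  let r := (-1) ^+ sg * Num.sqrt t.1.1%:R in
  mx2 (r * a%:~R) (r^-1 * b%:~R) (r * t.1.2%:R) (r * t.2%:~R).

Definition row_coset (t : row) : set 'M[R]_2 :=
  [set g | exists sg a b, row_det t a b /\ g = row_mx sg t a b].

Let sqrt_gt0 e : (0 < e)%N -> 0 < Num.sqrt e%:R :> R.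
Proof. by move=> e0; rewrite sqrtr_gt0 ltr0n. Qed.

Let sqrt_sq e : Num.sqrt e%:R ^+ 2 = e%:R :> R.
Proof. by rewrite sqr_sqrtr. Qed.

Let sqrt_spec e : (0 < e)%N ->
  exists r : R, [/\ r != 0, Num.sqrt e%:R = r & e%:R = r * r].
Proof.
move=> e0; exists (Num.sqrt e%:R); split; rewrite -?expr2 ?sqrt_sq//.
by rewrite gt_eqF// sqrt_gt0.
Qed.

Let sign_sq sg : (-1) ^+ sg * (-1) ^+ sg = 1 :> R.
Proof. by rewrite -expr2 sqrr_sign. Qed.

Lemma row_mx_Gamma sg t a b : is_row t -> row_det t a b -> Gamma0plus N (row_mx sg t a b).
Proof.
case: t => -[e q] d /and4P[/andP[/= e0 eN] Nq _ _] det.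
exists ((-1) ^+ sg * (e%:Z * a)), ((-1) ^+ sg * b), ((-1) ^+ sg * (e%:Z * q%:Z)), ((-1) ^+ sg * (e%:Z * d)), e.
split.
  split => //; move: det; rewrite /row_det /= => det.
  have sq : (-1) ^+ sg * (-1) ^+ sg = 1 :> int by rewrite -expr2 sqrr_sign.
  transitivity ((-1) ^+ sg * (-1) ^+ sg * e%:Z * (a * (e%:Z * d) - b * q%:Z)); first by ring.
  by rewrite sq det mulr1 mul1r.
split.
- by rewrite mulrCA dvdz_mulr.
- by rewrite mulrCA dvdz_mulr.
- rewrite dvdz_mull// -PoszM; change (N %| e * q)%N.
  by rewrite -(divnK eN) mulnC dvdn_mul.
rewrite /row_mx scale_mx2 /= !rmorphM !rmorphXn !rmorphN1 /= -!pmulrn.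
have [r [rn -> eE]] := sqrt_spec e0.
by rewrite invfM invr_sign eE; congr mx2; field.
Qed.

Let coprime_of_det e q d a b : a * (e%:Z * d) - b * q%:Z = 1 -> coprime (e * `|d|) q.
Proof.
move=> det; have : coprimez (e%:Z * d) q%:Z.
  by apply/coprimezP; exists (a, - b); rewrite /= mulNr.
by rewrite /coprimez /gcdz abszM /coprime.
Qed.

(** Both entries of the bottom row are divisible by e once the common factor
    e^(-1/2) is removed: d by definition, c because e divides N, which divides c.
    If c = 0 the determinant condition reads e a' d' = 1. *)
Lemma Gamma_row g : Gamma0plus N g ->
  exists sg t a b, [/\ is_row t, row_det t a b & g = row_mx sg t a b].
Proof.
move=> [a [b [c [d [e [[e0 det eN] [/dvdzP[a' aE] /dvdzP[d' dE] /dvdzP[c' cE] ->]]]]]]].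
have eZ : e%:Z != 0 by rewrite eqz_nat -lt0n.
pose q0 := c' * (N %/ e)%N%:Z.
have cE' : c = e%:Z * q0.
  by rewrite cE /q0 mulrCA -PoszM [(e * _)%N]mulnC divnK.
have det' : a' * (e%:Z * d') - b * q0 = 1.
  apply: (mulfI eZ); rewrite mulr1 -[RHS]det aE dE cE'; ring.
have Nq (sg : bool) : (N %/ e %| `|((-1) ^+ sg * q0)%R|)%N.
  by rewrite abszMsign /q0 abszM /= dvdn_mull.
have gE (sg : bool) : `|q0|%N%:Z = (-1) ^+ sg * q0 ->
    (Num.sqrt e%:R)^-1 *: mx2 a%:~R b%:~R c%:~R d%:~R =
    row_mx sg (e, `|q0|%N, (-1) ^+ sg * d') ((-1) ^+ sg * a') ((-1) ^+ sg * b).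
  move=> qE; rewrite /row_mx scale_mx2 /=.
  have -> : `|q0|%N%:R = (-1) ^+ sg * q0%:~R :> R.
    by rewrite pmulrn qE rmorphM rmorph_sign.
  rewrite aE dE cE' !rmorphM !rmorph_sign /= -!pmulrn.
  have [r [rn -> eE]] := sqrt_spec e0.
  have sq := sign_sq sg; rewrite invfM invr_sign eE.
  have sqE (z : R) : z = (-1) ^+ sg * (-1) ^+ sg * z by rewrite sq mul1r.
  by congr mx2; rewrite [LHS]sqE; field.
have dE' (sg : bool) : `|q0|%N%:Z = (-1) ^+ sg * q0 ->
    row_det (e, `|q0|%N, (-1) ^+ sg * d') ((-1) ^+ sg * a') ((-1) ^+ sg * b).
  move=> qE; rewrite /row_det /= qE.
  have sq : (-1) ^+ sg * (-1) ^+ sg = 1 :> int by rewrite -expr2 sqrr_sign.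
  transitivity ((-1) ^+ sg * (-1) ^+ sg * (a' * (e%:Z * d') - b * q0)); first by ring.
  by rewrite sq mul1r det'.
have is_rowE (sg : bool) : `|q0|%N%:Z = (-1) ^+ sg * q0 ->
    (0 < `|q0|)%N || ((e, `|q0|%N, (-1) ^+ sg * d') == (1%N, 0%N, 1)) ->
    is_row (e, `|q0|%N, (-1) ^+ sg * d').
  move=> qE hq; apply/and4P; split => //=; first by rewrite e0.
    by have := Nq sg; rewrite -qE absz_nat.
  exact: coprime_of_det (dE' sg qE).
suff [sg [qE hq]] : exists sg : bool, `|q0|%N%:Z = (-1) ^+ sg * q0 /\
    (0 < `|q0|)%N || ((e, `|q0|%N, (-1) ^+ sg * d') == (1%N, 0%N, 1)).
  exists sg, (e, `|q0|%N, (-1) ^+ sg * d'), ((-1) ^+ sg * a'), ((-1) ^+ sg * b).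
  by split; [exact: is_rowE|exact: dE'|exact: gE].
have [q00|q00] := eqVneq q0 0; last first.
  exists (q0 < 0); split; first by rewrite abszE normrEsign.
  by rewrite absz_gt0 q00.
exists (d' < 0); rewrite q00 mulr0 /=; split => //.
have : (`|a'| * (e * `|d'|) = 1)%N.
  by rewrite -(absz_nat e) -!abszM; move: det'; rewrite q00 mulr0 subr0 => ->.
move=> /eqP; rewrite !muln_eq1 => /and3P[_ /eqP -> /eqP d1].
by rewrite -normrEsign -abszE d1.
Qed.

Lemma row_exists t : is_row t -> exists a b, row_det t a b.
Proof.
case: t => -[e q] d /and4P[/= _ _ /= cop _].
have : coprimez (e%:Z * d) q%:Z by rewrite /coprimez /gcdz abszM.
by move=> /coprimezP[[u v] /= uv]; exists u, (- v); rewrite /row_det /= mulNr opprK.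
Qed.

Lemma Gamma_inftyP h : Gamma_infty N h <->
  exists sg n, h = mx2 ((-1) ^+ sg) ((-1) ^+ sg * n%:~R) 0 ((-1) ^+ sg).
Proof.
split; last first.
  move=> [sg [n ->]]; split; last by rewrite /= !mxE.
  exists ((-1) ^+ sg), ((-1) ^+ sg * n), 0, ((-1) ^+ sg), 1%N; split.
    by split; rewrite ?dvd1n// mulr0 subr0 -expr2 sqrr_sign.
  split; rewrite ?dvd1z ?dvdz0//.
  by rewrite sqrtr1 invr1 scale1r rmorphM !rmorph_sign rmorph0.
case=> [[a [b [c [d [e [[e0 det eN] [/dvdzP[a' aE] /dvdzP[d' dE] _ hE]]]]]]]] /= h10.
have eZ : e%:Z != 0 by rewrite eqz_nat -lt0n.
have c0 : c = 0.
  move: h10; rewrite hE scale_mx2 !mxE /= => /eqP.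
  by rewrite mulf_eq0 invr_eq0 gt_eqF ?sqrt_gt0//= intr_eq0 => /eqP.
have det' : a' * (e%:Z * d') = 1.
  by apply: (mulfI eZ); rewrite mulr1 -[RHS]det aE dE c0 mulr0 subr0; ring.
have e1 : e = 1%N.
  have : (`|a'| * (e * `|d'|) = 1)%N by rewrite -(absz_nat e) -!abszM det'.
  by move=> /eqP; rewrite !muln_eq1 => /and3P[_ /eqP].
rewrite e1 mul1r in det'.
have [sg aS] : exists sg : bool, a' = (-1) ^+ sg.
  have : (`|a'| * `|d'| = 1)%N by rewrite -abszM det'.
  move=> /eqP; rewrite muln_eq1 => /andP[/eqP a1 _].
  exists (a' < 0)%R; rewrite [LHS]intEsign a1 mulr1//.
have dS : d' = (-1) ^+ sg.
  by move: det'; rewrite aS => /(congr1 ( *%R ((-1) ^+ sg))); rewrite mulrA -expr2 sqrr_sign mul1r mulr1.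
exists sg, ((-1) ^+ sg * b).
rewrite hE scale_mx2 e1 sqrtr1 invr1 !mul1r aE dE c0 e1 !mulr1 aS dS rmorph0 rmorphM !rmorph_sign.
by rewrite mulrA sign_sq mul1r.
Qed.

Lemma mul_row_mx sg n sg' t a b : (0 < t.1.1)%N ->
  mx2 ((-1) ^+ sg) ((-1) ^+ sg * n%:~R) 0 ((-1) ^+ sg) *m row_mx sg' t a b =
  row_mx (sg (+) sg') t (a + n * t.1.2%:Z) (b + n * (t.1.1%:Z * t.2)).
Proof.
case: t => -[e q] d /= e0; rewrite /row_mx mul_mx2 /= signr_addb !rmorphD !rmorphM /= -!pmulrn.
have [r [rn -> eE]] := sqrt_spec e0.
by rewrite !invfM !invr_sign eE; congr mx2; field.
Qed.

(** Two matrices with the same bottom row differ by a translation, by an integer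
    because their top rows are integral in the same normalisation *)
Lemma right_coset_row sg t a b : is_row t -> row_det t a b ->
  right_coset (Gamma_infty N) (row_mx sg t a b) = row_coset t.
Proof.
move=> it det; have e0 : (0 < t.1.1)%N by case/and4P: it => /andP[].
apply/seteqP; split => [_ [h /Gamma_inftyP[sg' [n ->]] <-]|_ [sg' [a' [b' [det' ->]]]]].
  rewrite mul_row_mx//; exists (sg' (+) sg), (a + n * t.1.2%:Z), (b + n * (t.1.1%:Z * t.2)).
  by split => //; apply: etrans det; ring.
(* the upper right entry of row_mx sg' t a' b' * (row_mx sg t a b)^-1 *)
pose n := a * b' - a' * b.
exists (mx2 ((-1) ^+ (sg' (+) sg)) ((-1) ^+ (sg' (+) sg) * n%:~R) 0 ((-1) ^+ (sg' (+) sg))).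
  by apply/Gamma_inftyP; exists (sg' (+) sg), n.
rewrite mul_row_mx// -addbA addbb addbF; move: det det'; rewrite /row_det.
move: (t.1.1%:Z * t.2) (t.1.2%:Z) => u v det det'.
have bv : b * v = a * u - 1 by apply/eqP; rewrite eq_sym subr_eq addrC -subr_eq det.
have bv' : b' * v = a' * u - 1 by apply/eqP; rewrite eq_sym subr_eq addrC -subr_eq det'.
have au : a * u = b * v + 1 by rewrite bv subrK.
have au' : a' * u = b' * v + 1 by rewrite bv' subrK.
congr row_mx.
- transitivity (a + (a * (b' * v) - a' * (b * v))); first by rewrite /n; ring.
  by rewrite bv bv'; ring.
- transitivity (b + (b' * (a * u) - b * (a' * u))); first by rewrite /n; ring.
  by rewrite au au'; ring.
Qed.

(** By Bezout (d, q) generates 1, so e is a combination of e d^2, e d q and e q^2 *)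
Let dvd_of_rows e q d e' q' d' : coprimez d q%:Z ->
  e%:Z * d * d = e'%:Z * d' * d' -> e%:Z * d * q%:Z = e'%:Z * d' * q'%:Z ->
  e%:Z * q%:Z * q%:Z = e'%:Z * q'%:Z * q'%:Z -> (e' %| e)%N.
Proof.
move=> /coprimezP[[u v] /= uv] h1 h2 h3; change (e'%:Z %| e%:Z)%Z.
apply/dvdzP; exists (u * u * d' * d' + 2 * u * v * d' * q' + v * v * q' * q').
transitivity (e%:Z * (u * d + v * q) * (u * d + v * q)); first by rewrite uv !mulr1.
transitivity (u * u * (e%:Z * d * d) + 2 * u * v * (e%:Z * d * q) + v * v * (e%:Z * q * q)).
  by ring.
by rewrite h1 h2 h3; ring.
Qed.

(** The products of two entries of sqrt e (q, d) are integers that determine e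
    (dvd_of_rows); then q and d follow up to a common sign. *)
Lemma row_coset_inj t t' : is_row t -> is_row t' -> row_coset t = row_coset t' -> t = t'.
Proof.
move=> it it' tt'; have [a [b det]] := row_exists it.
have : row_coset t (row_mx false t a b) by exists false, a, b.
rewrite tt' => -[sg [a' [b' [det' /mx2_inj[_ _ rq rd]]]]].
case: t t' it it' {tt'} det det' rq rd => -[e q] d [[e' q'] d'].
move=> /and4P[/= /andP[e0 _] _ cop hq] /and4P[/= /andP[e'0 _] _ cop' hq'] _ _.
rewrite mul1r => rq rd.
have s0 := sqrt_gt0 e0; have s0' := sqrt_gt0 e'0.
have sq : ((-1) ^+ sg * Num.sqrt e'%:R) * ((-1) ^+ sg * Num.sqrt e'%:R) = e'%:R :> R.
  by rewrite mulrACA sign_sq mul1r -expr2 sqrt_sq.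
have prod (x y x' y' : int) :
    Num.sqrt e%:R * x%:~R = (-1) ^+ sg * Num.sqrt e'%:R * x'%:~R :> R ->
    Num.sqrt e%:R * y%:~R = (-1) ^+ sg * Num.sqrt e'%:R * y'%:~R :> R ->
    e%:Z * x * y = e'%:Z * x' * y'.
  move=> h1 h2; apply: (@intr_inj R); rewrite !intrM -!pmulrn -sq -(sqrt_sq e).
  have -> : Num.sqrt e%:R ^+ 2 * x%:~R * y%:~R = (Num.sqrt e%:R * x%:~R) * (Num.sqrt e%:R * y%:~R) :> R.
    by ring.
  by rewrite h1 h2; ring.
have cz (k : int) (u v : nat) : coprime (u * `|k|) v -> coprimez k v%:Z.
  by rewrite coprimeMl => /andP[_]; rewrite /coprimez /gcdz absz_nat.
have pq := prod q%:Z q%:Z q'%:Z q'%:Z rq rq.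
have pdq := prod d q%:Z d' q'%:Z rd rq.
have pd := prod d d d' d' rd rd.
have ee : e = e'.
  apply/eqP; rewrite eqn_dvd; apply/andP; split.
    exact: (@dvd_of_rows e' q' d' e q d (cz _ _ _ cop') (esym pd) (esym pdq) (esym pq)).
  exact: (@dvd_of_rows e q d e' q' d' (cz _ _ _ cop) pd pdq pq).
have rn : Num.sqrt e%:R != 0 :> R by rewrite gt_eqF.
subst e'; move: rq rd; rewrite ![(-1) ^+ sg * _]mulrC -!mulrA.
move=> /(mulfI rn) rq /(mulfI rn) rd.
case: sg rq rd {sq prod} => rq rd; last first.
  move: rq rd; rewrite expr0 !mul1r => /eqP; rewrite eqr_nat => /eqP ->.
  by move=> /intr_inj ->.
have q0 : q = 0%N /\ q' = 0%N.
  move: rq; rewrite expr1 mulN1r => /eqP; rewrite -addr_eq0 -natrD pnatr_eq0 addn_eq0.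
  by move=> /andP[/eqP -> /eqP ->].
case: q0 hq hq' => -> -> /= /eqP[_ ->] /eqP[_ ->].
by [].
Qed.

Lemma cosets_row K : cosets N K -> exists2 t, is_row t & K = row_coset t.
Proof.
move=> [g /Gamma_row[sg [t [a [b [it det ->]]]]] <-]; exists t => //.
exact: right_coset_row.
Qed.

Lemma row_cosets t : is_row t -> cosets N (row_coset t : set 'M[R]_2).
Proof.
move=> it; have [a [b det]] := row_exists it; exists (row_mx false t a b).
  exact: row_mx_Gamma.
exact: right_coset_row.
Qed.

Lemma Im_row_coset t (x y : R) : is_row t -> 0 < y ->
  Im (mobius (xget 1%:M (row_coset t)) (x +i* y)) =
  y / (t.1.1%:R * ((t.1.2%:R * x + t.2%:~R) ^+ 2 + (t.1.2%:R * y) ^+ 2)).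
Proof.
move=> it y0; have e0 : (0 < t.1.1)%N by case/and4P: it => /andP[].
have [a0 [b0 det0]] := row_exists it.
have : row_coset t (xget 1%:M (row_coset t)).
  by apply: (xgetPex _ (ex_intro _ (row_mx false t a0 b0) _)); exists false, a0, b0.
move=> [sg [a [b [det ->]]]]; have [r [rn rE eE]] := sqrt_spec e0.
have sq := sign_sq sg.
have sn : (-1) ^+ sg * r != 0 by rewrite mulf_neq0// signr_eq0.
have sq' : ((-1) ^+ sg * r) * ((-1) ^+ sg * r) = t.1.1%:R by rewrite mulrACA sq mul1r eE.
rewrite /row_mx rE; move: ((-1) ^+ sg * r) sn sq' => k kn kE.
rewrite Im_mobius//.
  by congr (_ / _); rewrite -kE; ring.
have := congr1 (fun i : int => i%:~R : R) det.
rewrite /= rmorph1 rmorphB !rmorphM /= -!pmulrn -kE => det1.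
by apply: etrans det1; field.
Qed.

End Cosets.

(** * Unfolding *)

Section Rows.
Variable (N : nat).
Implicit Types (n e q r k : nat) (t : row).

(** The windows - n q <= d < n q make the sums over the translates d = r + k q
    complete for every residue r *)
Definition row_box n : seq row :=
  [seq t <- [seq (p, d%:Z - (n * p.2)%N%:Z) | p <- [seq (e, q) | e <- divisors N, q <- iota 1 n],
                                          d <- iota 0 (2 * n * p.2)] | is_row N t].

Lemma mem_row_box n t : (0 < N)%N -> t \in row_box n =
  [&& is_row N t, (0 < t.1.2 <= n)%N & (- (n * t.1.2)%N%:Z <= t.2) && (t.2 < (n * t.1.2)%N%:Z)].
Proof.
move=> N0; rewrite mem_filter; case: (boolP (is_row N t)) => //= it.
apply/idP/idP.
  move=> /allpairsPdep[p [d [/allpairsP[[e q] /= [eN qn ->]] dn ->]]] /=.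
  by move: qn dn; rewrite !mem_iota /=; lia.
case: t it => -[e q] d /= /and4P[/= /andP[_ eN] _ _ _] /andP[/andP[q0 qn] /andP[d1 d2]].
apply/allpairsPdep; exists (e, q), (absz (d + (n * q)%N%:Z)); split => /=.
- apply/allpairsP; exists (e, q); split => //=; first by rewrite -dvdn_divisors.
  by rewrite mem_iota q0 /=; lia.
- by rewrite mem_iota /=; lia.
by congr (_, _); lia.
Qed.

Lemma row_box_uniq n : uniq (row_box n).
Proof.
apply/filter_uniq/allpairs_uniq_dep => /=.
- by apply: allpairs_uniq; [exact: divisors_uniq|exact: iota_uniq|move=> [? ?] [? ?]].
- by move=> p _; exact: iota_uniq.
move=> [[e q] d] [[e' q'] d'] _ _ /= [-> ->] E.
by congr (existT _ _ _); lia.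
Qed.

Let sum_blocks (V : zmodType) a q (G : nat -> V) :
  \sum_(0 <= d < a * q) G d = \sum_(r < q) \sum_(k < a) G (k * q + r)%N.
Proof.
rewrite exchange_big /=; elim: a => [|a IH]; first by rewrite mul0n big_geq// big_ord0.
rewrite big_ord_recr /= -IH mulSn addnC (@big_cat_nat _ _ _ (a * q)) ?leq_addr//=.
congr (_ + _); rewrite -{1}[(a * q)%N]add0n big_addn addKn big_mkord.
by apply: eq_bigr => r _; rewrite addnC.
Qed.

Lemma sum_row_box (V : zmodType) n (G : row -> V) : (0 < N)%N ->
  \sum_(t <- row_box n) G t = \sum_(e <- divisors N)
    \sum_(1 <= q < n.+1 | (N %/ e %| q)%N && coprime q e) \sum_(r < q | coprime r q)
    \sum_(k < 2 * n) G (e, q, (k * q + r)%N%:Z - (n * q)%N%:Z).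
Proof.
move=> N0; rewrite big_filter big_mkcond big_allpairs_dep /= big_allpairs /=.
rewrite big_seq [RHS]big_seq; apply: eq_bigr => e; rewrite -dvdn_divisors// => eN.
have e0 : (0 < e)%N by exact: dvdn_gt0 eN.
rewrite /index_iota subn1 /= [RHS]big_mkcond big_seq [RHS]big_seq.
apply: eq_bigr => q; rewrite mem_iota => /andP[q0 _].
have -> : iota 0 (2 * n * q) = index_iota 0 (2 * n * q) by rewrite /index_iota subn0.
rewrite sum_blocks.
case: ifP => [/andP[Nq qe]|h]; last first.
  rewrite big1// => r _; rewrite big1// => k _; case: ifP => // /and4P[_ /= Nq cop _].
  by move: h; rewrite Nq /=; move: cop; rewrite coprimeMl coprime_sym => /andP[->].
rewrite [RHS]big_mkcond; apply: eq_bigr => r _.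
have E k : is_row N (e, q, (k * q + r)%N%:Z - (n * q)%N%:Z) = coprime r q.
  rewrite /is_row /= e0 eN Nq q0 /= andbT coprimeMl [coprime e q]coprime_sym qe /=.
  rewrite /coprime; have -> : gcdn `|(k * q + r)%N%:Z - (n * q)%N%:Z| q = gcdn r q.
    have : gcdz q%:Z ((k%:Z - n%:Z) * q%:Z + r%:Z) = gcdz q%:Z r%:Z by exact: gcdzMDl.
    move=> [E]; rewrite gcdnC [RHS]gcdnC -E; congr (gcdn _ (absz _)); lia.
  by [].
case: ifP => rq; last by rewrite big1// => k _; rewrite E rq.
by apply: eq_bigr => k _; rewrite E rq.
Qed.

End Rows.

Section LatticeSums.
Context {R : realType}.
Notation mu := (@lebesgue_measure R).
Variables (s : R[i]) (y : R) (s_gt1 : 1 < Re s) (y_gt0 : 0 < y) (m : nat).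
Implicit Types (x u : R) (n k : nat).

Let T x : R[i] := cpow (x ^+ 2 + y ^+ 2) (- s).
Let chi x : R[i] := cis (- (2 * pi * m%:R * x)).

Definition translate_sum n u : R[i] := \sum_(k < 2 * n) T (u + (k%:R - n%:R)).
Definition translate_coef n (rho : R) : R[i] :=
  cintegral `[0, 1] (fun x => translate_sum n (x + rho) * chi x).
Definition power_fourier : R[i] := cintegral setT (fun x => T x * chi x).

Let ccont_T x : ccont T x. Proof. exact: ccont_quadratic_power. Qed.

Let ccont_chi x : ccont chi x.
Proof.
apply: ccont_comp; first exact: ccont_cis.
by apply: continuousN; apply: continuousM; first exact: cst_continuous.
Qed.

(** From x^2 <= 2 (u + x)^2 + 2 u^2 and u^2 <= 4 *)
Lemma lorentz_shift u x : `|u| <= 2 -> lorentz (u + x) <= 9 * lorentz x.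
Proof.
move=> u2; rewrite /lorentz ler_pdivlMr ?ltr_wpDr ?sqr_ge0// mulrC.
rewrite ler_pdivrMr ?ltr_wpDr ?sqr_ge0//.
have : u ^+ 2 <= 4.
  by rewrite -[u ^+ 2]real_normK ?num_real//; have := normr_ge0 u; nra.
have := sqr_ge0 (2 * u + x); have := sqr_ge0 (u + x).
rewrite !expr2; nra.
Qed.

Lemma lorentz_sum_bounded : exists B, forall n,
  \sum_(k < 2 * n) lorentz (k%:R - n%:R : R) <= B.
Proof.
have [B hB] := @riemann_bounded R 2 (ltr1n _ 2).
have le k : lorentz (k.+1%:R : R) <= expR (- (2 * ln k.+1%:R)).
  rewrite /lorentz expRN lef_pV2 ?posrE ?expR_gt0 ?ltr_wpDr ?sqr_ge0//.
  by rewrite expRM_natl lnK ?posrE// lerDr.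
exists (B + (1 + B)) => n; rewrite mul2n -addnn big_split_ord /=; apply: lerD.
  rewrite (reindex_inj rev_ord_inj) /=; apply: le_trans (hB n).
  apply: ler_sum => k _; apply: le_trans (le k); rewrite /lorentz.
  have -> : (n - k.+1)%:R - n%:R = - k.+1%:R :> R by rewrite natrB//; ring.
  by rewrite sqrrN.
case: n => [|n]; first by rewrite big_ord0; have := hB 0%N; rewrite big_ord0; lra.
rewrite big_ord_recl /=; apply: lerD.
  by rewrite addn0 subrr /lorentz expr0n addr0 invr1.
apply: le_trans (hB n); apply: ler_sum => k _; apply: le_trans (le k).
by rewrite natrD addrAC subrr add0r.
Qed.

Lemma translate_sum_bounded : exists2 M, 0 <= M & forall n u, `|u| <= 2 ->
  \sum_(k < 2 * n) normc (T (u + (k%:R - n%:R))) <= M.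
Proof.
have [C C0 hC] := quadratic_power_bound s_gt1 y_gt0.
have [B hB] := lorentz_sum_bounded.
have B0 : 0 <= B by have := hB 0%N; rewrite big_ord0.
exists (C * (9 * B)) => [|n u u2]; first by rewrite !mulr_ge0// ltW.
apply: le_trans (ler_wpM2l (ltW C0) (ler_wpM2l _ (hB n))) => //.
rewrite !mulr_sumr; apply: ler_sum => k _.
by apply: le_trans (hC _) (ler_wpM2l (ltW C0) (lorentz_shift _ u2)).
Qed.

Lemma ccont_sum (J : Type) (r : seq J) (P : pred J) (F : J -> R -> R[i]) x :
  (forall j, ccont (F j) x) -> ccont (fun x => \sum_(j <- r | P j) F j x) x.
Proof.
move=> cF; elim: r => [|j r IH].
  by under eq_fun do rewrite big_nil; exact: ccont_cst.
by under eq_fun do rewrite big_cons; case: (P j) => //; exact: ccontD.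
Qed.

Let ccont_Tshift c x : ccont (fun x => T (x + c)) x.
Proof.
apply: ccont_comp; first exact: ccont_T.
by apply: continuousD => //; exact: cst_continuous.
Qed.

Lemma ccont_translate n rho x : ccont (fun x => translate_sum n (x + rho)) x.
Proof.
apply: ccont_sum => k; under eq_fun do rewrite -addrA; exact: ccont_Tshift.
Qed.

Lemma normc_translate_coef : exists2 M, 0 <= M & forall n rho, 0 <= rho <= 1 ->
  normc (translate_coef n rho) <= M.
Proof.
have [M M0 hM] := translate_sum_bounded; exists M => // n rho /andP[r0 r1].
have := @normc_cintegral_itv _ (fun x => translate_sum n (x + rho) * chi x) 0 1 M ler01.
rewrite subr0 mulr1; apply.
  by move=> x _; apply: ccontM; [exact: ccont_translate|exact: ccont_chi].
move=> x /andP[x0 x1]; rewrite normcM normc_cis mulr1.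
apply: le_trans (normc_sum _ _ _) (hM n _ _).
by rewrite ger0_norm ?addr_ge0//; lra.
Qed.

Let chi_int x (j : nat) : chi (x + j%:R) = chi x.
Proof.
have -> : chi x = chi (x + j%:R) * cis ((m * j)%:R * (2 * pi)).
  by rewrite /chi -cisD; congr cis; rewrite natrM; ring.
by rewrite cisMn cis_2pi expr1n mulr1.
Qed.

Let glue (h : R -> R[i]) (a : R) n : (forall x, ccont h x) ->
  \sum_(k < n) cintegral `[0, 1] (fun x => h (x + (a + k%:R))) = cintegral `[a, a + n%:R] h.
Proof.
move=> ch; elim: n => [|n IH]; first by rewrite big_ord0 addr0 cintegral_itv1.
rewrite big_ord_recr /= IH (@cintegral_split _ h a (a + n%:R) (a + n.+1%:R)) ?lerDl//; last first.
  by rewrite lerD2l ler_nat.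
congr (_ + _); pose p x := x + (a + n%:R).
have p0 : p 0 = a + n%:R by rewrite /p add0r.
have p1 : p 1 = a + n.+1%:R by rewrite /p -natr1; ring.
have E : cintegral `[p 0, p 1] h = cintegral `[0, 1] (fun x => h (p x) * 1%:C).
  apply: (@cintegral_subst R h p (fun=> 1) (p 0 - 1) 0 1 ler01) => //.
  - by move=> x /andP[x0 _]; rewrite /p; lra.
  - move=> x _; have := is_deriveD (is_derive_id x 1) (is_derive_cst (a + n%:R) x 1).
    by rewrite addr0.
  - by move=> x _; exact: cst_continuous.
  - by rewrite /p lerD2r.
rewrite p0 p1 in E; rewrite E.
by apply: eq_cintegral => x _; rewrite mulr1.
Qed.

(** The integrals over [0, 1] of the translates glue to an integral over [- n, n],
    since the exponential has period 1; shifting by rho produces the phase. *)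
Lemma ccvg_translate_coef rho :
  ccvg (fun n => translate_coef n rho) (cis (2 * pi * m%:R * rho) * power_fourier).
Proof.
pose g x := T x * chi x; pose h x := T (x + rho) * chi x.
have cg x : ccont g x by apply: ccontM.
have ch x : ccont h x.
  by apply: ccontM; [exact: ccont_Tshift|exact: ccont_chi].
have ig : cintegrable setT g.
  have [C C0 hC] := quadratic_power_bound s_gt1 y_gt0.
  apply: (@cintegrable_le _ _ _ (fun x => C * lorentz x)) => //.
  - by apply: mfunC_cont => // x.
  - by apply: integrableZ_real => //; exact: integrable_lorentz.
  by move=> x _; rewrite /g normcM /chi normc_cis mulr1; exact: hC.
have hE : h = fun x => cis (2 * pi * m%:R * rho) * g (x + rho).
  apply/funext => x; have E : chi x = cis (2 * pi * m%:R * rho) * chi (x + rho).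
    by rewrite /chi -cisD; congr cis; ring.
  by rewrite /h /g E; exact: mulrCA.
have [] := cintegral_affine rho ltr01 cg ig; under eq_fun do rewrite mul1r.
move=> ig' _; have ih : cintegrable setT h by rewrite hE; exact: cintegrableZ.
have C1 := cvg_cintegral_exhaustT ih (@near_natNn R).
have -> : cis (2 * pi * m%:R * rho) * power_fourier = cintegral setT h.
  by rewrite hE (cintegralZ _ measurableT ig') (cintegral_shift rho cg ig).
apply: (ccvg_ext C1) => n.
rewrite -[X in `[_, X]](_ : - n%:R + (2 * n)%:R = n%:R :> R); last by rewrite natrM; ring.
rewrite -(glue _ _ ch) /translate_coef /translate_sum.
under [RHS]eq_cintegral do rewrite mulr_suml.
rewrite cintegral_sum; [|by []|]; last first.
  move=> k _; apply: ccont_cintegrable => x _; apply: ccontM; last exact: ccont_chi.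
  under eq_fun do rewrite -addrA; exact: ccont_Tshift.
apply: eq_bigr => k _; apply: eq_cintegral => x _; rewrite /h.
have -> : chi x = chi (x + (- n%:R + k%:R)).
  rewrite -(chi_int (x + (- n%:R + k%:R)) n) -(chi_int x k); congr chi; ring.
by congr (T _ * _); ring.
Qed.

End LatticeSums.

Section EisensteinExpansion.
Context {R : realType}.
Notation mu := (@lebesgue_measure R).
Variables (N : nat) (N_gt0 : (0 < N)%N) (s : R[i]) (s_gt1 : 1 < Re s).
Variables (y : R) (y_gt0 : 0 < y).
Implicit Types (x : R) (n e q k : nat) (t : row).

Let term x (K : set 'M[R]_2) : R[i] :=
  if K \in cosets N then cpow (Im (mobius (xget 1%:M K) (x +i* y))) s else 0.

Definition row_term x t : R[i] := cpow y s * (cpow t.1.1%:R (- s) *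
  (cpow t.1.2%:R (- (2 * s)) * cpow ((x + t.2%:~R / t.1.2%:R) ^+ 2 + y ^+ 2) (- s))).

Let termE x t : is_row N t -> (0 < t.1.2)%N -> term x (row_coset t) = row_term x t.
Proof.
move=> it q0; have e0 : (0 < t.1.1)%N by case/and4P: it => /andP[].
rewrite /term mem_set; last exact: row_cosets.
rewrite (Im_row_coset x it y_gt0) /row_term; case: t it q0 e0 => -[e q] d _ /= q0 e0.
have eR : 0 < e%:R :> R by rewrite ltr0n.
have qR : 0 < q%:R :> R by rewrite ltr0n.
set A := (x + _) ^+ 2 + _; have A0 : 0 < A by rewrite ltr_wpDl ?sqr_ge0// exprn_gt0.
have -> : (q%:R * x + d%:~R) ^+ 2 + (q%:R * y) ^+ 2 = q%:R * q%:R * A.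
  by rewrite /A; field; rewrite gt_eqF.
rewrite cpowMl ?invr_gt0 ?mulr_gt0// cpowVl ?mulr_gt0// !cpowMl ?mulr_gt0// !cpowN.
have -> : cpow q%:R (2 * s) = cpow q%:R s * cpow q%:R s :> R[i].
  by rewrite -cpowD; congr cpow; ring.
by rewrite !invfM.
Qed.

Let row0 : row := (1%N, 0%N, 1).

Let is_row0 : is_row N row0.
Proof. by rewrite /is_row /= dvd1n dvdn0 eqxx. Qed.

Let term0 x : term x (row_coset row0) = cpow y s.
Proof.
rewrite /term mem_set; last exact: row_cosets is_row0.
have -> : Im (mobius (xget 1%:M (row_coset row0)) (x +i* y)) = y; last by [].
have gen (a b c : R) : a = 1 -> b = 0 -> c = 1 ->
    y / (a * ((b * x + c) ^+ 2 + (b * y) ^+ 2)) = y.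
  by move=> -> -> ->; rewrite !mul0r add0r expr0n addr0 expr1n mulr1 divr1.
by rewrite (Im_row_coset x is_row0 y_gt0); apply: gen.
Qed.

Let box_row n t : t \in row_box N n -> is_row N t /\ (0 < t.1.2)%N.
Proof. by rewrite mem_row_box// => /and3P[h /andP[h' _] _]. Qed.

Let window_shift x n q k (r : nat) : (0 < q)%N ->
  x + ((k * q + r)%N%:Z - (n * q)%N%:Z)%:~R / q%:R = x + r%:R / q%:R + (k%:R - n%:R) :> R.
Proof.
move=> q0; rewrite rmorphB /= -!pmulrn natrD !natrM; field.
by rewrite pnatr_eq0 -lt0n.
Qed.

Lemma sum_row_term n x : \sum_(t <- row_box N n) row_term x t = cpow y s *
  \sum_(e <- divisors N) cpow e%:R (- s) *
    \sum_(1 <= q < n.+1 | (N %/ e %| q)%N && coprime q e) cpow q%:R (- (2 * s)) *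
      \sum_(r < q | coprime r q) translate_sum s y n (x + r%:R / q%:R).
Proof.
rewrite sum_row_box// mulr_sumr; apply: eq_bigr => e _; rewrite !mulr_sumr.
rewrite big_nat_cond [RHS]big_nat_cond; apply: eq_bigr => q /andP[/andP[q0 _] _].
rewrite !mulr_sumr; apply: eq_bigr => r _; rewrite /translate_sum !mulr_sumr.
by apply: eq_bigr => k _; rewrite /row_term /= window_shift.
Qed.

Lemma row_term_bounded : exists M, forall n x, 0 <= x <= 1 ->
  \sum_(t <- row_box N n) normc (row_term x t) <= M.
Proof.
have [M M0 hM] := translate_sum_bounded s_gt1 y_gt0.
have w2 : 2 < Re (2 * s) by rewrite mulr_natl mulr2n ReD; have := s_gt1; lra.
have [B hB] := ramanujan_bounded w2.
exists (\sum_(e <- divisors N) normc (cpow y s) * normc (cpow e%:R (- s) : R[i]) * (B * M)).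
move=> n x /andP[x0 x1]; rewrite sum_row_box//; apply: ler_sum => e _.
apply: (@le_trans _ _ (\sum_(1 <= q < n.+1 | (N %/ e %| q)%N && coprime q e)
    (normc (cpow y s) * normc (cpow e%:R (- s) : R[i]) * (ramanujan_bound (2 * s) q * M)))).
  rewrite big_nat_cond [X in _ <= X]big_nat_cond; apply: ler_sum => q /andP[/andP[q0 _] _].
  apply: (@le_trans _ _ (\sum_(r < q | coprime r q)
      (normc (cpow y s) * normc (cpow e%:R (- s) : R[i]) * (normc (cpow q%:R (- (2 * s)) : R[i]) * M)))).
    apply: ler_sum => r _; rewrite /row_term /=.
    under eq_bigr do rewrite !normcM !mulrA.
    rewrite -mulr_sumr !mulrA ler_wpM2l ?mulr_ge0 ?normc_ge0//.
    have qR : q%:R != 0 :> R by rewrite pnatr_eq0 -lt0n.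
    apply: le_trans (hM n (x + r%:R / q%:R) _); last first.
      have r0 : 0 <= r%:R / q%:R :> R by rewrite divr_ge0.
      have r1 : r%:R / q%:R <= 1 :> R.
        by rewrite ler_pdivrMr ?ltr0n// mul1r ler_nat ltnW.
      by rewrite ger0_norm ?addr_ge0//; lra.
    rewrite le_eqVlt; apply/orP; left; apply/eqP; apply: eq_bigr => k _.
    by rewrite window_shift.
  rewrite sumr_const -[X in X <= _]mulr_natl; apply: (@le_trans _ _ (q%:R * (normc (cpow y s) *
      normc (cpow e%:R (- s) : R[i]) * (normc (cpow q%:R (- (2 * s)) : R[i]) * M)))).
    rewrite ler_wpM2r ?mulr_ge0 ?normc_ge0// ler_nat.
    by rewrite (leq_trans (max_card _))// card_ord.
  rewrite mulrCA ler_wpM2l ?mulr_ge0 ?normc_ge0// mulrA ler_wpM2r//.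
  rewrite normc_cpow /ramanujan_bound raddfN mulNr.
  by rewrite -{1}[q%:R](@lnK R) ?posrE ?ltr0n// -expRD ler_expR; lra.
rewrite -mulr_sumr ler_wpM2l ?mulr_ge0 ?normc_ge0// -mulr_suml ler_wpM2r//.
apply: le_trans (hB n); rewrite big_mkcond; apply: ler_sum => q _.
by case: ifP => // _; exact: expR_ge0.
Qed.

(** The row (1, 0, 1) is the coset of the identity and contributes y ^ s *)
Lemma ccvg_eisenstein x : 0 <= x <= 1 ->
  ccvg (fun n => cpow y s + \sum_(t <- row_box N n) row_term x t) (eisenstein N (x +i* y) s).
Proof.
move=> x01; have [M hM] := row_term_bounded.
have C := @sum_exhaust R (set 'M[R]_2) row (fun n => row0 :: row_box N n) row_coset (term x)
  (normc (cpow y s) + M).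
have isr n t : t \in row0 :: row_box N n -> is_row N t.
  by rewrite inE => /orP[/eqP ->|/box_row[]].
apply: (ccvg_ext (C _ _ _ _ _)) => n.
- rewrite /= row_box_uniq andbT; apply/negP => /box_row[_].
  by rewrite ltnn.
- by move=> t t' /isr it /isr it'; exact: (row_coset_inj it it').
- move=> t; rewrite !inE => /orP[->//|]; rewrite !mem_row_box// => /and3P[it h1 h2].
  apply/orP; right; rewrite it /=; apply/andP; split; first by lia.
  rewrite mulSn; lia.
- rewrite /term; case: ifP => [/set_mem/cosets_row[t it ->] _|_]; last by rewrite eqxx.
  have : (0 < t.1.2)%N || (t == row0) by case/and4P: it.
  move=> /orP[q0|/eqP tE]; last by exists 0%N, t; rewrite ?tE ?inE ?eqxx.
  pose k := (t.1.2 + `|t.2|%N.+1)%N; exists k, t => //.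
  rewrite inE mem_row_box// it q0 /=; apply/orP; right.
  have : (k <= k * t.1.2)%N by rewrite leq_pmulr.
  have : (t.1.2 <= k)%N by rewrite leq_addr.
  have : (`|t.2|%N < k)%N by rewrite ltn_addl.
  by move: (k * _)%N => kq; lia.
- rewrite big_cons term0 lerD2l; apply: le_trans (hM n x x01).
  rewrite le_eqVlt; apply/orP; left; apply/eqP; apply: eq_big_seq => t /box_row[it q0].
  by rewrite termE.
rewrite big_cons term0; congr (_ + _).
by apply: eq_big_seq => t /box_row[it q0]; rewrite termE.
Qed.

End EisensteinExpansion.

Section EisensteinCoefficient.
Context {R : realType}.
Notation mu := (@lebesgue_measure R).
Variables (N : nat) (N_gt0 : (0 < N)%N) (s : R[i]) (s_gt1 : 1 < Re s).
Variables (y : R) (y_gt0 : 0 < y) (m : nat).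
Implicit Types (x : R) (n e q k : nat).

Let chi x : R[i] := cis (- (2 * pi * m%:R * x)).

Let cis_int (j : int) : cis (2 * pi * j%:~R) = 1 :> R[i].
Proof.
have nat (n : nat) : cis (2 * pi * n%:R) = 1 :> R[i].
  by rewrite mulrC cisMn cis_2pi expr1n.
case: j => n; first exact: nat.
rewrite NegzE rmorphN mulrN; apply: (mulIf (cis_neq0 (2 * pi * n.+1%:R))).
by rewrite -cisD addNr cis0 mul1r [RHS]nat.
Qed.

Let rdrv_freq (c : R) x : rdrv (fun x => cis (c * x)) x ('i * cis (c * x) * c%:C).
Proof.
apply: (rdrv_comp (rdrv_cis (c * x))).
have h := is_deriveZ c (is_derive_id x 1).
by apply: (is_derive_eq h); rewrite [LHS]mulr1.
Qed.

Let ccont_freq (c : R) x : ccont (fun x => cis (c * x)) x.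
Proof. exact: rdrv_ccont (rdrv_freq c x). Qed.

Let integral_cis (j : int) : cintegral `[0, 1] (fun x => cis (2 * pi * j%:~R * x)) =
  if j == 0 then 1 else 0 :> R[i].
Proof.
case: eqVneq => [->|j0].
  rewrite (@eq_cintegral _ _ (fun x : R => (1%R)%:C)); last first.
    by move=> x _; rewrite mulr0 mul0r cis0.
  by rewrite cintegral_real Rintegral_itv_cst// subr0 mulr1.
pose c : R := 2 * pi * j%:~R.
have c0 : c != 0 by rewrite !mulf_neq0 ?intr_eq0// gt_eqF// pi_gt0.
have cC : 'i * c%:C != 0 :> R[i].
  rewrite mulf_neq0 //; first by rewrite -normc_gt0 normc_i ltr01.
  by rewrite (_ : 0 = 0%:C)// (inj_eq (@complexI _)).
rewrite (@cintegral_FTC2 _ (fun x => ('i * c%:C)^-1 * cis (c * x)) _ 0 1 ler01).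
- by rewrite mulr1 mulr0 cis0 cis_int subrr.
- move=> x _; have := rdrvZ (('i * c%:C)^-1) (rdrv_freq c x).
  by apply: rdrv_eq; rewrite [X in _ * X]mulrAC (mulKf cC).
by move=> x _; exact: ccont_freq.
Qed.

Let coef (f : R -> R[i]) : R[i] := cintegral `[0, 1] (fun x => f x * chi x).

Let ccont_chi x : ccont chi x.
Proof.
have -> : chi = fun x => cis (- (2 * pi * m%:R) * x).
  by apply/funext => t; rewrite /chi mulNr.
exact: ccont_freq.
Qed.

Let cintegrable_coef (f : R -> R[i]) : (forall x, ccont f x) ->
  cintegrable `[0, 1] (fun x => f x * chi x).
Proof. by move=> cf; apply: ccont_cintegrable => x _; exact: ccontM (cf x) (ccont_chi x). Qed.

Let m01 : measurable (`[0%R, 1%R]%classic : set R). Proof. exact: measurable_itv. Qed.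

Let coefZ (c : R[i]) (f : R -> R[i]) : (forall x, ccont f x) ->
  coef (fun x => c * f x) = c * coef f.
Proof.
move=> cf; rewrite /coef -(cintegralZ c m01 (cintegrable_coef cf)).
by apply: eq_cintegral => x _; rewrite mulrA.
Qed.

Let coef_sum (J : Type) (r : seq J) (P : pred J) (F : J -> R -> R[i]) :
  (forall j x, ccont (F j) x) ->
  coef (fun x => \sum_(j <- r | P j) F j x) = \sum_(j <- r | P j) coef (F j).
Proof.
move=> cF; rewrite /coef.
rewrite -(cintegral_sum r m01 (fun j (_ : P j) => cintegrable_coef (cF j))).
by apply: eq_cintegral => x _; rewrite mulr_suml.
Qed.

Let ccontZ (c : R[i]) (f : R -> R[i]) x : ccont f x -> ccont (fun x => c * f x) x.
Proof. by move=> cf; apply: ccontM => //; exact: ccont_cst. Qed.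

Lemma row_term_coef n :
  cintegral `[0, 1] (fun x => (\sum_(t <- row_box N n) row_term s y x t) * chi x) =
  cpow y s * \sum_(e <- divisors N) cpow e%:R (- s) *
    \sum_(1 <= q < n.+1 | (N %/ e %| q)%N && coprime q e) cpow q%:R (- (2 * s)) *
      \sum_(r < q | coprime r q) translate_coef s y m n (r%:R / q%:R).
Proof.
have cG (c : R) x := ccont_translate s y_gt0 n c x.
have c1 q x : ccont (fun x => \sum_(r < q | coprime r q) translate_sum s y n (x + r%:R / q%:R)) x.
  by apply: ccont_sum => r; exact: cG.
have c2 e x : ccont (fun x => \sum_(1 <= q < n.+1 | (N %/ e %| q)%N && coprime q e)
    cpow q%:R (- (2 * s)) * \sum_(r < q | coprime r q) translate_sum s y n (x + r%:R / q%:R)) x.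
  by apply: ccont_sum => q; apply: ccontZ; exact: c1.
under eq_cintegral => x _ do rewrite sum_row_term//.
rewrite -/(coef _) coefZ; last by move=> x; apply: ccont_sum => e; apply: ccontZ; exact: c2.
congr (_ * _); rewrite coef_sum; last by move=> e x; apply: ccontZ; exact: c2.
apply: eq_bigr => e _; rewrite coefZ; last exact: c2.
congr (_ * _); rewrite coef_sum; last by move=> q x; apply: ccontZ; exact: c1.
apply: eq_bigr => q _; rewrite coefZ; last exact: c1.
by congr (_ * _); rewrite coef_sum// => r x; exact: cG.
Qed.

(** The n-th Fourier coefficient is close to a partial sum of the Ramanujan series
    times power_fourier; the errors tend to 0 for each modulus q and are bounded
    by q ^ (1 - 2 Re s), so that tannery applies. *)
Lemma ccvg_row_term_coef :
  ccvg (fun n => cintegral `[0, 1] (fun x => (\sum_(t <- row_box N n) row_term s y x t) * chi x))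
    (cpow y s * (\sum_(e <- divisors N) cpow e%:R (- s) * ramanujan_series (2 * s) m e (N %/ e)) *
     power_fourier s y m).
Proof.
have w2 : 2 < Re (2 * s) by rewrite mulr_natl mulr2n ReD; have := s_gt1; lra.
have [B hB] := ramanujan_bounded w2.
have [M M0 hM] := normc_translate_coef s_gt1 y_gt0 m.
pose F := power_fourier s y m.
have term (e : nat) : ccvg (fun n => \sum_(1 <= q < n.+1 | (N %/ e %| q)%N && coprime q e)
    cpow q%:R (- (2 * s)) * \sum_(r < q | coprime r q) translate_coef s y m n (r%:R / q%:R))
    (F * ramanujan_series (2 * s) m e (N %/ e)).
  pose u n q : R[i] := if (N %/ e %| q)%N && coprime q e then
    cpow q%:R (- (2 * s)) * \sum_(r < q | coprime r q)
      (translate_coef s y m n (r%:R / q%:R) - rational_phase m r q * F) else 0.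
  have cu : ccvg (fun n => \sum_(1 <= q < n.+1) u n q) 0.
    apply: (@tannery _ _ (fun q => ramanujan_bound (2 * s) q * (M + normc F)) (B * (M + normc F))).
    - move=> n q q0; have MF : 0 <= M + normc F by rewrite addr_ge0 ?normc_ge0.
      rewrite /u; case: (_ && _); last by rewrite normc0 mulr_ge0 ?expR_ge0.
      rewrite normcM.
      apply: (@le_trans _ _ (normc (cpow q%:R (- (2 * s)) : R[i]) * (q%:R * (M + normc F)))).
        rewrite ler_wpM2l ?normc_ge0//; apply: le_trans (normc_sum _ _ _) _.
        apply: (@le_trans _ _ (\sum_(r < q | coprime r q) (M + normc F))).
          apply: ler_sum => r _; apply: le_trans (normcB _ _) _.
          rewrite normcM normc_cis mul1r lerD2r; apply: hM.
          rewrite divr_ge0//= ler_pdivrMr ?ltr0n// mul1r ler_nat ltnW//.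
        rewrite sumr_const -[X in X <= _]mulr_natl ler_wpM2r// ler_nat.
        by rewrite (leq_trans (max_card _))// card_ord.
      rewrite mulrA ler_wpM2r// normc_cpow /ramanujan_bound raddfN mulNr.
      by rewrite -{2}[q%:R](@lnK R) ?posrE ?ltr0n// -expRD ler_expR; lra.
    - move=> n; rewrite -mulr_suml ler_wpM2r// addr_ge0// normc_ge0//.
    move=> q; rewrite /u; case: (_ && _); last exact: ccvg_cst.
    have C (r : 'I_q) : ccvg (fun n => if coprime r q then
        translate_coef s y m n (r%:R / q%:R) - rational_phase m r q * F else 0) 0.
      case: (coprime r q); last exact: ccvg_cst.
      have C := @ccvg_translate_coef R s y s_gt1 y_gt0 m (r%:R / q%:R).
      have E : cis (2 * pi * m%:R * (r%:R / q%:R)) = rational_phase m r q :> R[i].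
        by congr cis; rewrite !mulrA.
      have := ccvgB C (@ccvg_cst _ (rational_phase m r q * F)).
      by rewrite E subrr.
    have C1 := @ccvg_sum _ _ (index_enum 'I_q) _ (fun=> 0) C; rewrite big1_eq in C1.
    have C2 := ccvgZ (c := cpow q%:R (- (2 * s))) C1; rewrite mulr0 in C2.
    apply: (ccvg_ext C2) => n.
    by rewrite [in RHS]big_mkcond.
  have C := ccvgD cu (ccvgZ (c := F) (@ccvg_ramanujan_series R (2 * s) w2 m e (N %/ e))).
  rewrite add0r in C; apply: (ccvg_ext C) => n.
  rewrite mulr_sumr /u -big_mkcond /= -big_split /=; apply: eq_bigr => q _.
  rewrite sumrB -mulr_suml -/(ramanujan_sum m q) /ramanujan_term; ring.
have C := ccvgZ (c := cpow y s) (@ccvg_sum _ _ (divisors N) _ _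
  (fun e => ccvgZ (c := cpow e%:R (- s)) (term e))).
have -> : cpow y s * (\sum_(e <- divisors N) cpow e%:R (- s) * ramanujan_series (2 * s) m e (N %/ e)) *
     power_fourier s y m = cpow y s * \sum_(e <- divisors N) cpow e%:R (- s) * (F * ramanujan_series (2 * s) m e (N %/ e)).
  rewrite -mulrA mulr_suml; congr (_ * _); apply: eq_bigr => e _; rewrite /F; ring.
by apply: (ccvg_ext C) => n; rewrite row_term_coef.
Qed.

Let coefB (f g : R -> R[i]) : (forall x, ccont f x) -> (forall x, ccont g x) ->
  coef (fun x => f x - g x) = coef f - coef g.
Proof.
move=> cf cg; rewrite /coef -(cintegralB m01 (cintegrable_coef cf) (cintegrable_coef cg)).
by apply: eq_cintegral => x _; rewrite mulrBl.
Qed.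

Let coef_cis (k : int) : coef (fun x => cis (2 * pi * k%:~R * x)) = if k == m%:Z then 1 else 0.
Proof.
rewrite -(subr_eq0 k) -integral_cis; apply: eq_cintegral => x _.
by rewrite /chi -cisD; congr cis; rewrite rmorphB /= -pmulrn; ring.
Qed.

Let coef_cst (c : R[i]) : (0 < m)%N -> coef (fun=> c) = 0.
Proof.
move=> m0; have -> : (fun=> c) = (fun x : R => c * cis (2 * pi * 0%:~R * x)).
  by apply/funext => x; rewrite mulr0 mul0r cis0 mulr1.
rewrite coefZ; last by move=> x; exact: ccont_freq.
by rewrite coef_cis eq_sym -[0]/(Posz 0) eqz_nat gtn_eqF// mulr0.
Qed.

(** The Whittaker function at x = 0 *)
Definition bessel_coef (k : int) : R[i] :=
  2 * (Num.sqrt (`|k|%:~R * y))%:C * besselK (s - 2^-1) (2 * pi * `|k|%:~R * y).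

Let whittakerE (k : int) x :
  whittaker s k (x +i* y) = bessel_coef k * cis (2 * pi * k%:~R * x).
Proof.
rewrite /whittaker /bessel_coef /=; congr (_ * _); rewrite /e /cis; congr cexp.
have -> : (k%:~R : R[i]) = (k%:~R : R)%:C by rewrite rmorph_int.
by apply: eqC; rewrite ?ReM ?ImM /=; ring.
Qed.

Let window n : seq int := [seq k%:Z - n%:Z | k <- iota 0 (2 * n).+1].

Let window_uniq n : uniq (window n).
Proof. by rewrite map_inj_uniq ?iota_uniq// => j k E; lia. Qed.

Let mem_window n (k : int) : (k \in window n) = (`|k| <= n)%N.
Proof.
apply/idP/idP => [/mapP[j]|h]; first by rewrite mem_iota; lia.
by apply/mapP; exists (absz (k + n%:Z)); [rewrite mem_iota; lia|lia].
Qed.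

(** The expansion is integrated against the m-th exponential over a period, the
    Eisenstein series being replaced by its partial sums *)
Lemma fourier_coefficient (phi0 : R[i] -> R[i]) (phi : int -> R[i] -> R[i]) :
  (0 < m)%N -> eisenstein_fourier_coefs N phi0 phi ->
  phi m%:Z s * bessel_coef m%:Z =
  cpow y s * (\sum_(e <- divisors N) cpow e%:R (- s) * ramanujan_series (2 * s) m e (N %/ e)) *
    power_fourier s y m.
Proof.
move=> m0 phiP; pose c (k : int) : R[i] := if k == 0 then 0 else phi k s * bessel_coef k.
pose a : R[i] := phi0 s * cpow y (1 - s).
pose E x : R[i] := eisenstein N (x +i* y) s.
have tot x : partial_sum (fun k : int => (c k * cis (2 * pi * k%:~R * x)) : R[i]^o) @ totally -->
    (E x - cpow y s - a : R[i]^o).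
  have := phiP s s_gt1 (x +i* y) y_gt0.
  rewrite [X in partial_sum X @ _](_ : _ = (fun k : int => (c k * cis (2 * pi * k%:~R * x)) : R[i]^o)) //.
  apply/funext => k; rewrite /c; case: eqP => _; first by rewrite mul0r.
  by rewrite whittakerE mulrA.
have [M1 hM1] := row_term_bounded N_gt0 s_gt1 y_gt0.
have [M2 hM2] := totally_cvg_bounded (tot 0).
pose S n x : R[i] := \sum_(t <- row_box N n) row_term s y x t.
pose P n x : R[i] := \sum_(k <- window n) c k * cis (2 * pi * k%:~R * x).
(* both sides of the expansion, truncated at n *)
pose D n x : R[i] := S n x - (P n x + a).
have cS n x : ccont (S n) x.
  have -> : S n = fun x => cpow y s * \sum_(e <- divisors N) cpow e%:R (- s) *
      \sum_(1 <= q < n.+1 | (N %/ e %| q)%N && coprime q e) cpow q%:R (- (2 * s)) *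
        \sum_(r < q | coprime r q) translate_sum s y n (x + r%:R / q%:R).
    by apply/funext => u; exact: sum_row_term.
  apply: ccontZ; apply: ccont_sum => e; apply: ccontZ; apply: ccont_sum => q.
  by apply: ccontZ; apply: ccont_sum => r; exact: (ccont_translate s y_gt0 n _ x).
have cP n x : ccont (P n) x by apply: ccont_sum => k; apply: ccontZ; exact: ccont_freq.
have cPa n x : ccont (fun x => P n x + a) x by apply: ccontD; [exact: cP|exact: ccont_cst].
have cD n x : ccont (D n) x.
  by apply: ccontD; [exact: cS|apply: ccontN; exact: cPa].
have limD x : 0 <= x <= 1 -> ccvg (fun n => D n x * chi x) 0.
  move=> x01; have C1 := ccvg_eisenstein N_gt0 s_gt1 y_gt0 x01.
  have C2 : ccvg (fun n => P n x) (E x - cpow y s - a).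
    apply: (totally_cvg_exhaust (tot x)) => // k.
    by exists `|k|%N => n kn; rewrite mem_window.
  have C3 := ccvgZ (c := chi x) (ccvgB (ccvgB C1 C2) (@ccvg_cst _ (cpow y s + a))).
  have Z : chi x * (eisenstein N (x +i* y) s - (E x - cpow y s - a) - (cpow y s + a)) = 0.
    by rewrite /E; ring.
  rewrite Z in C3; apply: (ccvg_ext C3) => n; rewrite /D /S; ring.
have bD n x : 0 <= x <= 1 -> normc (D n x * chi x) <= M1 + (M2 + normc a).
  move=> x01; rewrite normcM /chi normc_cis mulr1.
  apply: le_trans (normcB _ _) (lerD _ _).
    exact: le_trans (normc_sum _ _ _) (hM1 n x x01).
  apply: le_trans (normcD _ _) _; rewrite lerD2r.
  apply: le_trans (normc_sum _ _ _) _; apply: le_trans (hM2 (window n) (window_uniq n)).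
  by apply: ler_sum => k _; rewrite !normcM !normc_cis.
have CD : ccvg (fun n => coef (D n)) 0.
  have h1 n : mfunC `[0, 1] (fun x => D n x * chi x).
    by apply: mfunC_cont => // x; apply: ccontM; [exact: cD|exact: ccont_chi].
  have h2 x : `[0, 1]%classic x -> ccvg (fun n => D n x * chi x) 0.
    by rewrite /= in_itv /=; exact: limD.
  have h3 n x : `[0, 1]%classic x -> normc (D n x * chi x) <= M1 + (M2 + normc a).
    by rewrite /= in_itv /=; exact: bD.
  have [_] := cintegral_dominated m01 h1 h2 (integrable_itv_cst 0 1 _) h3.
  by rewrite cintegral0.
have cm : c m%:Z = phi m%:Z s * bessel_coef m%:Z by rewrite /c eqz_nat gtn_eqF.
have DE n : (m <= n)%N -> coef (D n) = coef (S n) - c m%:Z.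
  move=> mn; rewrite /D (coefB (cS n) (cPa n)).
  congr (_ - _); rewrite -[RHS]addr0 -(coef_cst a m0).
  have cPk (k : int) x : ccont (fun x => c k * cis (2 * pi * k%:~R * x)) x.
    by apply: ccontZ; exact: ccont_freq.
  have -> : coef (fun x => P n x + a) = coef (P n) + coef (fun=> a).
    rewrite /coef -(cintegralD m01 (cintegrable_coef (cP n)) (cintegrable_coef (fun=> @ccont_cst _ a _))).
    by apply: eq_cintegral => x _; rewrite mulrDl.
  congr (_ + _).
  have CS : coef (P n) = \sum_(k <- window n) coef (fun x => c k * cis (2 * pi * k%:~R * x)).
    exact: (@coef_sum int (window n) xpredT (fun (k : int) x => c k * cis (2 * pi * k%:~R * x)) cPk).
  rewrite CS.
  have mw : m%:Z \in window n by rewrite mem_window.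
  rewrite (bigD1_seq m%:Z mw (window_uniq n)) /= big1 ?addr0.
    rewrite coefZ; last by move=> x; exact: ccont_freq.
    by rewrite coef_cis eqxx mulr1.
  move=> k km; rewrite coefZ; last by move=> x; exact: ccont_freq.
  by rewrite coef_cis (negbTE km) mulr0.
have C := ccvgB ccvg_row_term_coef CD; rewrite subr0 in C.
rewrite -cm; apply: (ccvg_uniq _ C); apply/ccvgP => d d0; exists m => n mn.
by rewrite DE// -/(coef _) -/(S n) opprB addrCA subrr addr0 subrr normc0.
Qed.

End EisensteinCoefficient.

(** * The coefficient formula and its continuation *)

Section CoefficientFormula.
Context {R : realType}.
Implicit Types (s z : R[i]).

Lemma sqrt_cpow (x : R) : 0 < x -> (Num.sqrt x)%:C = cpow x 2^-1 :> R[i].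
Proof.
move=> x0; have two : (2^-1 : R[i]) = (2^-1 : R)%:C by rewrite fmorphV rmorph_nat.
rewrite /cpow two -rmorphM cexp_real; congr (_%:C).
rewrite -[in LHS](lnK (x0 : x \is Num.pos)).
have -> : expR (ln x) = expR (2^-1 * ln x) ^+ 2 by rewrite expr2 -expRD; congr expR; lra.
by rewrite sqrtr_sqr ger0_norm ?expR_ge0.
Qed.

(** At a height y where the Bessel factor does not vanish, fourier_coefficient can
    be divided by it.  By fourier_bessel the transform of the power is the same
    factor divided by Gamma s, which in turn cannot vanish; the powers of y
    cancel. *)
Lemma coefficient_formula N m (phi0 : R[i] -> R[i]) (phi : int -> R[i] -> R[i]) s :
  (0 < N)%N -> squarefree N -> (0 < m)%N -> eisenstein_fourier_coefs N phi0 phi ->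
  1 < Re s ->
  phi m%:Z s = cpow pi s * (cpow m%:R (s - 1) / Gamma s) *
    (sigma (1 - 2 * s) m / zeta (2 * s)) * DN N m s.
Proof.
move=> N0 sfN m0 phiP s1.
have mR : 0 < m%:R :> R by rewrite ltr0n.
have pi0 := pi_gt0 R.
have w2 : 2 < Re (2 * s) by rewrite mulr_natl mulr2n ReD; lra.
have [Y Y0 K0] := besselK_neq0 (s - 2^-1).
have [y y0 yE] : exists2 y : R, 0 < y & 2 * pi * m%:R * y = Y.
  exists (Y / (2 * pi * m%:R)); first by rewrite divr_gt0 ?mulr_gt0.
  by rewrite mulrC divfK// gt_eqF// !mulr_gt0.
have FC := fourier_coefficient N0 s1 y0 m0 phiP.
have FB := fourier_bessel s1 y0 mR.
rewrite -/(power_fourier s y m) yE in FB.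
have absm : (`|m%:Z|%:~R : R) = m%:R by [].
rewrite /bessel_coef absm yE (ramanujan_series_DN w2 N0 sfN m0 erefl) in FC.
have AZ := ramanujan_series_zeta w2 m0.
have Z0 := zeta_neq0 w2.
rewrite -[sigma _ _]AZ (mulfK Z0).
set q := (Num.sqrt (m%:R * y))%:C in FC.
set K := besselK _ _ in FC FB K0.
set I := power_fourier s y m in FC FB.
set A := ramanujan_series _ _ _ _ in FC *.
set P := cpow (pi * m%:R / y) (s - 2^-1) in FB.
set rp := (Num.sqrt pi)%:C in FB.
have qE : q = cpow (m%:R * y) 2^-1 by rewrite /q sqrt_cpow// mulr_gt0.
have rpE : rp = cpow pi 2^-1 by exact: sqrt_cpow.
have q0 : q != 0 by rewrite qE; exact: cpow_neq0.
have key : cpow y s * rp * P = q * (cpow pi s * cpow m%:R (s - 1)).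
  rewrite rpE qE /P.
  rewrite !cpowMl ?mulr_gt0 ?invr_gt0// cpowVl// -cpowN /cpow -!cexpD; congr cexp.
  by field.
have G0 : Gamma s != 0.
  apply/eqP => G0; move/eqP: FB; rewrite G0 mul0r eq_sym !mulf_eq0 (negbTE K0).
  by rewrite rpE /P !(negbTE (cpow_neq0 _ _)) pnatr_eq0.
have two0 : (2 : R[i]) != 0 by rewrite pnatr_eq0.
apply: (mulIf (mulf_neq0 (mulf_neq0 (mulf_neq0 two0 q0) K0) G0)).
transitivity (cpow y s * (A * DN N m s) * (Gamma s * I)).
  by rewrite mulrA FC; ring.
rewrite FB; transitivity ((cpow y s * rp * P) * (A * DN N m s * 2 * K)); first by ring.
by rewrite key; field.
Qed.

Let meromorphic_cpow (t : R) (f : R[i] -> R[i]) z : (forall w, cderivable f w) ->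
  meromorphic_at (fun w => cpow t (f w)) z.
Proof. by move=> df; apply: meromorphic_entire => w; exact: cderivable_cpow. Qed.

Let cderivable_affine (a b w : R[i]) : cderivable (fun w => a * w + b) w.
Proof.
apply: cderivableD; last exact: cderivable_cst.
by apply: cderivableM; [exact: cderivable_cst|exact: cderivable_id].
Qed.

Let meromorphic_cpow_affine (t : R) (a b z : R[i]) (f : R[i] -> R[i]) :
  (forall w, f w = a * w + b) -> meromorphic_at (fun w => cpow t (f w)) z.
Proof.
move=> fE; apply: meromorphic_cpow => w; have -> : f = fun w => a * w + b by exact/funext.
exact: cderivable_affine.
Qed.

Let meromorphic_Fp p m z : meromorphic_at (fun s => Fp p m (2 * s)) z.
Proof.
apply: meromorphicM.
  apply: meromorphicB; first exact: meromorphic_cst.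
  apply: meromorphicV; apply: (@meromorphic_cpow_affine _ 2 0) => w; ring.
apply: meromorphic_sum => j _; apply: meromorphicV.
by apply: (@meromorphic_cpow_affine _ (j%:R * 2) (- j%:R)) => w; ring.
Qed.

Let meromorphic_DN N m z : meromorphic_at (DN N m) z.
Proof.
apply: meromorphic_sum => v _; apply: meromorphicM; first apply: meromorphicM.
- by apply: (@meromorphic_cpow_affine _ (- 1) 0) => w; ring.
- by apply: meromorphic_prod => p _; apply: meromorphicV; exact: meromorphic_Fp.
apply: meromorphic_prod => p _; apply: meromorphicB; first exact: meromorphic_cst.
by apply: meromorphicV; exact: meromorphic_Fp.
Qed.

Lemma meromorphic_coefficient N m z :
  meromorphic_at (fun s => cpow pi s * (cpow m%:R (s - 1) / Gamma s) *
    (sigma (1 - 2 * s) m / zeta (2 * s)) * DN N m s) z.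
Proof.
apply: meromorphicM; last exact: meromorphic_DN.
apply: meromorphicM; first apply: meromorphicM.
- by apply: (@meromorphic_cpow_affine _ 1 0) => w; ring.
- apply: meromorphicM; last by apply: meromorphicV; exact: meromorphic_Gamma.
  by apply: (@meromorphic_cpow_affine _ 1 (- 1)) => w; ring.
apply: meromorphicM; last by apply: meromorphicV; exact: meromorphic_zeta2.
apply: meromorphic_sum => d _.
by apply: (@meromorphic_cpow_affine _ (- 2) 1) => w; ring.
Qed.

End CoefficientFormula.

Theorem theorem8 (R : realType) (N : nat) (N_gt0 : (0 < N)%N)
    (N_squarefree : squarefree N) (m : nat) (m_gt0 : (0 < m)%N)
    (phi0 : R[i] -> R[i]) (phi : int -> R[i] -> R[i])
    (phiP : eisenstein_fourier_coefs N phi0 phi) :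
  meromorphic_continuation [set s : R[i] | 1 < Re s] (phi m%:Z)
    (fun s => cpow pi s * (cpow m%:R (s - 1) / Gamma s) *
              (sigma (1 - 2 * s) m / zeta (2 * s)) * DN N m s).
Proof.
split=> [z|z z1]; first exact: meromorphic_coefficient.
exact: coefficient_formula N_gt0 N_squarefree m_gt0 phiP z1.
Qed.
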